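(* Let $d\ge 2$ and let $\Omega\subset\mathbb{R}^d$ be a bounded domain with Neumann eigenvalues $0=\mu_1<\mu_2\le\mu_3\le\cdots$. For every integer $k\ge 1$ put $$m_k:=C_d\left(\frac{k}{|\Omega|}\right)^{2/d},\qquad S_k:=\frac{\frac{d+2}{d}\,\frac1k\sum_{j=1}^k\mu_j}{m_k}.$$ Then for all $k\ge 1$ the Neumann eigenvalue $\mu_{k+1}$ satisfies $$m_k^2(1-S_k)\ \ge\ (\mu_{k+1}-m_k)^2,$$ i.e. $$m_k\left(1-\sqrt{1-S_k}\right)\le \mu_{k+1}\le m_k\left(1+\sqrt{1-S_k}\right).$$
   Context: $|\Omega|$ denotes the $d$-dimensional volume of $\Omega$. $B_d=\pi^{d/2}/\Gamma(1+d/2)$ is the volume of the unit ball in $\mathbb{R}^d$, and $C_d=(2\pi)^2B_d^{-2/d}$. The Neumann eigenvalues are those of $-\Delta u=\mu u$ in $\Omega$, $\partial u/\partial n=0$ on $\partial\Omega$, understood through the quadratic form $Q(f,f)=\int_\Omega|\nabla f|^2\,dx$ on $L^2(\Omega)$, whose form domain consists of restrictions to $\Omega$ of functions in the Sobolev space $H^1(\mathbb{R}^d)=H^1_0(\mathbb{R}^d)$ (normally the same as $H^1(\Omega)$). Standing assumption: the spectrum of this Neumann Laplacian consists of an ordered sequence of eigenvalues $0=\mu_1<\mu_2\le\mu_3\le\cdots$ (repeated according to multiplicity) tending to infinity. *)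

(* Defs.v *)
From HB Require Import structures.
From mathcomp Require Import all_boot all_order all_algebra.
From mathcomp Require Import all_classical all_reals all_analysis.

Set Implicit Arguments.
Unset Strict Implicit.
Unset Printing Implicit Defensive.

Import Order.TTheory GRing.Theory Num.Theory.
Import numFieldNormedType.Exports.

Local Open Scope classical_set_scope.
Local Open Scope ring_scope.

(* The Borel sigma-algebra of R^n, presented as the product sigma-algebra: it
   is generated by the coordinate functions. *)
Section measurable_rV.
Context {R : realType} (n : nat).

Let coord (i : 'I_n) (x : 'rV[R]_n) : measurableTypeR R := x ord0 i.

Let rV_set0 : g_sigma_preimage coord set0.
Proof. exact: sigma_algebra0. Qed.

Let rV_setC A : g_sigma_preimage coord A -> g_sigma_preimage coord (~` A).
Proof. exact: sigma_algebraC. Qed.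

Let rV_bigcup (F : _^nat) : (forall i, g_sigma_preimage coord (F i)) ->
  g_sigma_preimage coord (\bigcup_i (F i)).
Proof. exact: sigma_algebra_bigcup. Qed.

HB.instance Definition _ :=
  @isMeasurable.Build (measure_tuple_display (R.-ocitv.-measurable).-sigma)
    'rV[R]_n (g_sigma_preimage coord) rV_set0 rV_setC rV_bigcup.

End measurable_rV.

Section lebesgue_rV.
Context {R : realType}.

Lemma measurable_rV_coord n (i : 'I_n) :
  measurable_fun setT (fun x : 'rV[R]_n => x ord0 i : measurableTypeR R).
Proof.
move=> _ Y mY; rewrite setTI; apply: sub_sigma_algebra => /=.
rewrite -bigcup_seq/=; exists i => /=; first by rewrite mem_index_enum.
by exists Y => //; rewrite setTI.
Qed.

Lemma measurable_fun_rVP d (T : measurableType d) n (f : T -> 'rV[R]_n) :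
  (forall i, measurable_fun setT (fun x => f x ord0 i : measurableTypeR R)) ->
  measurable_fun setT f.
Proof.
move=> mf _ A mA; rewrite setTI.
suff: measurable `<=` [set B | measurable (f @^-1` B)] by exact.
apply: smallest_sub.
  split => /=; first by rewrite preimage_set0.
  - by move=> B mB; rewrite setTD preimage_setC; exact: measurableC.
  - by move=> F mF; rewrite preimage_bigcup; exact: bigcup_measurable.
move=> B; rewrite -bigcup_seq => -[i /= _ [Y mY <-]].
by rewrite setTI; have := mf i measurableT _ mY; rewrite setTI.
Qed.

Definition rV_cons n (p : measurableTypeR R * 'rV[R]_n) : 'rV[R]_n.+1 :=
  row_mx (p.1)%:M p.2 : 'rV[R]_(1 + n).

Definition rV_uncons n (x : 'rV[R]_n.+1) : measurableTypeR R * 'rV[R]_n :=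
  (x ord0 ord0, \row_j x ord0 (lift ord0 j)).

Lemma rV_cons0 n (p : measurableTypeR R * 'rV[R]_n) :
  rV_cons p ord0 ord0 = p.1.
Proof.
have := row_mxEl (p.1%:M : 'rV[R]_1) p.2 ord0 ord0.
rewrite [in RHS]mxE eqxx mulr1n => <-.
by congr (row_mx _ _ _ _); exact: val_inj.
Qed.

Lemma rV_consS n (p : measurableTypeR R * 'rV[R]_n) j :
  rV_cons p ord0 (lift ord0 j) = p.2 ord0 j.
Proof.
rewrite -(row_mxEr (p.1%:M : 'rV[R]_1) p.2 ord0 j).
by congr (row_mx _ _ _ _); exact: val_inj.
Qed.

Lemma rV_consK n : cancel (@rV_cons n) (@rV_uncons n).
Proof.
move=> [a v]; congr pair => /=; first by rewrite rV_cons0.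
by apply/rowP => j; rewrite mxE rV_consS.
Qed.

Lemma rV_unconsK n : cancel (@rV_uncons n) (@rV_cons n).
Proof.
move=> x; apply/rowP => i.
case: (unliftP ord0 i) => [j ->|->]; last by rewrite rV_cons0.
by rewrite rV_consS mxE.
Qed.

Lemma measurable_rV_cons n : measurable_fun setT (@rV_cons n).
Proof.
apply: measurable_fun_rVP => i; case: (unliftP ord0 i) => [j ->|->].
  rewrite (_ : (fun _ => _) = (fun v : 'rV[R]_n => v ord0 j) \o snd).
    by apply: measurableT_comp => //; exact: measurable_rV_coord.
  by apply/funext => x /=; rewrite rV_consS.
by rewrite (_ : (fun _ => _) = fst)//; apply/funext => x /=; rewrite rV_cons0.
Qed.

Lemma measurable_rV_uncons n : measurable_fun setT (@rV_uncons n).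
Proof.
apply/measurable_fun_pairP; split; first exact: measurable_rV_coord.
apply: measurable_fun_rVP => j.
rewrite (_ : (fun _ => _) = (fun v : 'rV[R]_n.+1 => v ord0 (lift ord0 j))).
  exact: measurable_rV_coord.
by apply/funext => x /=; rewrite mxE.
Qed.

Section lebesgue_rVS.
Local Open Scope ereal_scope.
Context n (m : {sigma_finite_measure set 'rV[R]_n -> \bar R}).

Definition lebesgue_rVS : set 'rV[R]_n.+1 -> \bar R :=
  pushforward (lebesgue_measure \x m) (@rV_cons n).

Let lebesgue_rVS0 : lebesgue_rVS set0 = 0.
Proof. by rewrite /lebesgue_rVS /pushforward preimage_set0 measure0. Qed.

Let lebesgue_rVS_ge0 A : 0 <= lebesgue_rVS A.
Proof.
exact: (@measure_ge0 _ _ _ (product_measure1 lebesgue_measure m)).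
Qed.

Let lebesgue_rVS_sigma_additive : semi_sigma_additive lebesgue_rVS.
Proof.
have mcons A : measurable A -> measurable (@rV_cons n @^-1` A).
  by move=> mA; rewrite -[X in measurable X]setTI; exact: measurable_rV_cons.
move=> F mF tF mUF; rewrite /lebesgue_rVS /pushforward preimage_bigcup.
apply: measure_semi_sigma_additive.
- by move=> i; exact: mcons.
- apply/trivIsetP => /= i j _ _ ij; rewrite -preimage_setI.
  by move/trivIsetP : tF => /(_ _ _ _ _ ij) ->//; rewrite preimage_set0.
- by rewrite -preimage_bigcup; exact: mcons.
Qed.

HB.instance Definition _ := isMeasure.Build _ _ _ lebesgue_rVS
  lebesgue_rVS0 lebesgue_rVS_ge0 lebesgue_rVS_sigma_additive.

Let lebesgue_rVS_sigma_finite : sigma_finite setT lebesgue_rVS.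
Proof.
have /sigma_finiteP[F [TF ndF Foo]] := sigma_finiteT (@lebesgue_measure R).
have /sigma_finiteP[G [TG ndG Goo]] := sigma_finiteT m.
exists (fun i => @rV_uncons n @^-1` (F i `*` G i)).
  apply/esym; rewrite -subTset => x _.
  have [k _ Fk] : (\bigcup_i F i) (rV_uncons x).1 by rewrite -TF.
  have [l _ Gl] : (\bigcup_i G i) (rV_uncons x).2 by rewrite -TG.
  exists (maxn k l) => //; split.
  - by move: Fk; exact/subsetPset/ndF/leq_maxl.
  - by move: Gl; exact/subsetPset/ndG/leq_maxr.
move=> k; have [mF Fy] := Foo k; have [mG Gy] := Goo k.
have mFG : measurable (F k `*` G k) by exact: measurableX.
split; first by rewrite -[X in measurable X]setTI; exact: measurable_rV_uncons.
rewrite /lebesgue_rVS /pushforward -comp_preimage.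
rewrite (_ : _ \o _ = id); last by apply/funext => p /=; rewrite rV_consK.
by rewrite preimage_id product_measure1E// lte_mul_pinfty// ge0_fin_numE.
Qed.

HB.instance Definition _ := Measure_isSigmaFinite.Build _ _ _ lebesgue_rVS
  lebesgue_rVS_sigma_finite.

End lebesgue_rVS.

(* Lebesgue measure on R^n, as an iterated product measure. *)
Fixpoint lebesgue_rV n : {sigma_finite_measure set 'rV[R]_n -> \bar R} :=
  if n is n'.+1 then lebesgue_rVS (lebesgue_rV n') else \d_(0 : 'rV[R]_0).

Lemma lebesgue_rV_prod n (A : 'I_n -> set (measurableTypeR R)) :
  (forall i, measurable (A i)) ->
  lebesgue_rV n [set x : 'rV[R]_n | forall i, A i (x ord0 i)] =
  (\big[*%E/1]_(i < n) lebesgue_measure (A i))%E.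
Proof.
elim: n A => [|n IH] A mA /=.
  by rewrite big_ord0 diracE mem_set// => -[].
rewrite big_ord_recl -IH; last by move=> i; exact: mA.
rewrite -product_measure1E//; last first.
  pose B (i : 'I_n) :=
    [set x : 'rV[R]_n | A (lift ord0 i) (x ord0 i)].
  rewrite (_ : [set _ | _] = \bigcap_(i in [set: 'I_n]) B i); last first.
    by apply/seteqP; split=> x /= Bx i *; exact: Bx.
  apply: fin_bigcap_measurable => [|i _]; first exact: finite_finset.
  have := @measurable_rV_coord n i measurableT _ (mA (lift ord0 i)).
  by rewrite setTI.
rewrite /lebesgue_rVS /pushforward; congr (_ _).
apply/seteqP; split => -[a v] /=.
  move=> Aav; split=> [|i]; first by have := Aav ord0; rewrite rV_cons0.
  by have := Aav (lift ord0 i); rewrite rV_consS.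
move=> [Aa Av] i.
by case: (unliftP ord0 i) => [j ->|->]; rewrite ?rV_consS ?rV_cons0//; exact: Av.
Qed.

End lebesgue_rV.

Section sobolev.
Context {R : realType} (n : nat).
Implicit Types (phi F : 'rV[R]_n -> R) (G : 'I_n -> 'rV[R]_n -> R)
  (D : set 'rV[R]_n).

Definition partial (i : 'I_n) phi : 'rV[R]_n -> R :=
  fun x => 'D_(delta_mx ord0 i : 'rV[R]_n) phi x.

Definition iter_partial (s : seq 'I_n) phi : 'rV[R]_n -> R :=
  foldr partial phi s.

Definition smooth phi := forall s : seq 'I_n,
  continuous (iter_partial s phi) /\
  forall i x, derivable (iter_partial s phi) x (delta_mx ord0 i).

Definition test_function phi :=
  smooth phi /\ compact (closure [set x | phi x != 0]).

(* Elements of L^2(D) are represented by functions on R^n, only the values on D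
   being relevant, and are identified when almost everywhere equal on D. *)
Definition L2 D (f : 'rV[R]_n -> R) :=
  measurable_fun D f /\
  (\int[lebesgue_rV n]_(x in D) ((f x) ^+ 2)%:E < +oo)%E.

Definition L2_dot D (f g : 'rV[R]_n -> R) : R :=
  \int[lebesgue_rV n]_(x in D) (f x * g x).

Definition L2_norm D f : R := Num.sqrt (L2_dot D f f).

(* F belongs to H^1(R^n) and G is its gradient in the sense of distributions. *)
Definition H1_grad F G :=
  [/\ L2 setT F, forall i, L2 setT (G i) &
      forall phi, test_function phi -> forall i,
        \int[lebesgue_rV n]_x (F x * partial i phi x) =
        - \int[lebesgue_rV n]_x (G i x * phi x)].

End sobolev.

Section neumann.
Context {R : realType} (n : nat).
Implicit Types (Omega : set 'rV[R]_n) (u f : 'rV[R]_n -> R)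
  (G : 'I_n -> 'rV[R]_n -> R).

(* u belongs to the form domain, i.e., u is the restriction to Omega of an
   element of H^1(R^n), and G coincides on Omega with the gradient of u. *)
Definition neumann_form_domain Omega u G :=
  L2 Omega u /\ exists F, H1_grad F G /\ ae_eq (lebesgue_rV n) Omega u F.

Definition neumann_form Omega (G K : 'I_n -> 'rV[R]_n -> R) : R :=
  \sum_(i < n) L2_dot Omega (G i) (K i).

(* The graph of the operator associated with the form: u is in the domain of
   the Neumann Laplacian, which maps it to f. *)
Definition neumann_laplacian Omega u f :=
  L2 Omega f /\
  exists G, neumann_form_domain Omega u G /\
    forall v K, neumann_form_domain Omega v K ->
      neumann_form Omega G K = L2_dot Omega f v.

(* lam is in the resolvent set when the operator minus lam is a bijection onto
   L^2(Omega) with a bounded inverse; injectivity follows from the estimate. *)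
Definition neumann_resolvent_set Omega : set R := [set lam |
  (forall f, L2 Omega f ->
     exists u, neumann_laplacian Omega u (fun x => f x + lam * u x)) /\
  exists C : R, forall u f,
    neumann_laplacian Omega u (fun x => f x + lam * u x) ->
    L2_norm Omega u <= C * L2_norm Omega f].

Definition neumann_spectrum Omega : set R := ~` neumann_resolvent_set Omega.

Definition neumann_eigenfunction Omega (lam : R) u :=
  neumann_laplacian Omega u (fun x => lam * u x).

(* The eigenspace of lam has a basis with k elements. *)
Definition neumann_multiplicity Omega (lam : R) (k : nat) :=
  exists e : 'I_k -> 'rV[R]_n -> R,
    (forall i, neumann_eigenfunction Omega lam (e i)) /\
    forall u, neumann_eigenfunction Omega lam u ->
      exists! c : 'rV[R]_k,
        ae_eq (lebesgue_rV n) Omega u (fun x => \sum_(i < k) c ord0 i * e i x).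

(* The eigenvalues are indexed from 1, and mu 0 is irrelevant. *)
Definition neumann_eigenvalues Omega (mu : nat -> R) :=
  [/\ forall i j, (1 <= i <= j)%N -> mu i <= mu j,
      mu @ \oo --> +oo%R,
      neumann_spectrum Omega = mu @` [set j | (1 <= j)%N] &
      forall lam, exists2 k, ([set j | (1 <= j)%N /\ mu j = lam] #= `I_k)%card &
        neumann_multiplicity Omega lam k].

End neumann.

Section constants.
Context {R : realType}.

(* Euler's Gamma function, for 0 < x. *)
Definition Gamma (x : R) : R :=
  \int[lebesgue_measure]_(t in `]0%R, +oo[%classic) (t `^ (x - 1) * expR (- t)).

Definition ball_volume (d : nat) : R :=
  pi `^ (d%:R / 2) / Gamma (1 + d%:R / 2).

Definition weyl_constant (d : nat) : R :=
  (2 * pi) ^+ 2 * ball_volume d `^ (- 2 / d%:R).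

Definition volume (d : nat) (Omega : set 'rV[R]_d) : R :=
  fine (lebesgue_rV d Omega).

Definition weyl_m (d : nat) (Omega : set 'rV[R]_d) (k : nat) : R :=
  weyl_constant d * (k%:R / volume Omega) `^ (2 / d%:R).

Definition weyl_S (d : nat) (Omega : set 'rV[R]_d) (mu : nat -> R) (k : nat) : R :=
  ((d%:R + 2) / d%:R * (k%:R^-1 * \sum_(1 <= j < k.+1) mu j)) / weyl_m Omega k.

End constants.

(* Main.v *)
Require Import Defs.
From HB Require Import structures.
From mathcomp Require Import all_boot all_order all_algebra finmap.
From mathcomp Require Import all_classical all_reals all_analysis.
From mathcomp Require Import measurable_realfun ssrAC ring lra.
Set Implicit Arguments.
Unset Strict Implicit.
Unset Printing Implicit Defensive.
Import Order.TTheory GRing.Theory Num.Theory.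
Import numFieldNormedType.Exports.
Local Open Scope classical_set_scope.
Local Open Scope ring_scope.

(** Let x = mu_(k+1), let u_1, ..., u_k be orthonormal eigenfunctions, and let
   e_xi be the plane wave e^(i xi.y) restricted to Omega. Once its projection on
   the u_j is subtracted, e_xi becomes an element of the form domain orthogonal to
   the u_j, whose Rayleigh quotient is therefore at least x. Expanding this gives
   Kroeger's inequality

     sum_(j <= k) (x - mu_j) |<u_j, e_xi>|^2 >= (x - |xi|^2) |Omega|,

   where the right-hand side may be replaced by its positive part since the
   left-hand side is nonnegative. Integrating over xi yields, by Plancherel's
   formula,

     (2 pi)^d sum_(j <= k) (x - mu_j)
       >= |Omega| integral (x - |xi|^2)_+ dxi
        = |Omega| x^(1 + d/2) B_d / (1 + d/2).

   In terms of y = x / m_k this is (d/2) S_k <= (1 + d/2) y - y^(1 + d/2), and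
   Bernoulli's inequality y^(d/2) >= 1 + (d/2) (y - 1) turns it into
   S_k <= 2 y - y^2, that is (y - 1)^2 <= 1 - S_k.

   Three steps of this argument follow an indirect route.

   The eigenvalues are given through the spectrum, and the lower bound of the
   Rayleigh quotient on the orthogonal of the u_j must be deduced from it
   ([rayleigh_orth], [variational_inequality]). If the infimum lam of this
   quotient were smaller than x, it would be isolated from the right in the
   spectrum ([resolvent_gap]), hence an eigenvalue ([bottom_eigenvector], by a
   power iteration which uses the completeness of L^2,
   [L2_geometric_complete]), and all its eigenvectors would be combinations of
   the u_j ([eigen_system_full]).

   Instead of all xi, only those of a lattice h Z^d are used, where h = pi / L and
   Omega is contained in [-L, L]^d. The plane waves are then orthogonal on this
   cube and Bessel's inequality ([wave_bessel]) replaces Plancherel's formula.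
   That plane waves belong to the form domain is [cutwave_form_domain].

   The lattice sums of (x - |xi|^2)_+ are compared with the constant
   pi^(d/2) / Gamma (2 + d/2) without computing the volume of a ball: by
   homogeneity, the bound for all meshes h amounts to a bound on
   sum_z (t - s |z|^2)_+ for all t, whose Laplace transform in t is a product of
   one-dimensional theta sums; these tend to the Gaussian integral as s tends to 0
   ([lattice_gamma_limit]). *)

(** * Semi-inner products *)

Section semi_inner.
Context {R : realType} {V : lmodType R}.
Implicit Types (b : V -> V -> R) (u v w : V).

(** Functions are not identified when equal almost everywhere, whence a form that
   is only semi-definite. *)
Definition semi_inner b := [/\ forall u v, b u v = b v u,
  forall a u v w, b (a *: u + v) w = a * b u w + b v w &
  forall u, 0 <= b u u].

Variable b : V -> V -> R.
Hypothesis bP : semi_inner b.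

Lemma siC u v : b u v = b v u. Proof. by case: bP. Qed.

Lemma si_ge0 u : 0 <= b u u. Proof. by case: bP. Qed.

Lemma siPl a u v w : b (a *: u + v) w = a * b u w + b v w.
Proof. by case: bP. Qed.

Lemma siDl u v w : b (u + v) w = b u w + b v w.
Proof. by have := siPl 1 u v w; rewrite scale1r mul1r. Qed.

Lemma si0l w : b 0 w = 0.
Proof. by have := siDl 0 0 w; rewrite addr0 => /eqP;
  rewrite -subr_eq subrr eq_sym => /eqP.
Qed.

Lemma siZl a u w : b (a *: u) w = a * b u w.
Proof. by have := siPl a u 0 w; rewrite addr0 si0l addr0. Qed.

Lemma siNl u w : b (- u) w = - b u w.
Proof. by rewrite -scaleN1r siZl mulN1r. Qed.

Lemma siBl u v w : b (u - v) w = b u w - b v w.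
Proof. by rewrite siDl siNl. Qed.

Lemma siDr u v w : b w (u + v) = b w u + b w v.
Proof. by rewrite siC siDl !(siC w). Qed.

Lemma siZr a u w : b w (a *: u) = a * b w u.
Proof. by rewrite siC siZl (siC w). Qed.

Lemma siNr u w : b w (- u) = - b w u.
Proof. by rewrite siC siNl (siC w). Qed.

Lemma siBr u v w : b w (u - v) = b w u - b w v.
Proof. by rewrite siDr siNr. Qed.

Lemma si_suml (I : Type) (r : seq I) (P : pred I) (F : I -> V) w :
  b (\sum_(i <- r | P i) F i) w = \sum_(i <- r | P i) b (F i) w.
Proof.
by apply: (big_morph (fun u => b u w)); [move=> *; exact: siDl|exact: si0l].
Qed.

Lemma si_sumr (I : Type) (r : seq I) (P : pred I) (F : I -> V) w :
  b w (\sum_(i <- r | P i) F i) = \sum_(i <- r | P i) b w (F i).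
Proof. by rewrite siC si_suml; apply: eq_bigr => i _; rewrite siC. Qed.

Definition siE := (siDl, siDr, siZl, siZr, siNl, siNr).

(** The discriminant of the form on the span of u and v; when v is a null vector
   a large multiple of it shows that b u v vanishes. *)
Lemma cauchy_schwarz u v : b u v ^+ 2 <= b u u * b v v.
Proof.
have H a c : 0 <= a ^+ 2 * b u u + 2 * a * c * b u v + c ^+ 2 * b v v.
  have := si_ge0 (a *: u + c *: v); rewrite !siE (siC v u); congr (_ <= _); ring.
have u0 := si_ge0 u; have v0 := si_ge0 v.
have [vv|vv] := ltP 0 (b v v).
  have := H (b v v) (- b u v); rewrite -(pmulr_rge0 _ vv) => H1.
  suff : 0 <= b v v * (b u u * b v v - b u v ^+ 2) by rewrite pmulr_rge0// subr_ge0.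
  have -> : b v v * (b u u * b v v - b u v ^+ 2) = b v v ^+ 2 * b u u
    + 2 * b v v * (- b u v) * b u v + (- b u v) ^+ 2 * b v v by ring.
  exact: H.
have {vv}vv : b v v = 0 by apply/eqP; rewrite eq_le vv v0.
rewrite vv mulr0; have := H (b u v) (- (b u u + 1) / 2); rewrite vv mulr0 addr0.
have -> : b u v ^+ 2 * b u u + 2 * b u v * (- (b u u + 1) / 2) * b u v
  = - b u v ^+ 2 by field.
by rewrite oppr_ge0.
Qed.

Lemma si_null u v : b u u = 0 -> b u v = 0.
Proof.
move=> u0; apply/eqP; rewrite -sqrf_eq0 eq_le sqr_ge0 andbT.
by rewrite (le_trans (cauchy_schwarz u v))// u0 mul0r.
Qed.

Lemma si_null_eq u v w : b (u - v) (u - v) = 0 -> b u w = b v w.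
Proof.
move=> H; have := si_null w H.
by rewrite siBl => /eqP; rewrite subr_eq0 => /eqP.
Qed.

Lemma si_le2 u v : b (u + v) (u + v) <= 2 * b u u + 2 * b v v.
Proof.
have := si_ge0 (u - v); rewrite !siE !(siC v u) => H; lra.
Qed.

Lemma si_cvg_l (x : nat -> V) l v :
  (fun n => b (x n - l) (x n - l)) @ \oo --> 0 ->
  (fun n => b (x n) v) @ \oo --> b l v.
Proof.
move=> xl; apply/cvgrPdist_lt => e e0.
have e20 : 0 < e ^+ 2 / (b v v + 1).
  by rewrite divr_gt0 ?exprn_gt0// ltr_wpDl ?si_ge0.
move/cvgrPdist_lt : xl => /(_ _ e20); apply: filterS => n.
rewrite sub0r normrN ger0_norm ?si_ge0// ltr_pdivlMr ?ltr_wpDl ?si_ge0// => H.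
rewrite -siBl -(@ltr_pXn2r _ 2%N) ?nnegrE ?(ltW e0)//.
rewrite real_normK ?num_real// (le_lt_trans (cauchy_schwarz _ _))//.
rewrite (_ : b (l - x n) (l - x n) = b (x n - l) (x n - l)).
  by rewrite (le_lt_trans _ H)// ler_wpM2l ?si_ge0// lerDl.
by rewrite -opprB siNl siNr opprK.
Qed.

End semi_inner.

(** Completeness for sequences with geometrically small increments, which is all
   that the power iteration of [bottom_eigenvector] produces. *)
Definition si_complete {R : realType} {V : lmodType R} (b : V -> V -> R) :=
  forall (x : nat -> V) (C r : R), 0 <= r < 1 ->
    (forall n, b (x n.+1 - x n) (x n.+1 - x n) <= C * r ^+ n) ->
    exists l, (fun n => b (x n - l) (x n - l)) @ \oo --> 0.

(** * The operator of a quadratic form *)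

Section form_operator.
Context {R : realType} {V W : lmodType R}.
Variables (dot : V -> V -> R) (q : W -> W -> R) (p : {linear W -> V}).
Hypotheses (dotP : semi_inner dot) (qP : semi_inner q).

(** The graph of the self-adjoint operator A associated with the form q, whose
   domain W is kept apart from V because the gradient of a function is a datum
   of W that its values do not display. *)
Definition form_op u f := exists w, p w = u /\ forall w', q w w' = dot f (p w').

Definition form_resolvent lam :=
  (forall f, exists u, form_op u (f + lam *: u)) /\
  exists C, forall u f, form_op u (f + lam *: u) -> dot u u <= C * dot f f.

(** Uniqueness of the coordinates holds up to null vectors. *)
Definition form_mult lam m := exists e : 'I_m -> V,
  (forall i, form_op (e i) (lam *: e i)) /\
  forall u, form_op u (lam *: u) -> exists! c : 'rV[R]_m,
    let v := u - \sum_(i < m) c ord0 i *: e i in dot v v = 0.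

(* The form depends on p w only up to null vectors. *)
Hypothesis pN : forall w v, dot (p w - v) (p w - v) = 0 ->
  exists w', p w' = v /\ forall w'', q w' w'' = q w w''.

Local Notation A := form_op.

Lemma form_opC u v f g : A u f -> A v g -> dot f v = dot u g.
Proof.
move=> [w [<- wf]] [w' [<- wg]]; rewrite -wf (siC qP) wg; exact: (siC dotP).
Qed.

Lemma form_opP a u v f g : A u f -> A v g -> A (a *: u + v) (a *: f + g).
Proof.
move=> [w [<- wf]] [w' [<- wg]]; exists (a *: w + w').
by rewrite linearP; split=> // z; rewrite (siPl qP) (siPl dotP) wf wg.
Qed.

Lemma form_op0 : A 0 0.
Proof. by exists 0; rewrite linear0; split=> // w; rewrite (si0l qP) (si0l dotP). Qed.

Lemma form_opZ a u f : A u f -> A (a *: u) (a *: f).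
Proof. by move=> uf; have := form_opP a uf form_op0; rewrite !addr0. Qed.

Lemma form_op_sum (I : Type) (r : seq I) (P : pred I) (F G : I -> V) :
  (forall i, A (F i) (G i)) -> A (\sum_(i <- r | P i) F i) (\sum_(i <- r | P i) G i).
Proof.
move=> FG; elim/big_ind2 : _ => //; first exact: form_op0.
move=> u f v g uf vg; have := form_opP 1 uf vg; by rewrite !scale1r.
Qed.

Lemma form_op_null u v f g : A u f -> dot (u - v) (u - v) = 0 ->
  dot (f - g) (f - g) = 0 -> A v g.
Proof.
move=> [w [<- wf]] /pN[w' [<- ww']] fg; exists w'; split=> // z.
by rewrite ww' wf (si_null_eq dotP _ fg).
Qed.

(** The resolvent of a self-adjoint operator at c is bounded by the inverse of
   the distance from c to the spectrum. Let h be the best constant such that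
   h |u| <= |(A - c) u|. If h were smaller than dl, then c + h and c - h would be
   in the resolvent set; but an almost optimal u = (A - c) v makes
   (A - c - h) (A - c + h) v small compared with u, since (A - c)^2 is at least
   h^2, so that these two factors cannot both have bounded inverses. *)
Lemma resolvent_gap c dl : 0 < dl ->
  (forall lam, `|lam - c| < dl -> form_resolvent lam) ->
  forall u f, A u (f + c *: u) -> dl ^+ 2 * dot u u <= dot f f.
Proof.
move=> dl0 res u0 f0 Au0; rewrite leNgt; apply/negP => lt0.
have d0 := si_ge0 dotP.
have u00 : 0 < dot u0 u0.
  rewrite lt_neqAle d0 andbT; apply: contraTneq lt0 => <-.
  by rewrite mulr0 -leNgt.
pose E := [set e | 0 <= e /\
  forall u f, A u (f + c *: u) -> e * dot u u <= dot f f].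
have E0 : E 0 by split=> // u f _; rewrite mul0r.
have Eub : ubound E (dot f0 f0 / dot u0 u0).
  by move=> e [_ /(_ _ _ Au0)]; rewrite ler_pdivlMr.
have Esup : has_sup E by split; [exists 0|exists (dot f0 f0 / dot u0 u0)].
pose e2 := sup E.
have e2d : e2 < dl ^+ 2.
  apply: (@le_lt_trans _ _ (dot f0 f0 / dot u0 u0)).
    by apply: ge_sup => //; exists 0.
  by rewrite ltr_pdivrMr.
have Ee2 : forall u f, A u (f + c *: u) -> e2 * dot u u <= dot f f.
  move=> u f Auf; have [uu|uu] := ltP 0 (dot u u); last first.
    have -> : dot u u = 0 by apply/eqP; rewrite eq_le uu d0.
    by rewrite mulr0 d0.
  rewrite -ler_pdivlMr//; apply: ge_sup => [|e [_ /(_ _ _ Auf)]]; first by exists 0.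
  by rewrite ler_pdivlMr.
have cc : `|c - c| < dl by rewrite subrr normr0.
have [Rc [C HC]] := res _ cc.
(* The bound on the resolvent at c itself. *)
have e20 : 0 < e2.
  have C1 : 0 < Num.max C 1 by rewrite lt_max ltr01 orbT.
  apply: (@lt_le_trans _ _ (Num.max C 1)^-1); first by rewrite invr_gt0.
  apply: ub_le_sup; first by case: Esup.
  split=> [|u f /HC]; first by rewrite invr_ge0 ltW.
  rewrite ler_pdivrMl// => /le_trans; apply.
  by rewrite ler_wpM2r// le_max lexx.
pose h := Num.sqrt e2.
have h0 : 0 < h by rewrite sqrtr_gt0.
have hh : h ^+ 2 = e2 by rewrite sqr_sqrtr// ltW.
have hd : h < dl by rewrite -(@ltr_pXn2r _ 2%N) ?nnegrE ?ltW// hh.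
have [_ [C1 HC1]] : form_resolvent (c + h).
  by apply: res; rewrite addrAC subrr add0r gtr0_norm.
have [_ [C2 HC2]] : form_resolvent (c - h).
  by apply: res; rewrite addrAC subrr add0r normrN gtr0_norm.
pose D1 := Num.max C1 0; pose D2 := Num.max C2 0.
have D10 : 0 <= D1 by rewrite le_max lexx orbT.
have D20 : 0 <= D2 by rewrite le_max lexx orbT.
have {}HC1 u f : A u (f + (c + h) *: u) -> dot u u <= D1 * dot f f.
  by move=> /HC1/le_trans; apply; rewrite ler_wpM2r// le_max lexx.
have {}HC2 u f : A u (f + (c - h) *: u) -> dot u u <= D2 * dot f f.
  by move=> /HC2/le_trans; apply; rewrite ler_wpM2r// le_max lexx.
(* The final estimate is |u|^2 <= D e |u|^2, hence the choice of e. *)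
pose D := 2 * D1 + 2 * e2 * D2 * D1 + 1.
have D0 : 0 < D by rewrite ltr_wpDl// addr_ge0// ?mulr_ge0// ltW.
pose e := (2 * D)^-1.
have e0 : 0 < e by rewrite invr_gt0 mulr_gt0.
have [u [f [Auf fu]]] : exists u f, A u (f + c *: u) /\
    dot f f < (e2 + e) * dot u u.
  apply: contrapT => H.
  suff /(ub_le_sup _) : E (e2 + e).
    move=> H1; have := H1 (proj2 Esup); by rewrite -/e2 gerDl leNgt e0.
  split=> [|u f Auf]; first by rewrite addr_ge0// ltW.
  by rewrite leNgt; apply/negP => ?; apply: H; exists u, f.
have uu : 0 < dot u u.
  rewrite lt_neqAle d0 andbT; apply: contraTneq fu => <-.
  by rewrite mulr0 -leNgt.
have [v Av] := Rc u.
have vu := Ee2 _ _ Av.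
have fv : dot f v = dot u u.
  have := form_opC Auf Av; rewrite !(siE dotP).
  by move=> /addIr.
(* z = ((A - c)^2 - h^2) v is factored through y = (A - c + h) v. *)
pose z := f - e2 *: v.
have zz : dot z z <= e * dot u u.
  rewrite !(siE dotP) (siC dotP v f) fv.
  have : e2 * (e2 * dot v v) <= e2 * dot u u by rewrite ler_wpM2l// ltW.
  lra.
pose y := u + h *: v.
have Ay : A y (z + (c + h) *: y).
  have <- : h *: (u + c *: v) + (f + c *: u) = z + (c + h) *: y.
    rewrite /z /y -hh expr2 !(scalerDr, scalerDl) !scalerA (mulrC h c).
    by rewrite [RHS](AC (2*(2*2)) ((4*5)*(1*3)*(2*6))) /= addNr addr0.
  by rewrite /y addrC; exact: form_opP.
have Av' : A v (y + (c - h) *: v).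
  by rewrite /y scalerBl (AC (2*2) ((1*3)*(2*4))) /= subrr addr0.
have yz := HC1 _ _ Ay; have vy := HC2 _ _ Av'.
have : dot u u <= 2 * dot y y + 2 * (e2 * dot v v).
  have := si_le2 dotP y (- (h *: v)).
  by rewrite {1 2}/y addrK !(siNl dotP) !(siNr dotP) opprK (siZl dotP) (siZr dotP)
    mulrA -expr2 hh.
apply/negP; rewrite -ltNge.
have yz' : dot y y <= D1 * (e * dot u u) by rewrite (le_trans yz)// ler_wpM2l.
have vy' : dot v v <= D2 * (D1 * (e * dot u u)).
  by rewrite (le_trans vy)// ler_wpM2l.
apply: (@le_lt_trans _ _ ((2 * D1 + 2 * e2 * D2 * D1) * (e * dot u u))).
  rewrite [leRHS]mulrDl; apply: lerD; first by rewrite -mulrA ler_pM2l.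
  by rewrite -!mulrA ler_pM2l// ler_pM2l.
rewrite mulrA gtr_pMl//.
apply: (@lt_trans _ _ (D * e)); first by rewrite ltr_pM2r// ltrDl.
by rewrite /e invfM mulrCA divff ?gt_eqF// mulr1 invf_lt1// ltr1n.
Qed.

End form_operator.

Section bottom.
Context {R : realType} {V W : lmodType R}.
Variables (dot : V -> V -> R) (q : W -> W -> R) (p : {linear W -> V}).
Hypotheses (dotP : semi_inner dot) (qP : semi_inner q).
Hypothesis dot_complete : si_complete dot.
Hypothesis pN : forall w v, dot (p w - v) (p w - v) = 0 ->
  exists w', p w' = v /\ forall w'', q w' w'' = q w w''.
Local Notation A := (form_op dot q p).
Local Notation resolvent := (form_resolvent dot q p).

(** If lam0 is the infimum of the Rayleigh quotient on the orthogonal of some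
   eigenvectors and the spectrum has a gap just above lam0, then lam0 is an
   eigenvalue there. Let T = (1 + lam0) (A + 1)^-1, so that 0 <= T <= 1 on this
   orthogonal. The gap says that (1 - T) (rho - T) >= 0 for some rho < 1, hence
   T^n f converges geometrically to a fixed point of T, which is an eigenvector;
   it does not vanish if f nearly attains the infimum. Since T is symmetric,
   every estimate bears on the moments s n = <T^n f, f> and on their differences
   d n = s n - s (n + 1). *)
Lemma bottom_eigenvector (k : nat) (e : 'I_k -> V) (nu : 'I_k -> R) lam0 dl :
  (forall j, A (e j) (nu j *: e j)) -> (forall j, 0 <= nu j) ->
  0 <= lam0 -> 0 < dl -> resolvent (-1) ->
  (forall w, (forall j, dot (p w) (e j) = 0) -> lam0 * dot (p w) (p w) <= q w w) ->
  (forall eta, 0 < eta -> exists w, [/\ forall j, dot (p w) (e j) = 0,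
     dot (p w) (p w) = 1 & q w w <= lam0 + eta]) ->
  (forall u f, A u (f + (lam0 + dl) *: u) -> dl ^+ 2 * dot u u <= dot f f) ->
  exists g, [/\ 0 < dot g g, forall j, dot g (e j) = 0 & A g (lam0 *: g)].
Proof.
move=> Ae nu0 lam00 dl0 [resS _] low inf_ gap.
have d0 := si_ge0 dotP.
pose H v := forall j, dot v (e j) = 0.
have [S HS] : exists S : V -> V, forall f, A (S f) (f - S f).
  have [S HS] := choice resS; exists S => f.
  by have := HS f; rewrite scaleN1r.
have SH f : H f -> H (S f).
  move=> Hf j; have := form_opC dotP qP (HS f) (Ae j).
  rewrite !(siE dotP) Hf sub0r => /eqP; rewrite -subr_eq0 -opprD oppr_eq0.
  rewrite addrC -[X in _ + X]mul1r -mulrDl mulf_eq0 => /orP[|/eqP//].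
  by rewrite gt_eqF// ltr_wpDl.
pose a := 1 + lam0.
have a0 : 0 < a by rewrite ltr_wpDr.
pose T f := a *: S f.
have Tsym f g : dot (T f) g = dot f (T g).
  rewrite /T !(siE dotP); congr (_ * _).
  by have := form_opC dotP qP (HS f) (HS g); rewrite !(siE dotP) => /addIr ->.
have SE f : exists2 w, p w = S f & q w w = dot f (S f) - dot (S f) (S f).
  have [w [wf qw]] := HS f; exists w => //.
  by rewrite qw wf (siBl dotP).
(* T^2 <= T, because q is at least lam0 on the orthogonal. *)
have T1 f : H f -> dot (T f) (T f) <= dot f (T f).
  move=> Hf; have [w wf qw] := SE f.
  have := low w; rewrite wf => /(_ (SH _ Hf)); rewrite qw => le.
  rewrite /T !(siE dotP) ler_pM2l// /a; lra.
have T0 f : 0 <= dot f (T f).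
  have [w wf qw] := SE f; rewrite /T (siZr dotP) mulr_ge0 ?(ltW a0)//.
  by have := si_ge0 qP w; rewrite qw subr_ge0; apply/le_trans/d0.
have TH f : H f -> H (T f).
  by move=> /SH Hf j; rewrite /T (siZl dotP) Hf mulr0.
pose rho := a / (a + 2 * dl).
have ad0 : 0 < a + 2 * dl by rewrite addr_gt0// mulr_gt0.
have rho0 : 0 < rho by rewrite divr_gt0.
have rho1 : rho < 1 by rewrite ltr_pdivrMr// mul1r ltrDl mulr_gt0.
(* The gap, read through u = (A + 1)^-1 f. *)
have Tgap f : (1 + rho) * dot f (T f) <= dot (T f) (T f) + rho * dot f f.
  have := gap (S f) (f - (1 + (lam0 + dl)) *: S f).
  have -> : f - (1 + (lam0 + dl)) *: S f + (lam0 + dl) *: S f = f - S f.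
    by rewrite -addrA -scaleNr -scalerDl opprD addrNK scaleN1r.
  move=> /(_ (HS f)); rewrite !(siE dotP) (siC dotP (S f) f) => le.
  rewrite /T -subr_ge0.
  have -> : a * (a * dot (S f) (S f)) + rho * dot f f - (1 + rho) * (a * dot f (S f))
    = rho * (dot f f - 2 * (a + dl) * dot f (S f) + a * (a + 2 * dl) * dot (S f) (S f)).
    rewrite /rho; field; exact: lt0r_neq0.
  rewrite mulr_ge0 ?(ltW rho0)//; rewrite -subr_ge0 in le; move: le => /le_trans; apply.
  rewrite le_eqVlt; apply/orP; left; apply/eqP; rewrite /a; ring.
pose eta := a * (1 - rho) / 4.
have eta0 : 0 < eta by rewrite !divr_gt0// mulr_gt0// subr_gt0.
have [w [Hf ff qw]] := inf_ _ eta0; set f := p w in Hf ff.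
(* The form q + dot is an inner product in which w and (A + 1)^-1 f have
   product 1; Cauchy-Schwarz then bounds <T f, f> from below. *)
have fT : 1 - dot f (T f) <= (1 - rho) / 4.
  have [w' [w'f qw']] := HS f.
  have q1P : semi_inner (fun v v' => q v v' + dot (p v) (p v')).
    split=> [v v'|b v v' v''|v].
    - by rewrite (siC qP) (siC dotP).
    - by rewrite (siPl qP) linearP (siPl dotP); ring.
    - by rewrite addr_ge0// (si_ge0 qP).
  have := cauchy_schwarz q1P w' w => /=.
  rewrite !qw' w'f -/f !(siE dotP) ff !subrK expr1n => le1.
  have fS : 0 <= dot f (S f).
    by have := T0 f; rewrite /T (siZr dotP) pmulr_rge0.
  have le2 : 1 <= dot f (S f) * (a + eta).
    by rewrite (le_trans le1)// ler_wpM2l// /a; lra.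
  rewrite /T ?(siZr dotP) lerBlDr.
  rewrite -(@ler_pM2r _ (a + eta)); last exact: addr_gt0.
  have : a * 1 <= a * (dot f (S f) * (a + eta)) by rewrite ler_pM2l.
  rewrite mulr1 mulrA => le3.
  rewrite mul1r [leRHS]mulrDl.
  have : 0 <= (1 - rho) / 4 * eta by rewrite mulr_ge0 ?ltW// divr_gt0// subr_gt0.
  have -> : (1 - rho) / 4 * (a + eta) = eta + (1 - rho) / 4 * eta.
    by rewrite mulrDr; congr (_ + _); rewrite /eta; ring.
  by move: le3; lra.
pose x n := iter n T f.
have xS n : x n.+1 = T (x n) by [].
have Hx n : H (x n) by elim: n => // n IH; exact: TH.
pose s n := dot (x n) f.
have xs m n : dot (x m) (x n) = s (m + n)%N.
  elim: n m => [|n IH] m; first by rewrite addn0.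
  by rewrite xS -Tsym -xS IH addSnnS.
pose d n := s n - s n.+1.
have d_ge0 n : 0 <= d n.*2.+1.
  have := T1 _ (Hx n); rewrite -xS !xs addSnnS !addnS addnn => le.
  by rewrite /d subr_ge0.
have d_rho n : d n.*2.+1 <= rho * d n.*2.
  have := Tgap (x n); rewrite -xS !xs !(addSn, addnS) addnn /d; lra.
have d_le n : d n.*2.+2 <= d n.*2.+1.
  have := T0 (x n - x n.+1).
  rewrite (siBl dotP) -!Tsym !(siBr dotP) -!xS !xs !(addSn, addnS) addnn /d; lra.
(* The two previous bounds chain to d (2 n + 2) <= rho d (2 n). *)
have d_exp n : d n.*2 <= d 0%N * rho ^+ n.
  elim: n => [|n IH]; first by rewrite expr0 mulr1.
  rewrite doubleS (le_trans (d_le n))// (le_trans (d_rho n))//.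
  by rewrite exprSr mulrA mulrC ler_pM2r.
have d2_ge0 n : 0 <= d n.*2.
  by rewrite -(pmulr_rge0 _ rho0) (le_trans (d_ge0 n)).
have [g xg] : exists l, (fun n => dot (x n - l) (x n - l)) @ \oo --> 0.
  apply: (dot_complete (C := d 0%N) (r := rho)); first by rewrite ltW.
  move=> n; apply: le_trans (d_exp n); have := d_ge0 n.
  rewrite !(siBl dotP) !(siBr dotP) !xs !(addSn, addnS) addnn /d; lra.
have s_low n : 1 / 2 <= s n.*2.
  (* This combination increases: the tail of the series of the d is geometric. *)
  have inv m : s 0%N - 2 / (1 - rho) * d 0%N <= s m.*2 - 2 / (1 - rho) * d m.*2.
    elim: m => // m IH; rewrite (le_trans IH)// doubleS.
    have le4 : d m.*2.+2 <= rho * d m.*2 := le_trans (d_le m) (d_rho m).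
    have r1 : 0 < 2 / (1 - rho) by rewrite divr_gt0// subr_gt0.
    have := ler_wpM2l (ltW r1) le4.
    have -> : 2 / (1 - rho) * (rho * d m.*2) = 2 / (1 - rho) * d m.*2 - 2 * d m.*2.
      by field; rewrite subr_eq0 gt_eqF.
    have le5 : d m.*2.+1 <= d m.*2.
      by rewrite (le_trans (d_rho m))// ler_piMl// ltW.
    have -> : s m.*2.+2 = s m.*2 - d m.*2 - d m.*2.+1 by rewrite /d; lra.
    lra.
  have := inv n; have r1 : 0 < 1 - rho by rewrite subr_gt0.
  have : 0 <= 2 / (1 - rho) * d n.*2 by rewrite mulr_ge0// divr_ge0// ltW.
  have : 2 / (1 - rho) * d 0%N <= 1 / 2.
    have d0rho : d 0%N <= (1 - rho) / 4 by rewrite (_ : d 0%N = 1 - dot f (T f))// -ff -Tsym.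
    have r2 : 0 <= 2 / (1 - rho) by rewrite divr_ge0// ltW.
    apply: (le_trans (ler_wpM2l r2 d0rho)).
    by rewrite le_eqVlt; apply/orP; left; apply/eqP; field; rewrite subr_eq0 gt_eqF.
  have -> : s 0%N = 1 by [].
  lra.
have gg : 0 < dot g g.
  have [] := @cvgrPdist_lt _ R^o _ \oo _ (fun n => dot (x n - g) (x n - g)) 0.
  move=> /(_ xg (1/8)) + _ => /(_ (ltac:(lra)))[N _ /(_ N (leqnn N))] /=.
  rewrite sub0r normrN ger0_norm// => lt.
  have := si_le2 dotP (x N - g) g; rewrite subrK xs addnn.
  have := s_low N; lra.
have Hg : H g.
  move=> j; have := si_cvg_l (v := (e j)) dotP xg.
  under eq_fun do rewrite Hx.
  by move=> /cvg_lim <-//; rewrite lim_cst.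
have Tg : dot (g - T g) (g - T g) = 0.
  have Tx v : dot g v = dot (T g) v.
    have xgv := si_cvg_l (v := v) dotP xg.
    have xgTv := si_cvg_l (v := (T v)) dotP xg.
    rewrite Tsym.
    have : (fun n => dot (x n.+1) v) @ \oo --> dot g (T v).
      by under eq_fun do rewrite xS Tsym.
    have : (fun n => dot (x n.+1) v) @ \oo --> dot g v.
      by move: xgv; rewrite -cvg_shiftS.
    move=> /cvg_lim h1 /cvg_lim h2.
    by rewrite -h1// -h2.
  by rewrite (siBl dotP) Tx subrr.
exists g; split=> //.
have := form_opZ dotP qP a (HS g); rewrite scalerBr -/(T g) => ATg.
have TgN : dot (T g - g) (T g - g) = 0.
  by rewrite -opprB (siNl dotP) (siNr dotP) opprK.
apply: (form_op_null dotP pN ATg) => //.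
have -> : a *: g - T g - lam0 *: g = g - T g.
  by rewrite addrAC -scalerBl /a addrK scale1r.
exact: Tg.
Qed.

End bottom.

(** * The variational principle for a discrete spectrum *)

Lemma card_seq_II (T : choiceType) (s : seq T) : uniq s ->
  ([set` s] #= `I_(size s))%card.
Proof.
move=> us; have -> : [set` s] = [set` [fset x in s]%fset].
  by apply/seteqP; split=> x /=; rewrite inE.
by apply/card_eq_fsetP; rewrite card_fseq undup_id.
Qed.

Lemma card_II_uniq_le (T : choiceType) (A : set T) m (s : seq T) :
  (A #= `I_m)%card -> uniq s -> {in s, forall x, A x} -> (size s <= m)%N.
Proof.
move=> Am us sA; rewrite -card_le_II.
apply: (@card_le_trans _ _ _ A); last by move: Am; rewrite card_eq_le => /andP[].
apply: (@card_le_trans _ _ _ [set` s]).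
  by have := card_seq_II us; rewrite card_eq_le => /andP[].
by apply: subset_card_le => x /sA.
Qed.

Lemma card_II_le (T : choiceType) (A : set T) m (s : seq T) :
  (A #= `I_m)%card -> uniq s -> (forall x, A x -> x \in s) -> (m <= size s)%N.
Proof.
move=> Am us As; rewrite -card_le_II.
apply: (@card_le_trans _ _ _ A); first by move: Am; rewrite card_eq_le => /andP[].
apply: (@card_le_trans _ _ _ [set` s]); first by apply: subset_card_le => x /As.
by have := card_seq_II us; rewrite card_eq_le => /andP[].
Qed.

Lemma exists_left_kernel (F : fieldType) m n (M : 'M[F]_(m, n)) : (n < m)%N ->
  exists2 c : 'rV[F]_m, c != 0 & c *m M = 0.
Proof.
move=> nm; have : kermx M != 0.
  rewrite kermx_eq0 /row_free neq_ltn (leq_ltn_trans (rank_leq_col M))//.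
by move=> /rowV0Pn[c /sub_kermxP cM c0]; exists c.
Qed.

Section min_max.
Context {R : realType} {V W : lmodType R}.
Variables (dot : V -> V -> R) (q : W -> W -> R) (p : {linear W -> V}).
Hypotheses (dotP : semi_inner dot) (qP : semi_inner q).
Hypothesis dot_complete : si_complete dot.
Hypothesis pN : forall w v, dot (p w - v) (p w - v) = 0 ->
  exists w', p w' = v /\ forall w'', q w' w'' = q w w''.
Local Notation A := (form_op dot q p).
Local Notation resolvent := (form_resolvent dot q p).
Variable mu : nat -> R.
Hypothesis mu_le : forall i j, (1 <= i <= j)%N -> mu i <= mu j.
Hypothesis mu_oo : mu @ \oo --> +oo%R.
Hypothesis mu1 : 0 <= mu 1%N.
Hypothesis mu_res : forall lam, (forall j, (1 <= j)%N -> mu j <> lam) -> resolvent lam.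
Hypothesis mu_mult : forall lam,
  exists2 m, ([set j | (1 <= j)%N /\ mu j = lam] #= `I_m)%card & form_mult dot q p lam m.

Lemma mu_ge0 j : (1 <= j)%N -> 0 <= mu j.
Proof. by move=> j1; rewrite (le_trans mu1)// mu_le// j1. Qed.

(** Orthonormal eigenvectors for the first k eigenvalues: they are indexed from
   0 whereas the eigenvalues are indexed from 1. *)
Definition eigen_system k (e : nat -> V) :=
  (forall j, (j < k)%N -> A (e j) (mu j.+1 *: e j)) /\
  (forall i j, (i < k)%N -> (j < k)%N -> dot (e i) (e j) = (i == j)%:R).

Let idx k lam := [seq j <- iota 0 k | mu j.+1 == lam].

Lemma idxP k lam j : (j \in idx k lam) = (j < k)%N && (mu j.+1 == lam).
Proof. by rewrite mem_filter mem_iota add0n leq0n/= andbC. Qed.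

Lemma eigen_orth u v lam nu : A u (lam *: u) -> A v (nu *: v) -> lam != nu ->
  dot u v = 0.
Proof.
move=> Au Av ln; have := form_opC dotP qP Au Av.
rewrite (siZl dotP) (siZr dotP) => /eqP.
by rewrite -subr_eq0 -mulrBl mulf_eq0 subr_eq0 (negbTE ln) => /eqP.
Qed.

(** Fewer than m of the first k eigenvalues equal mu (k + 1), of multiplicity m.
   So some nonzero vector of the m-dimensional eigenspace is orthogonal to the
   vectors already chosen there, and to the others by symmetry. *)
Lemma exists_eigen_system k : exists e, eigen_system k e.
Proof.
elim: k => [|k [e [eA eO]]]; first by exists (fun=> 0); split.
pose lam := mu k.+1; pose s := idx k lam.
have [m Im [b [bA bU]]] := mu_mult lam.
have sm : (size s < m)%N.
  have := @card_II_uniq_le _ _ _ [seq j.+1 | j <- k :: s] Im.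
  rewrite size_map; apply.
    rewrite map_inj_uniq; last by move=> i j [].
    by rewrite /= idxP ltnn/= filter_uniq// iota_uniq.
  move=> x /mapP[j + ->]; rewrite inE idxP => /orP[/eqP->//|/andP[_ /eqP]].
  by split.
have [c c0 cM] := exists_left_kernel
  (\matrix_(i < m, j < size s) dot (b i) (e (nth 0%N s j))) sm.
pose u := \sum_(i < m) c ord0 i *: b i.
have uA : A u (lam *: u).
  rewrite scaler_sumr; apply: (form_op_sum dotP qP) => i.
  by rewrite scalerA mulrC -scalerA; exact: form_opZ.
have uu : 0 < dot u u.
  rewrite lt_neqAle (si_ge0 dotP) andbT; apply: contra c0 => /eqP/esym uu0.
  have [c' [_ c'U]] := bU _ uA.
  have h1 : c' = c by apply: c'U; rewrite /= -/u subrr (si0l dotP).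
  rewrite -h1; apply/eqP; apply: c'U => /=.
  by under eq_bigr do rewrite mxE scale0r; rewrite big1// subr0.
have ue j : (j < k)%N -> dot u (e j) = 0.
  move=> jk; have [jl|jl] := eqVneq (mu j.+1) lam; last first.
    by apply: (eigen_orth uA (eA _ jk)); rewrite eq_sym.
  have js : j \in s by rewrite idxP jk jl eqxx.
  have iz : (index j s < size s)%N by rewrite index_mem.
  move/rowP : cM => /(_ (Ordinal iz)); rewrite !mxE => <-.
  rewrite /u (si_suml dotP); apply: eq_bigr => i _.
  by rewrite (siZl dotP) mxE /= nth_index.
pose v := (Num.sqrt (dot u u))^-1 *: u.
have vv : dot v v = 1.
  rewrite !(siE dotP) mulrA -expr2 exprVn sqr_sqrtr ?(ltW uu)//.
  by rewrite mulVf// gt_eqF.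
have ve j : (j < k)%N -> dot v (e j) = 0.
  by move=> jk; rewrite (siZl dotP) ue// mulr0.
have vA : A v (lam *: v).
  by rewrite scalerA mulrC -scalerA; exact: form_opZ.
exists (fun j => if j == k then v else e j); split=> [j|i j].
  by rewrite ltnS leq_eqVlt; case: eqVneq => [->//|_ /=]; exact: eA.
rewrite !ltnS (leq_eqVlt i) (leq_eqVlt j).
case: (eqVneq i k) => [->|ik] /=; case: (eqVneq j k) => [->|jk] //= ik' jk'.
- exact: ve.
- by rewrite (siC dotP) ve// (negbTE ik).
- exact: eO.
Qed.

(** For lam below mu (k + 1) the system contains as many vectors of the eigenspace
   as its dimension, leaving no room for u: one vector too many makes the
   coordinates linearly dependent, which contradicts orthogonality. *)
Lemma eigen_system_full k e u lam : eigen_system k e -> A u (lam *: u) ->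
  lam < mu k.+1 -> (forall j, (j < k)%N -> dot u (e j) = 0) -> dot u u = 0.
Proof.
move=> [eA eO] uA lamk ue; apply/eqP; apply: contrapT => /negP uu0.
pose s := idx k lam; have [m Im [b [bA bU]]] := mu_mult lam.
have ms : (m <= size s)%N.
  rewrite -(size_map succn); apply: card_II_le Im _ _.
    by rewrite map_inj_uniq ?filter_uniq ?iota_uniq// => i j [].
  move=> [|x] /=; first by case.
  move=> [_ xl]; apply/mapP; exists x => //.
  rewrite idxP xl eqxx andbT ltnNge; apply/negP => kx.
  by move: lamk; rewrite -xl ltNge mu_le//= ltnS.
pose v (i : 'I_(size s).+1) := nth 0 (u :: [seq e j | j <- s]) i.
have vA i : A (v i) (lam *: v i).
  have : v i \in u :: [seq e j | j <- s] by rewrite mem_nth//= size_map.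
  rewrite inE => /orP[/eqP->//|/mapP[j + ->]].
  by rewrite idxP => /andP[jk /eqP <-]; exact: eA.
have vO i j : i != j -> dot (v i) (v j) = 0.
  have H a b' (ab : (a < b' < (size s).+1)%N) :
      dot (nth 0 (u :: [seq e j | j <- s]) a) (nth 0 (u :: [seq e j | j <- s]) b') = 0.
    move: a b' ab => [|a] [|b']//=; rewrite !ltnS => ab.
      rewrite (nth_map 0%N)// ue//.
      by have := mem_nth 0%N ab; rewrite idxP => /andP[].
    move: ab => /andP[ab bs]; have as_ := ltn_trans ab bs.
    rewrite !(nth_map 0%N)// eO; last 2 first.
    - by have := mem_nth 0%N as_; rewrite idxP => /andP[].
    - by have := mem_nth 0%N bs; rewrite idxP => /andP[].
    by rewrite nth_uniq ?filter_uniq ?iota_uniq// ltn_eqF.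
  rewrite neq_ltn => /orP[] ij; last rewrite (siC dotP);
    by apply: H; rewrite ij /= ltn_ord.
have vv i : dot (v i) (v i) != 0.
  rewrite /v; case: i => -[|i] /= ilt.
    exact: uu0.
  rewrite ltnS in ilt; rewrite (nth_map 0%N)//.
  have := mem_nth 0%N ilt; rewrite idxP => /andP[ik _].
  by rewrite eO// eqxx oner_neq0.
have [C HC] := choice (fun i => let: ex_intro c (conj H _) := bU _ (vA i) in
  ex_intro (fun c : 'rV[R]_m => let w := v i - \sum_(j < m) c ord0 j *: b j in
    dot w w = 0) c H).
have [a a0 aM] := exists_left_kernel (\matrix_(i, j) C i ord0 j) (ms : (m < (size s).+1)%N).
pose y := \sum_i a ord0 i *: v i.
have yE z : dot y z = 0.
  rewrite /y (si_suml dotP).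
  transitivity (\sum_i \sum_j (a ord0 i * C i ord0 j) * dot (b j) z).
    apply: eq_bigr => i _; rewrite (siZl dotP) (si_null_eq dotP z (HC i)).
    rewrite (si_suml dotP) mulr_sumr; apply: eq_bigr => j _.
    by rewrite (siZl dotP) mulrA.
  rewrite exchange_big big1//= => j _; rewrite -mulr_suml.
  move/rowP : aM => /(_ j); rewrite !mxE => aM.
  rewrite [X in X * _](_ : _ = 0) ?mul0r// -[RHS]aM.
  by apply: eq_bigr => i _; rewrite mxE.
move/negP: a0; apply; apply/eqP/rowP => i; rewrite mxE.
have := yE (v i); rewrite /y (si_suml dotP) (bigD1 i)//= big1 ?addr0.
  by rewrite (siZl dotP) => /eqP; rewrite mulf_eq0 (negbTE (vv i)) orbF => /eqP.
by move=> j ji; rewrite (siZl dotP) vO ?mulr0.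
Qed.

(** As mu tends to infinity, some eigenvalue is the first one above lam. *)
Lemma spectral_gap_right (lam : R) : 0 <= lam -> exists dl, [/\ 0 < dl,
  forall nu, `|nu - (lam + dl)| < dl -> resolvent nu &
  resolvent (-1)].
Proof.
move=> lam0.
have : \forall j \near \oo, lam < mu j by move/cvgryPgt : mu_oo; exact.
move=> [N _ HN].
have PN : exists j, (1 <= j)%N && (lam < mu j).
  by exists N.+1; rewrite /= HN//=.
case: (ex_minnP PN) => J /andP[J1 lJ] Jmin.
exists ((mu J - lam) / 2); split; first by rewrite divr_gt0// subr_gt0.
  move=> nu; rewrite ltr_norml => /andP[h1 h2]; apply: mu_res => j j1 muj.
  have [Jj|jJ] := leqP J j.
    by have := mu_le (i := J) (j := j); rewrite J1 Jj muj => /(_ isT); lra.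
  have : ~~ (lam < mu j) by apply/negP => lj; have := Jmin j;
    rewrite j1 lj leqNgt jJ => /(_ isT).
  by rewrite -leNgt muj; lra.
by apply: mu_res => j j1 muj; have := mu_ge0 j1; rewrite muj; lra.
Qed.

(** Otherwise the infimum of the Rayleigh quotient on this orthogonal would be an
   eigenvalue below mu (k + 1), contradicting [eigen_system_full]. *)
Lemma rayleigh_orth k e w : eigen_system k e ->
  (forall j, (j < k)%N -> dot (p w) (e j) = 0) ->
  mu k.+1 * dot (p w) (p w) <= q w w.
Proof.
move=> es we; rewrite leNgt; apply/negP => lt1.
have d0 := si_ge0 dotP.
have pos v a : q v v < a * dot (p v) (p v) -> 0 < dot (p v) (p v).
  move=> lt; rewrite lt_neqAle d0 andbT; apply: contraTneq lt => <-.
  by rewrite mulr0 -leNgt (si_ge0 qP).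
have ww := pos _ _ lt1.
pose E := [set r | exists v, [/\ forall j, (j < k)%N -> dot (p v) (e j) = 0,
  0 < dot (p v) (p v) & r = q v v / dot (p v) (p v)]].
have Ew : E (q w w / dot (p w) (p w)) by exists w.
have E0 : lbound E 0 by move=> _ [v [_ v0 ->]]; rewrite divr_ge0// (si_ge0 qP).
have Einf : has_inf E by split; [exists (q w w / dot (p w) (p w))|exists 0].
pose lam := inf E.
have lam0 : 0 <= lam by apply: lb_le_inf => //; exact: Einf.1.
have lam1 : lam < mu k.+1.
  apply: (@le_lt_trans _ _ (q w w / dot (p w) (p w))).
    by apply: ge_inf => //; exact: Einf.2.
  by rewrite ltr_pdivrMr.
have [dl [dl0 dlr res1]] := spectral_gap_right lam0.
have [g [gg ge gA]] : exists g, [/\ 0 < dot g g,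
    forall j : 'I_k, dot g (e j) = 0 & A g (lam *: g)].
  apply: (bottom_eigenvector dotP qP dot_complete pN
    (nu := fun j : 'I_k => mu j.+1) (dl := dl)) => //.
  - by move=> j; exact: es.1.
  - by move=> j; exact: mu_ge0.
  - move=> v ve; have [v0|v0] := ltP 0 (dot (p v) (p v)); last first.
      have -> : dot (p v) (p v) = 0 by apply/eqP; rewrite eq_le v0 d0.
      by rewrite mulr0 (si_ge0 qP).
    rewrite -ler_pdivlMr//; apply: ge_inf; first exact: Einf.2.
    by exists v; split=> // j jk; exact: (ve (Ordinal jk)).
  - move=> eta eta0; have [r [v [ve v0 ->] lt]] := inf_adherent eta0 Einf.
    exists ((Num.sqrt (dot (p v) (p v)))^-1 *: v).
    have sq : (Num.sqrt (dot (p v) (p v)))^-1 ^+ 2 = (dot (p v) (p v))^-1.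
      by rewrite exprVn sqr_sqrtr// ltW.
    rewrite !linearZ; split=> [j||].
    + by rewrite (siZl dotP) ve ?mulr0.
    + by rewrite !(siE dotP) mulrA -expr2 sq mulVf// gt_eqF.
    + by rewrite !(siE qP) mulrA -expr2 sq mulrC ltW.
  - exact: (resolvent_gap dotP qP).
have := eigen_system_full es gA lam1 (fun j jk => ge (Ordinal jk)).
by move: gg => /[swap] ->; rewrite ltxx.
Qed.

(** The previous bound for the projection of w on the orthogonal of the
   eigenvectors, expanded. *)
Theorem variational_inequality k e w : eigen_system k e ->
  mu k.+1 * dot (p w) (p w) <=
  q w w + \sum_(j < k) (mu k.+1 - mu j.+1) * dot (p w) (e j) ^+ 2.
Proof.
move=> es; have [eA eO] := es.
have [f Hf] : exists f : 'I_k -> W, forall j, p (f j) = e j /\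
    forall v, q (f j) v = mu j.+1 * dot (e j) (p v).
  have H (j : 'I_k) : exists v : W, p v = e j /\
      forall v', q v v' = mu j.+1 * dot (e j) (p v').
    have [v [pv qv]] := eA _ (ltn_ord j); exists v; split=> // v'.
    by rewrite qv (siZl dotP).
  by have [f Hf] := choice H; exists f.
pose a (j : 'I_k) := dot (p w) (e j).
pose v := w - \sum_j a j *: f j.
have pvE : p v = p w - \sum_j a j *: e j.
  by rewrite /v linearB linear_sum; congr (_ - _);
    apply: eq_bigr => j _; rewrite linearZ (Hf j).1.
have ve j : (j < k)%N -> dot (p v) (e j) = 0.
  move=> jk; rewrite pvE (siBl dotP) (si_suml dotP) (bigD1 (Ordinal jk))//= big1.
    by rewrite (siZl dotP) eO// eqxx mulr1 addr0 subrr.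
  move=> i ij; rewrite (siZl dotP) eO//.
  by move: ij; rewrite -val_eqE /= => /negbTE->; rewrite mulr0.
have := rayleigh_orth es ve.
have -> : dot (p v) (p v) = dot (p w) (p w) - \sum_j a j ^+ 2.
  rewrite {2}pvE (siBr dotP) (si_sumr dotP) [X in _ - X]big1 ?subr0; last first.
    by move=> j _; rewrite (siZr dotP) ve ?mulr0.
  rewrite pvE (siBl dotP) (si_suml dotP); congr (_ - _); apply: eq_bigr => j _.
  by rewrite (siZl dotP) (siC dotP) expr2.
have -> : q v v = q w w - \sum_(j < k) mu j.+1 * a j ^+ 2.
  have qfv j : q (f j) v = 0 by rewrite (Hf j).2 (siC dotP) ve ?mulr0.
  rewrite {2}/v (siBr qP) (si_sumr qP) [X in _ - X]big1 ?subr0; last first.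
    by move=> j _; rewrite (siZr qP) (siC qP) qfv mulr0.
  rewrite /v (siBl qP) (si_suml qP); congr (_ - _); apply: eq_bigr => j _.
  by rewrite (siZl qP) (Hf j).2 (siC dotP) -/(a j); ring.
rewrite mulrBr; under [X in _ -> _ <= _ + X]eq_bigr do rewrite mulrBl.
rewrite sumrB -mulr_sumr; lra.
Qed.

End min_max.

(** * Borel sets and Fubini's theorem on R^n *)

Section borel_rV.
Context {R : realType} (n : nat).
Implicit Types (A : set 'rV[R]_n) (f : 'rV[R]_n -> R).

Lemma measurable_rV_box (A : 'I_n -> set (measurableTypeR R)) :
  (forall i, measurable (A i)) ->
  measurable [set x : 'rV[R]_n | forall i, A i (x ord0 i)].
Proof.
move=> mA.
rewrite (_ : [set _ | _] = \bigcap_(i in [set: 'I_n])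
    (fun x : 'rV[R]_n => x ord0 i) @^-1` A i); last first.
  by apply/seteqP; split=> x /= Bx i *; exact: Bx.
apply: fin_bigcap_measurable => [|i _]; first exact: finite_finset.
by have := measurable_rV_coord i measurableT (mA i); rewrite setTI.
Qed.

Lemma nbhs_ball_rV (x : 'rV[R]_n) A : nbhs x A ->
  exists2 e, 0 < e & forall y : 'rV[R]_n, (forall i, `|x ord0 i - y ord0 i| < e) -> A y.
Proof.
move=> /nbhs_ballP[e /= e0 xA]; exists e => // y xy; apply: xA.
split=> // i j; rewrite [i]ord1; exact: xy.
Qed.

(** An open set is a countable union of cubes with rational centers and radii
   the inverses of integers. *)
Lemma open_measurable_rV A : open A -> measurable A.
Proof.
move=> oA.
pose B (p : 'rV[rat]_n * nat) := [set x : 'rV[R]_n |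
  forall i, ball (ratr (p.1 ord0 i) : R) (p.2.+1%:R^-1) (x ord0 i)].
pose C (p : 'rV[rat]_n * nat) := if `[< B p `<=` A >] then B p else set0.
have -> : A = \bigcup_p C p.
  apply/seteqP; split=> [x Ax|x [p _]]; last first.
    by rewrite /C; case: asboolP => // BA /BA.
  have [e e0 HA] := nbhs_ball_rV (open_nbhs_nbhs (conj oA Ax)).
  have [m me] : exists m : nat, m.+1%:R^-1 < e / 2.
    have [m] := ltr_add_invr (divr_gt0 e0 (@ltr0Sn R 1)).
    by rewrite add0r; exists m.
  have /choice[r Hr] : forall i, exists r : rat, ball (x ord0 i) (m.+1%:R^-1) (ratr r : R).
    move=> i; have : x ord0 i - m.+1%:R^-1 < x ord0 i + m.+1%:R^-1.
      by rewrite ltrBlDr -addrA ltrDl addr_gt0// invr_gt0.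
    move=> /rat_in_itvoo[r]; rewrite in_itv/= => /andP[r1 r2]; exists r.
    by rewrite /ball/= ltr_distlC r1 r2.
  exists (\row_i r i, m) => //; rewrite /C; case: asboolP => [_ i|]; last first.
    case=> y Hy; apply: HA => i; have := Hy i; have := Hr i.
    rewrite /ball/= mxE => h1 h2; rewrite -(subrK (ratr (r i)) (x ord0 i)) -addrA.
    by rewrite (le_lt_trans (ler_normD _ _))// (splitr e) ltrD// (lt_trans _ me).
  by rewrite /= mxE; apply: ball_sym; exact: Hr.
apply: countable_bigcupT_measurable => [|p]; first exact: countableP.
rewrite /C; case: asboolP => // _; apply: (measurable_rV_box (A := fun i =>
  ball (ratr (p.1 ord0 i) : R) (p.2.+1%:R^-1))) => i; rewrite ball_itv; exact: measurable_itv.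
Qed.

Lemma continuous_measurable_rV f : continuous f -> measurable_fun setT f.
Proof.
move=> /continuousP cf; apply: (measurability _ (RGenOpens.measurableE R)).
move=> _ [_ [a [b ->] <-]]; rewrite setTI; apply: open_measurable_rV.
exact/cf/interval_open.
Qed.

End borel_rV.

Section fubini_rV.
Context {R : realType}.
Local Open Scope ereal_scope.

Lemma ge0_integral_rVS n (f : 'rV[R]_n.+1 -> \bar R) :
  measurable_fun setT f -> (forall x, 0 <= f x) ->
  \int[lebesgue_rV n.+1]_x f x =
  \int[lebesgue_measure \x lebesgue_rV n]_p f (rV_cons p).
Proof.
move=> mf f0; rewrite -(@ge0_integral_pushforward _ _ _ _ _ (@rV_cons R n)
  (@measurable_rV_cons R n) _ setT)//.
Qed.

Lemma integrable_rVS n (f : 'rV[R]_n.+1 -> \bar R) :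
  (lebesgue_rV n.+1).-integrable setT f ->
  (lebesgue_measure \x lebesgue_rV n).-integrable setT (f \o (@rV_cons R n)).
Proof.
move=> /integrableP[mf fi]; apply/integrableP; split.
  by apply: measurableT_comp => //; exact: measurable_rV_cons.
move: fi; rewrite ge0_integral_rVS//; exact: measurableT_comp.
Qed.

Lemma integral_rVS n (f : 'rV[R]_n.+1 -> \bar R) :
  (lebesgue_rV n.+1).-integrable setT f ->
  \int[lebesgue_rV n.+1]_x f x =
  \int[lebesgue_measure \x lebesgue_rV n]_p f (rV_cons p).
Proof.
move=> fi; have /integrableP[mf _] := fi.
rewrite -(@integral_pushforward _ _ _ _ _ (@rV_cons R n)
  (@measurable_rV_cons R n) _ setT f)//; exact: integrable_rVS.
Qed.

End fubini_rV.

Section box.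
Context {R : realType}.

Definition box n (L : R) : set 'rV[R]_n := [set x | forall i, `[- L, L]%classic (x ord0 i)].

Lemma measurable_box n (L : R) : measurable (@box n L).
Proof. exact: (@measurable_rV_box R n (fun=> `[- L, L]%classic)). Qed.

Lemma box_norm n (L : R) (x : 'rV[R]_n) : box L x <-> forall i, `|x ord0 i| <= L.
Proof.
by split=> H i; have := H i; rewrite /= in_itv/= ler_norml.
Qed.

Lemma lebesgue_rV_box n (L : R) : 0 <= L ->
  lebesgue_rV n (box L) = ((2 * L) ^+ n)%:E.
Proof.
move=> L0; rewrite (@lebesgue_rV_prod R n (fun=> `[- L, L]%classic))//.
rewrite -[in RHS](card_ord n) -prodr_const -prodEFin.
apply: eq_bigr => i _; rewrite lebesgue_measure_itv/= lte_fin.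
case: ltP => [_|h]; first by rewrite -EFinB; congr _%:E; lra.
by congr _%:E; lra.
Qed.

(** Bounded functions of bounded support: a class on which Fubini's theorem
   applies and which is stable by taking sections. *)
Definition boxed n (f : 'rV[R]_n -> R) := measurable_fun setT f /\
  exists M L, (forall x, `|f x| <= M) /\ (forall x, ~ box L x -> f x = 0).

Lemma boxed_integrable n (f : 'rV[R]_n -> R) : boxed f ->
  (lebesgue_rV n).-integrable setT (EFin \o f).
Proof.
move=> [mf [M [L [fM fL]]]].
wlog L0 : L fL / 0 <= L.
  move=> /(_ (Num.max L 0)); apply; last by rewrite le_max lexx orbT.
  move=> x Bx; apply: fL => Bx'; apply: Bx; apply/box_norm => i.
  by rewrite le_max (box_norm _ _).1.
have -> : EFin \o f = (EFin \o f) \_ (box L).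
  apply/funext => x; rewrite patchE; case: ifPn => //; rewrite notin_setE => /fL.
  by rewrite /= => ->.
apply: (proj1 (integrable_mkcond _ (measurable_box L))).
apply: measurable_bounded_integrable.
- exact: measurable_box.
- by rewrite [ltLHS]lebesgue_rV_box// ltry.
- exact: measurable_funTS.
- by exists M; split; [exact: num_real|move=> N MN x _ /=; rewrite (le_trans (fM x))// ltW].
Qed.

(** The line through x parallel to the i-th axis. *)
Definition upd n (x : 'rV[R]_n) i t : 'rV[R]_n :=
  \row_j if j == i then t else x ord0 j.

Lemma upd_cons0 n s t (v : 'rV[R]_n) : upd (rV_cons (s, v)) ord0 t = rV_cons (t, v).
Proof.
apply/rowP => i; rewrite mxE; case: (unliftP ord0 i) => [j ->|->].
  by rewrite !rV_consS.
by rewrite eqxx rV_cons0.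
Qed.

Lemma upd_consS n s t (v : 'rV[R]_n) j :
  upd (rV_cons (s, v)) (lift ord0 j) t = rV_cons (s, upd v j t).
Proof.
apply/rowP => i; rewrite mxE; case: (unliftP ord0 i) => [k ->|->].
  by rewrite !rV_consS mxE (inj_eq (@lift_inj _ _)).
by rewrite !rV_cons0 (negbTE (neq_lift _ _)).
Qed.

Lemma boxed_cons n (f : 'rV[R]_n.+1 -> R) t : boxed f ->
  boxed (fun v => f (rV_cons (t, v))).
Proof.
move=> [mf [M [L [fM fL]]]]; split.
  apply: measurableT_comp => //; apply: (measurableT_comp (@measurable_rV_cons R n)).
  exact: measurable_pair1.
exists M, L; split=> [x|x Bx]; first exact: fM.
by apply: fL => B; apply: Bx => i; have := B (lift ord0 i); rewrite rV_consS.
Qed.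

(** By Fubini, an integral vanishes as soon as it vanishes along all the lines
   parallel to some axis. *)
Lemma integral_lines0 n (f : 'rV[R]_n -> R) i : boxed f ->
  (forall x, \int[lebesgue_measure]_t (f (upd x i t))%:E = 0)%E ->
  (\int[lebesgue_rV n]_x (f x)%:E = 0)%E.
Proof.
elim: n f i => [f []//|n IH f i bf].
have intf := boxed_integrable bf.
have intfc := integrable_rVS intf.
case: (unliftP ord0 i) => [j ->|->] f0; rewrite integral_rVS//.
  rewrite -(integral12_prod_meas1 intfc); apply: integral0_eq => t _.
  rewrite /fubini_F; apply: (IH _ j (boxed_cons t bf)) => x.
  by rewrite -(f0 (rV_cons (t, x))); apply: eq_integral => s _; rewrite upd_consS.
rewrite -(integral21_prod_meas1 intfc); apply: integral0_eq => v _.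
rewrite /fubini_G -(f0 (rV_cons (0, v))).
by apply: eq_integral => s _; rewrite upd_cons0.
Qed.

End box.

(** * Completeness of L^2 *)

Section geometric_cvg.
Context {R : realType}.

(** The sequences a n - g n and a n + g n are adjacent, where g n is the tail of
   the geometric series that bounds the increments from n on. *)
Lemma geometric_cauchy (a : nat -> R) (c t : R) : 0 <= t < 1 ->
  (forall n, `|a n.+1 - a n| <= c * t ^+ n) ->
  a @ \oo --> limn a /\ forall n, `|a n - limn a| <= c / (1 - t) * t ^+ n.
Proof.
move=> /andP[t0 t1] ac.
pose g n := c / (1 - t) * t ^+ n.
have t1' : 0 < 1 - t by rewrite subr_gt0.
have gE n : g n = c * t ^+ n + g n.+1.
  by rewrite /g exprS; field; rewrite subr_eq0 gt_eqF.
have c0 : 0 <= c by have := ac 0%N; rewrite expr0 mulr1; apply: le_trans.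
have g0 n : 0 <= g n by rewrite mulr_ge0 ?exprn_ge0// divr_ge0// ltW.
have gcvg : g @ \oo --> 0.
  have := @cvg_geometric R (c / (1 - t)) t; apply; by rewrite ger0_norm.
have nd : nondecreasing_seq (fun n => a n - g n).
  apply/nondecreasing_seqP => n; have := ac n; rewrite (gE n) ler_norml => /andP[+ _]; lra.
have ni : nonincreasing_seq (fun n => a n + g n).
  apply/nonincreasing_seqP => n; have := ac n; rewrite (gE n) ler_norml => /andP[_]; lra.
have cb : cvgn (fun n => a n - g n).
  apply: nondecreasing_is_cvgn => //; exists (a 0%N + g 0%N) => _ [n _ <-].
  have := ni 0%N n (leq0n n); have := g0 n; lra.
have ca : a @ \oo --> limn (fun n => a n - g n).
  rewrite [X in X @ _ --> _](_ : a = (fun n => (a n - g n) + g n)); last first.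
    by apply/funext => n; rewrite subrK.
  rewrite -[X in _ --> X]addr0; apply: cvgD => //.
have la : limn a = limn (fun n => a n - g n) by apply/cvg_lim.
split; first by rewrite la.
move=> n; rewrite -/(g n) ler_distl.
have h1 := nondecreasing_cvgn_le nd cb n.
have ce : (fun n => a n + g n) @ \oo --> limn a.
  by rewrite -[X in _ --> X]addr0; apply: cvgD => //; rewrite la.
have h2 := nonincreasing_cvgn_ge ni (cvgP _ ce) n.
move: h2; rewrite (cvg_lim _ ce)// => h2; move: h1; rewrite -la => h1.
by apply/andP; split; [lra|lra].
Qed.

End geometric_cvg.

Section L2.
Context {R : realType} (n : nat) (D : set 'rV[R]_n).
Hypothesis mD : measurable D.
Local Notation leb := (lebesgue_rV n : {measure set 'rV[R]_n -> \bar R}).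
Implicit Types f g h : 'rV[R]_n -> R.
Local Notation dist2 f g := (L2_dot D (fun y => f y - g y) (fun y => f y - g y)).

Lemma integrable_scale a f : leb.-integrable D (EFin \o f) ->
  leb.-integrable D (EFin \o (fun x => a * f x)).
Proof. by move=> fi; have := integrableZl mD a fi; apply. Qed.

Lemma L2_meas f : L2 D f -> measurable_fun D f. Proof. by case. Qed.

Lemma L2_sqr_integrable f : L2 D f -> leb.-integrable D (EFin \o (fun x => f x ^+ 2)).
Proof.
move=> [mf fi]; apply/integrableP; split.
  by apply/measurable_EFinP; exact: measurable_funX.
by under eq_integral do rewrite /= ger0_norm ?sqr_ge0//.
Qed.

Lemma L2_mul_integrable f g : L2 D f -> L2 D g ->
  leb.-integrable D (EFin \o (fun x => f x * g x)).
Proof.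
move=> f2 g2; have fi := L2_sqr_integrable f2; have gi := L2_sqr_integrable g2.
apply: le_integrable (integrableD mD fi gi) => //.
  by apply/measurable_EFinP; apply: measurable_funM; exact: L2_meas.
move=> x _ /=; rewrite lee_fin [leRHS]ger0_norm ?addr_ge0 ?sqr_ge0//.
rewrite normrM -(real_normK (num_real (f x))) -(real_normK (num_real (g x))).
have := sqr_ge0 (`|f x| - `|g x|); have := normr_ge0 (f x); have := normr_ge0 (g x).
nra.
Qed.

Lemma L2_intro f : measurable_fun D f ->
  leb.-integrable D (EFin \o (fun x => f x ^+ 2)) -> L2 D f.
Proof.
move=> mf /integrableP[_ fi]; split => //; apply: le_lt_trans fi.
by rewrite le_eqVlt; apply/orP; left; apply/eqP/eq_integral => x _ /=;
  rewrite ger0_norm ?sqr_ge0.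
Qed.

Lemma L2_lin a f g : L2 D f -> L2 D g -> L2 D (fun x => a * f x + g x).
Proof.
move=> f2 g2; apply: L2_intro.
  apply: measurable_funD; last exact: L2_meas.
  by apply: measurable_funM => //; exact: L2_meas.
pose ff := EFin \o (fun x => f x ^+ 2); pose fg := EFin \o (fun x => f x * g x).
have -> : EFin \o (fun x => (a * f x + g x) ^+ 2) =
  ((fun x => (a ^+ 2)%R%:E * ff x) \+
  ((fun x => (2 * a)%R%:E * fg x) \+ (EFin \o (fun x => (g x ^+ 2)%R))))%E.
  by apply/funext => x; rewrite /ff /fg /= -!EFinM -!EFinD; congr _%:E; ring.
apply: integrableD => //; first by apply: integrableZl => //; exact: L2_sqr_integrable.
apply: integrableD => //; last exact: L2_sqr_integrable.
by apply: integrableZl => //; exact: L2_mul_integrable.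
Qed.

Lemma L2_0 : L2 D (fun=> 0).
Proof.
split=> //; rewrite integral0_eq ?ltry// => x _; by rewrite expr0n.
Qed.

Lemma L2_subset (E : set 'rV[R]_n) f : measurable E -> E `<=` D -> L2 D f -> L2 E f.
Proof.
move=> mE ED f2; have [mf _] := f2; split; first exact: measurable_funS mf.
have /integrableP[_] := @integrableS _ _ _ leb _ _ _ mD mE ED (L2_sqr_integrable f2).
by under eq_integral do rewrite /= ger0_norm ?sqr_ge0//.
Qed.

Lemma L2_dotC f g : L2_dot D f g = L2_dot D g f.
Proof. by apply: eq_Rintegral => x _; rewrite mulrC. Qed.

Lemma L2_dot_lin a f g h : L2 D f -> L2 D g -> L2 D h ->
  L2_dot D (fun x => a * f x + g x) h = a * L2_dot D f h + L2_dot D g h.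
Proof.
move=> f2 g2 h2; rewrite /L2_dot.
have fh := L2_mul_integrable f2 h2.
rewrite -(RintegralZl a mD fh) -RintegralD//; last 2 first.
- exact: integrable_scale.
- exact: L2_mul_integrable.
by apply: eq_Rintegral => x _; ring.
Qed.

Lemma L2_dot_ge0 f : 0 <= L2_dot D f f.
Proof. by apply: Rintegral_ge0 => x _; rewrite -expr2 sqr_ge0. Qed.

Lemma L2_dotE f g : L2 D f -> L2 D g ->
  ((L2_dot D f g)%:E = \int[leb]_(x in D) (f x * g x)%:E)%E.
Proof.
move=> f2 g2; rewrite fineK//; apply: integrable_fin_num => //.
exact: L2_mul_integrable.
Qed.

Lemma L2_dot_null f g : L2 D f -> L2 D g ->
  dist2 f g = 0 <-> ae_eq leb D f g.
Proof.
move=> f2 g2.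
have fg2 : L2 D (fun x => f x - g x).
  have := L2_lin (-1) g2 f2; congr (L2 D); apply/funext => x; ring.
have mfg : measurable_fun D (EFin \o (fun x => (f x - g x) ^+ 2)).
  by apply/measurable_EFinP; apply: measurable_funX; exact: L2_meas.
have E : (\int[leb]_(x in D) `|((f x - g x) ^+ 2)%R%:E| = (dist2 f g)%:E)%E.
  by rewrite L2_dotE//; apply: eq_integral => x _ /=; rewrite ger0_norm ?sqr_ge0// expr2.
have [H1 H2] := ae_eq_integral_abs leb mD mfg; rewrite E in H1 H2.
split=> [d0|fg].
  have := H1 (congr1 EFin d0); apply: filterS => x /= H Dx.
  by have [/eqP] := H Dx; rewrite sqrf_eq0 subr_eq0 => /eqP.
have : ae_eq leb D (EFin \o (fun x => (f x - g x) ^+ 2)) (cst 0%E).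
  by apply: filterS fg => x /= H Dx; rewrite H// subrr expr0n.
by move=> /H2 [].
Qed.

(** The Riesz-Fischer theorem for geometric sequences. With s the square root of
   r, the sum G of the squared increments weighted by s^-m is integrable; where
   it is finite it bounds every increment by a geometric sequence of ratio the
   square root t of s, and it controls the distance to the pointwise limit. *)
Lemma L2_geometric_complete (x : nat -> 'rV[R]_n -> R) (C r : R) :
  0 <= r < 1 -> (forall m, L2 D (x m)) ->
  (forall m, dist2 (x m.+1) (x m)
     <= C * r ^+ m) ->
  exists2 l, L2 D l &
    (fun m => dist2 (x m) l) @ \oo --> 0.
Proof.
move=> r01 x2 xC.
(* The weights require a positive ratio. *)
wlog r0 : r r01 xC / 0 < r.
  move=> W; have /andP[r0 r1] := r01.
  apply: (W (Num.max r 2^-1)).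
  - by rewrite le_max r0/= gt_max r1/= invf_lt1// ltr1n.
  - move=> m; apply: le_trans (xC m) _; rewrite ler_wpM2l//.
      by have := xC 0%N; rewrite expr0 mulr1; apply: le_trans; exact: L2_dot_ge0.
    by rewrite lerXn2r ?nnegrE// ?le_max ?lexx// ?r0// invr_ge0.
  - by rewrite lt_max invr_gt0 ltr0n orbT.
have r1 : r < 1 by case/andP: r01.
have C0 : 0 <= C.
  by have := xC 0%N; rewrite expr0 mulr1; apply: le_trans; exact: L2_dot_ge0.
pose s := Num.sqrt r.
have s0 : 0 < s by rewrite sqrtr_gt0.
have ss : s ^+ 2 = r by rewrite sqr_sqrtr// ltW.
have s1 : s < 1 by rewrite -(@ltr_pXn2r _ 2%N) ?nnegrE ?(ltW s0)// ss expr1n.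
pose t := Num.sqrt s.
have t0 : 0 < t by rewrite sqrtr_gt0.
have tt : t ^+ 2 = s by rewrite sqr_sqrtr// ltW.
have t1 : t < 1 by rewrite -(@ltr_pXn2r _ 2%N) ?nnegrE ?(ltW t0)// tt expr1n.
have sub2 f g : L2 D f -> L2 D g -> L2 D (fun x => f x - g x).
  move=> f2 g2; have := L2_lin (-1) g2 f2; congr (L2 D); apply/funext => y; ring.
pose dd m y := (s ^- m * (x m.+1 y - x m y) ^+ 2)%:E.
have dd0 m y : (0 <= dd m y)%E
  by rewrite lee_fin mulr_ge0 ?sqr_ge0// invr_ge0 exprn_ge0// ltW.
have mdd m : measurable_fun D (dd m).
  apply/measurable_EFinP; apply: measurable_funM => //; apply: measurable_funX.
  by apply: L2_meas; exact: sub2.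
pose G y := (\sum_(m <oo) dd m y)%E.
have G0 y : (0 <= G y)%E by apply: nneseries_ge0 => m _ _; exact: dd0.
have mG : measurable_fun D G.
  have := @ge0_emeasurable_sum _ _ R D dd xpredT; apply => // m y _ _; exact: dd0.
have Gdd m y : (dd m y <= G y)%E.
  apply: le_trans (nneseries_lim_ge m.+1 _); last by move=> *; exact: dd0.
  by rewrite big_nat_recr//= leeDr// sume_ge0.
have intG : (\int[leb]_(y in D) G y < +oo)%E.
  rewrite integral_nneseries//.
  apply: (@le_lt_trans _ _ (\sum_(m <oo) (C * s ^+ m)%:E)%E).
    apply: lee_nneseries => [m _ _|m _]; first by apply: integral_ge0 => y _; exact: dd0.
    have -> : (\int[leb]_(y in D) dd m y = (s ^- m)%:E *
        (dist2 (x m.+1) (x m))%:E)%E.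
      have h2 := sub2 _ _ (x2 m.+1) (x2 m).
      rewrite L2_dotE// -ge0_integralZl//.
      - by apply/measurable_EFinP; apply: measurable_funM; exact: L2_meas.
      - by move=> y _; rewrite lee_fin -expr2 sqr_ge0.
      - by rewrite lee_fin invr_ge0 exprn_ge0 ?ltW.
    rewrite -EFinM lee_fin ler_pdivrMl ?exprn_gt0// (le_trans (xC m))//.
    by rewrite -ss -exprM mul2n -addnn exprD mulrCA.
  have cvC : cvgn (series (geometric C s)).
    by apply: is_cvg_geometric_series; rewrite ger0_norm// ltW.
  rewrite (_ : limn _ = limn (EFin \o series (geometric C s))).
    by rewrite EFin_lim// ltry.
  by congr (limn _); apply/funext => k; rewrite /= /series/= sumEFin.
have dxG m y k : G y = k%:E -> `|x m.+1 y - x m y| <= Num.sqrt k * t ^+ m.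
  move=> Gk; have := Gdd m y; rewrite Gk lee_fin ler_pdivrMl ?exprn_gt0// => h.
  have k0 : 0 <= k by have := G0 y; rewrite Gk.
  rewrite -(@ler_pXn2r _ 2%N) ?nnegrE ?mulr_ge0 ?sqrtr_ge0 ?exprn_ge0 ?(ltW t0)//.
  by rewrite real_normK ?num_real// exprMn sqr_sqrtr// -exprM mulnC exprM tt mulrC.
pose l y := if G y == +oo%E then 0 else limn (x ^~ y).
have Gfin y : G y != +oo%E -> exists k, G y = k%:E.
  by move=> Gy; exists (fine (G y)); rewrite fineK// ge0_fin_numE// ltey.
have xl y k : G y = k%:E -> x ^~ y @ \oo --> l y /\
    forall m, `|x m y - l y| <= Num.sqrt k / (1 - t) * t ^+ m.
  move=> Gk; rewrite /l Gk/=; apply: geometric_cauchy; first by rewrite (ltW t0).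
  by move=> m; exact: dxG.
have ml : measurable_fun D l.
  apply: (@measurable_fun_cvg _ _ _ D (fun m y => if G y == +oo%E then 0 else x m y)).
    move=> m; have mGy : measurable_fun D (fun y => G y == +oo%E).
      apply: (measurable_fun_bool true).
      rewrite (_ : _ @^-1` _ = G @^-1` [set +oo%E]); first exact: mG.
      by apply/seteqP; split => y /= /eqP.
    apply: measurable_fun_if => //.
    apply: measurable_funS (L2_meas (x2 m)) => //; exact: subIsetl.
  move=> y _ /=; have [Gy|Gy] := eqVneq (G y) +oo%E.
    by rewrite /l Gy eqxx; exact: cvg_cst.
  by have [k /xl[]] := Gfin _ Gy.
pose K := fine (\int[leb]_(y in D) G y) / (1 - t) ^+ 2.
have GK m : (\int[leb]_(y in D) ((x m y - l y) ^+ 2)%:E <= (K * s ^+ m)%:E)%E.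
  apply: (@le_trans _ _ (\int[leb]_(y in D) (((1 - t) ^- 2 * s ^+ m)%:E * G y))%E).
    apply: ge0_le_integral => //.
    - by move=> y _; rewrite lee_fin sqr_ge0.
    - apply/measurable_EFinP; apply: measurable_funX; apply: measurable_funB => //.
      exact: L2_meas.
    - by apply: measurable_funeM.
    move=> y _; have [Gy|Gy] := eqVneq (G y) +oo%E.
      by rewrite Gy gt0_muley ?leey// lte_fin mulr_gt0 ?exprn_gt0//
        invr_gt0 exprn_gt0// subr_gt0.
    have [k Gk] := Gfin _ Gy; have [_ /(_ m)] := xl _ _ Gk.
    have k0 : 0 <= k by have := G0 y; rewrite Gk.
    rewrite Gk -EFinM lee_fin => h.
    rewrite -real_normK ?num_real//.
    have := lerXn2r 2 _ _ h; rewrite !nnegrE normr_ge0 => /(_ isT).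
    have h0 := le_trans (normr_ge0 _) h.
    move=> /(_ h0)/le_trans; apply.
    rewrite !exprMn sqr_sqrtr// exprVn -exprM mulnC exprM tt.
    by rewrite le_eqVlt; apply/orP; left; apply/eqP; ring.
  rewrite ge0_integralZl//; last first.
    by rewrite lee_fin mulr_ge0 ?exprn_ge0 ?invr_ge0 ?exprn_ge0 ?subr_ge0 ?(ltW t1)// ltW.
  rewrite -[X in (_ * X)%E]fineK; last first.
    by rewrite ge0_fin_numE// integral_ge0.
  by rewrite -EFinM lee_fin /K le_eqVlt; apply/orP; left; apply/eqP; ring.
have xl2 m : L2 D (fun y => x m y - l y).
  split; first by apply: measurable_funB => //; exact: L2_meas.
  by apply: le_lt_trans (GK m) _; rewrite ltry.
exists l.
  have := sub2 _ _ (x2 0%N) (xl2 0%N); congr (L2 D).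
  by apply/funext => y /=; rewrite opprB addrC subrK.
apply: (@squeeze_cvgr _ _ _ _ (fun=> 0) (geometric K s)).
- near=> m; rewrite L2_dot_ge0 /=; rewrite -lee_fin L2_dotE//.
  by under eq_integral do rewrite -expr2; exact: GK.
- exact: cvg_cst.
- by apply: cvg_geometric; rewrite ger0_norm// ltW.
Unshelve. all: by end_near.
Qed.

End L2.

(** * The Neumann form as an abstract form *)

Section boxed_facts.
Context {R : realType} (n : nat).
Implicit Types (f phi : 'rV[R]_n -> R).

Lemma boxed_L2 (D : set 'rV[R]_n) f : measurable D -> boxed f -> L2 D f.
Proof.
move=> mD bf; apply: (L2_subset measurableT mD) => //.
have [mf [M [L [fM fL]]]] := bf.
apply: L2_intro => //; apply: boxed_integrable; split; first exact: measurable_funX.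
exists (M ^+ 2), L; split=> [x|x /fL ->]; last by rewrite expr0n.
by rewrite normrX lerXn2r ?nnegrE// (le_trans _ (fM x)).
Qed.

Lemma box_compact (L : R) : compact (@box R n L).
Proof.
exact: (@rV_compact R n (fun=> `[- L, L]%classic) (fun=> @segment_compact R _ _)).
Qed.

Lemma continuous_bounded_box f (L : R) : continuous f ->
  exists M, forall x, box L x -> `|f x| <= M.
Proof.
move=> cf; have : compact (f @` box L).
  by apply: continuous_compact; [exact: continuous_subspaceT|exact: box_compact].
move=> /compact_bounded[M [_ HM]]; exists (M + 1) => x Bx.
by apply: HM; [rewrite ltrDl|exists x].
Qed.

Lemma boxed_continuous f (L : R) : continuous f -> (forall x, ~ box L x -> f x = 0) ->
  boxed f.
Proof.
move=> cf fL; split; first exact: continuous_measurable_rV.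
have [M HM] := continuous_bounded_box L cf.
exists (Num.max M 0), L; split=> // x; have [Bx|Bx] := pselect (box L x).
  by rewrite le_max HM.
by rewrite fL// normr0 le_max lexx orbT.
Qed.

Lemma bounded_set_box (A : set 'rV[R]_n) : bounded_set A ->
  exists2 L, 0 < L & A `<=` box L.
Proof.
move=> [M [_ HM]]; exists (Num.max M 0 + 1); first by rewrite ltr_wpDl// le_max lexx orbT.
move=> x Ax; apply/box_norm => i.
have := HM (Num.max M 0 + 1) _ x Ax;
  rewrite (le_lt_trans (y := Num.max M 0)) ?ltrDl ?le_max ?lexx//.
move=> /(_ isT); apply: le_trans.
rewrite /Num.norm/= mx_normrE; apply: (le_trans _ (le_bigmax _ _ (ord0, i))) => //.
Qed.

(** A derivative vanishes outside of the closure of the support. *)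
Lemma test_function_boxed phi i : test_function phi ->
  boxed phi /\ boxed (partial i phi).
Proof.
move=> [sm cphi]; have [L _ HL] := bounded_set_box (compact_bounded cphi).
have phi0 x : ~ box L x -> phi x = 0.
  by move=> Bx; apply/eqP/negPn/negP => px; apply: Bx; apply: HL; exact: subset_closure.
split; apply: (@boxed_continuous _ L) => //.
- exact: (sm [::]).1.
- exact: (sm [:: i]).1.
move=> x Bx; rewrite (_ : partial i phi x = 'D_(delta_mx ord0 i) (cst 0 : 'rV[R]_n -> R) x).
  by rewrite derive_cst.
apply: near_eq_derive; have /closed_openC oC := @closed_closure _ [set x | phi x != 0].
have := open_nbhs_nbhs (conj oC (fun cx => Bx (HL _ cx))).
by apply: filterS => y Cy; apply/eqP/negPn/negP => py; apply: Cy; exact: subset_closure.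
Qed.

End boxed_facts.

Section L2_lmod.
Context {R : realType} (n : nat) (D : set 'rV[R]_n) (mD : measurable D).

(** The proof of measurability is a parameter so that the module structure of
   [L2_type] can be inferred. *)
Definition L2_pred of measurable D : {pred 'rV[R]_n -> R} := fun f => `[<L2 D f>].

Lemma L2_predP : GRing.submod_closed (L2_pred mD).
Proof.
split=> [|a f g]; rewrite !unfold_in.
  by apply/asboolP; exact: L2_0.
by move=> /asboolP f2 /asboolP g2; apply/asboolP; exact: L2_lin.
Qed.

HB.instance Definition _ :=
  GRing.isSubmodClosed.Build R ('rV[R]_n -> R) (L2_pred mD) L2_predP.

Definition L2_type := {f : 'rV[R]_n -> R | L2_pred mD f}.
HB.instance Definition _ := SubChoice.on L2_type.
HB.instance Definition _ := [SubChoice_isSubLmodule of L2_type by <:].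

Lemma L2_typeP (f : L2_type) : L2 D (val f).
Proof. exact: (asboolW (valP f)). Qed.

Definition mk_L2 f (f2 : L2 D f) : L2_type := Sub f (asboolT f2).

Definition L2d (f g : L2_type) := L2_dot D (val f) (val g).

Lemma semi_inner_L2d : semi_inner L2d.
Proof.
split=> [f g|a f g h|f]; first exact: L2_dotC.
  by rewrite /L2d linearP L2_dot_lin//; exact: L2_typeP.
exact: L2_dot_ge0.
Qed.

Lemma L2d_complete : si_complete L2d.
Proof.
move=> x C r r01 xC.
have [l l2 xl] := L2_geometric_complete mD r01 (fun m => L2_typeP (x m)) xC.
by exists (mk_L2 l2); exact: xl.
Qed.

Lemma L2d_null (f g : L2_type) :
  L2d (f - g) (f - g) = 0 <-> ae_eq (lebesgue_rV n) D (val f) (val g).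
Proof. by rewrite -L2_dot_null//; exact: L2_typeP. Qed.

Lemma H1_grad_lin a (F F' : 'rV[R]_n -> R) G G' : H1_grad F G -> H1_grad F' G' ->
  H1_grad (fun x => a * F x + F' x) (fun i x => a * G i x + G' i x).
Proof.
move=> [F2 G2 FG] [F2' G2' FG']; split; first exact: L2_lin.
  by move=> i; exact: L2_lin.
move=> phi tphi i; have [bphi bdphi] := test_function_boxed i tphi.
have e1 : L2_dot setT F (partial i phi) = - L2_dot setT (G i) phi := FG _ tphi i.
have e2 : L2_dot setT F' (partial i phi) = - L2_dot setT (G' i) phi := FG' _ tphi i.
have phi2 := boxed_L2 measurableT bphi; have dphi2 := boxed_L2 measurableT bdphi.
rewrite -/(L2_dot setT (fun x => a * F x + F' x) (partial i phi)).
rewrite -/(L2_dot setT (fun x => a * G i x + G' i x) phi).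
by rewrite !L2_dot_lin// e1 e2; ring.
Qed.

Lemma H1_grad0 : H1_grad (fun _ : 'rV[R]_n => 0 : R) (fun _ _ => 0).
Proof.
split; [exact: L2_0|by move=> i; exact: L2_0|move=> phi tphi i].
by under eq_Rintegral do rewrite mul0r; under [in RHS]eq_Rintegral do rewrite mul0r;
  rewrite Rintegral_cst// mul0r oppr0.
Qed.

(** Elements of the form domain are pairs of a function and its gradient. *)
Definition form_pred of measurable D :
    {pred ('rV[R]_n -> R) * ('I_n -> 'rV[R]_n -> R)} :=
  fun w => `[<neumann_form_domain D w.1 w.2>].

Lemma form_predP : GRing.submod_closed (form_pred mD).
Proof.
split=> [|a [u G] [v K]]; rewrite !unfold_in.
  apply/asboolP; split; first exact: L2_0.
  by exists (fun=> 0); split; [exact: H1_grad0|apply: aeW].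
move=> /asboolP[u2 [F [FG uF]]] /asboolP[v2 [F' [FG' vF']]].
apply/asboolP; rewrite (_ : a *: (u, G) + (v, K) =
  ((fun x => a * u x + v x), (fun i x => a * G i x + K i x)))//=.
split; first exact: L2_lin.
exists (fun x => a * F x + F' x); split; first exact: H1_grad_lin FG FG'.
by apply: filterS2 uF vF' => x /= uF vF Dx; rewrite uF// vF.
Qed.

HB.instance Definition _ := GRing.isSubmodClosed.Build R
  (('rV[R]_n -> R) * ('I_n -> 'rV[R]_n -> R))%type (form_pred mD) form_predP.

Definition form_type :=
  {w : ('rV[R]_n -> R) * ('I_n -> 'rV[R]_n -> R) | form_pred mD w}.
HB.instance Definition _ := SubChoice.on form_type.
HB.instance Definition _ := [SubChoice_isSubLmodule of form_type by <:].

Lemma form_typeP (w : form_type) : neumann_form_domain D (val w).1 (val w).2.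
Proof. exact: (asboolW (valP w)). Qed.

Definition mk_form u G (uG : neumann_form_domain D u G) : form_type :=
  Sub (u, G) (asboolT uG).

Definition form_val (w : form_type) : L2_type := mk_L2 (form_typeP w).1.

Lemma form_val_linear : linear form_val.
Proof. by move=> a u v; apply/val_inj. Qed.

HB.instance Definition _ := GRing.isLinear.Build R form_type L2_type _ form_val form_val_linear.

Definition formq (w w' : form_type) := neumann_form D (val w).2 (val w').2.

Lemma form_grad_L2 (w : form_type) i : L2 D ((val w).2 i).
Proof. by have [_ [F [[_ G2 _] _]]] := form_typeP w; exact: (L2_subset measurableT). Qed.

Lemma semi_inner_formq : semi_inner formq.
Proof.
split=> [f g|a f g h|f]; first by apply: eq_bigr => i _; exact: L2_dotC.
  rewrite /formq /neumann_form mulr_sumr -big_split; apply: eq_bigr => i _ /=.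
  by rewrite -L2_dot_lin//; exact: form_grad_L2.
by apply: sumr_ge0 => i _; exact: L2_dot_ge0.
Qed.

Lemma form_val_null w v : L2d (form_val w - v) (form_val w - v) = 0 ->
  exists w', form_val w' = v /\ forall w'', formq w' w'' = formq w w''.
Proof.
move=> /L2d_null wv; have [_ [F [FG uF]]] := form_typeP w.
have dv : neumann_form_domain D (val v) (val w).2.
  split; first exact: L2_typeP.
  by exists F; split=> //; apply: filterS2 wv uF => x /= h1 h2 Dx; rewrite -h1// h2.
by exists (mk_form dv); split => //; exact/val_inj.
Qed.

Local Notation A := (form_op L2d formq form_val).

Lemma form_opE u f : A u f <-> neumann_laplacian D (val u) (val f).
Proof.
split=> [[w [<- wf]]|[f2 [G [uG wf]]]].
  split; first exact: L2_typeP.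
  exists (val w).2; split; first exact: form_typeP.
  by move=> v K vK; exact: (wf (mk_form vK)).
exists (mk_form uG); split; first exact/val_inj.
by move=> w; apply: wf; exact: form_typeP.
Qed.

Lemma form_resolventE lam : neumann_resolvent_set D lam ->
  form_resolvent L2d formq form_val lam.
Proof.
move=> [surj [C HC]]; split.
  move=> f; have [u uf] := surj _ (L2_typeP f).
  have [_ [G [[u2 _] _]]] := uf.
  by exists (mk_L2 u2); apply/form_opE.
exists (C ^+ 2) => u f /form_opE uf.
have := HC (val u) (val f) uf; rewrite /L2_norm => h.
have d0 := si_ge0 semi_inner_L2d.
rewrite -(sqr_sqrtr (d0 u)) -(sqr_sqrtr (d0 f)) -exprMn.
by rewrite lerXn2r ?nnegrE ?sqrtr_ge0// (le_trans _ h) ?sqrtr_ge0.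
Qed.

Lemma form_multE lam m : neumann_multiplicity D lam m ->
  form_mult L2d formq form_val lam m.
Proof.
move=> [e [eA eU]].
have e2 i : L2 D (e i) by have [_ [G [[]]]] := eA i.
exists (fun i => mk_L2 (e2 i)); split=> [i|u uA].
  by apply/form_opE; exact: eA.
have key (c : 'rV[R]_m) : (let v := u - \sum_(i < m) c ord0 i *: mk_L2 (e2 i) in L2d v v = 0)
    <-> ae_eq (lebesgue_rV n) D (val u) (fun x => \sum_(i < m) c ord0 i * e i x).
  rewrite /= L2d_null.
  suff -> : val (\sum_(i < m) c ord0 i *: mk_L2 (e2 i)) =
    (fun x => \sum_(i < m) c ord0 i * e i x) by [].
  rewrite raddf_sum; apply/funext => x; rewrite fct_sumE.
  by apply: eq_bigr => i _.
have [c [uc cU]] := eU (val u) (proj1 (form_opE _ _) uA).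
by exists c; split=> [|c' /key/cU]//; apply/key.
Qed.

End L2_lmod.

(** * Plane waves belong to the form domain *)

Section line.
Context {R : realType}.

Lemma is_derive_continuous (F f : R -> R) :
  (forall t, is_derive t (1 : R) F (f t)) -> continuous F.
Proof.
by move=> dF t; apply: differentiable_continuous; apply/derivable1_diffP; case: (dF t).
Qed.

Lemma FTC_is_derive (F f : R -> R) (a b : R) : a < b ->
  (forall t, is_derive t (1 : R) F (f t)) -> continuous f ->
  (\int[lebesgue_measure]_(t in `[a, b]) (f t)%:E = (F b - F a)%:E)%E.
Proof.
move=> ab dF cf; have cF := is_derive_continuous dF.
rewrite EFinB; apply: continuous_FTC2 => //.
- exact: continuous_subspaceT.
- split=> [t _||]; first by case: (dF t).
    by apply: cvg_at_right_filter; exact: cF.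
  by apply: cvg_at_left_filter; exact: cF.
- by move=> t _; rewrite derive1E; exact: derive_val.
Qed.

(** The fundamental theorem of calculus on [-(M+1), M+1]. *)
Lemma integral_derivative0 (F f : R -> R) (M : R) : 0 <= M ->
  (forall t, is_derive t (1 : R) F (f t)) -> continuous f ->
  (forall t, M < `|t| -> F t = 0 /\ f t = 0) ->
  (\int[lebesgue_measure]_t (f t)%:E = 0)%E.
Proof.
move=> M0 dF cf Ff0.
pose b := M + 1; pose a := - b.
have far : M < `|b| by rewrite ger0_norm ?addr_ge0// ltrDl.
have lt : a < b by rewrite /a /b; lra.
transitivity (\int[lebesgue_measure]_(t in `[a, b]) (f t)%:E)%E; last first.
  have -> := FTC_is_derive lt dF cf.
  rewrite (proj1 (Ff0 _ far)) (proj1 (Ff0 a _)) ?subrr//.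
  by rewrite normrN.
rewrite [RHS]integral_mkcond; apply: eq_integral => t _; rewrite patchE.
case: ifPn => // /negP nt; rewrite (proj2 (Ff0 t _))//.
rewrite ltNge; apply/negP => h; apply: nt; rewrite inE/= in_itv/= -ler_norml.
by rewrite (le_trans h)// lerDl.
Qed.

Lemma is_derive_affine (b c t : R) : is_derive t (1 : R) (fun s => b + c * s) c.
Proof.
have -> : (fun s => b + c * s) = cst b + c *: id by apply/funext.
by apply: is_derive_eq; rewrite add0r [_ *: _]mulr1.
Qed.

(** The square of the positive part, whose derivative s + |s| is continuous. *)
Definition sqpos (s : R) : R := (s ^+ 2 + s * `|s|) / 2.

Lemma sqpos_ge0E s : 0 <= s -> sqpos s = s ^+ 2.
Proof. by move=> s0; rewrite /sqpos ger0_norm//; field. Qed.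

Lemma sqpos_le0E s : s <= 0 -> sqpos s = 0.
Proof. by move=> s0; rewrite /sqpos ler0_norm//; field. Qed.

(** The increment of t |t| differs from its linear part by at most h^2. *)
Lemma is_derive_mulnorm (s : R) : is_derive s (1 : R) (fun t => t * `|t|) (2 * `|s|).
Proof.
have H : (fun h => h^-1 *: (((h *: (1 : R) + s) * `|h *: (1 : R) + s|) - s * `|s|))
    @ 0^' --> 2 * `|s|.
  apply/cvgrPdist_le => e e0; near=> h.
  have h0 : h != 0 by near: h; exact: nbhs_dnbhs_neq.
  have he : `|h| <= e.
    near: h; apply: (@nbhs_dnbhs _ (0 : R)); apply: filterS (nbhsx_ballx (0:R) e e0) => h.
    by rewrite /ball/= sub0r normrN => /ltW.
  apply: le_trans he; rewrite !/(_ *: _) /= mulr1.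
  rewrite -(ler_pM2l (x := `|h|)) ?normr_gt0// -normrM mulrBr mulVKf//.
  rewrite -expr2 real_normK ?num_real// (addrC h s).
  have [s0|s0] := leP 0 s; [rewrite (ger0_norm s0)|rewrite (ltr0_norm s0)];
  have [t0|t0] := leP 0 (s + h); rewrite ?(ger0_norm t0) ?(ltr0_norm t0) ler_norml;
  apply/andP; split; nra.
by apply: DeriveDef; [exact: cvgP H|exact: cvg_lim H].
Unshelve. all: by end_near.
Qed.

Lemma is_derive_sqpos (s : R) : is_derive s (1 : R) sqpos (s + `|s|).
Proof.
have := is_derive_mulnorm s => H; rewrite /sqpos.
have -> : (fun s => (s ^+ 2 + s * `|s|) / 2) =
    2^-1 *: ((@GRing.exp R ^~ 2%N) + (fun t => t * `|t|)).
  by apply/funext => t; rewrite /= mulrC.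
by apply: is_derive_eq; rewrite !/(_ *: _) /=; field.
Qed.

Lemma continuous_dsqpos : continuous (fun s : R => s + `|s|).
Proof. by move=> s; apply: cvgD => //; exact: norm_continuous. Qed.

(** A function of class C^1 equal to 1 on [-L, L] and to 0 outside of
   [-L-1, L+1]. *)
Definition cutoff (L t : R) : R := sqpos (1 - sqpos (t - L) - sqpos (- t - L)).

Definition dcutoff (L t : R) : R :=
  let w := 1 - sqpos (t - L) - sqpos (- t - L) in
  (w + `|w|) * ((- t - L + `|- t - L|) - (t - L + `|t - L|)).

Lemma is_derive_cutoff L t : is_derive t (1 : R) (cutoff L) (dcutoff L t).
Proof.
pose w (t : R) := 1 - sqpos (t - L) - sqpos (- t - L).
suff dw : is_derive t (1 : R) w ((- t - L + `|- t - L|) - (t - L + `|t - L|)).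
  exact: (@is_derive1_comp _ sqpos w _ _ _ (is_derive_sqpos (w t)) dw).
have d1 : is_derive t (1 : R) (fun t => t - L) 1.
  by apply: is_derive_eq; rewrite subr0.
have d2 : is_derive t (1 : R) (fun t => - t - L) (- 1).
  by apply: is_derive_eq; rewrite subr0.
have h1 := @is_derive1_comp _ sqpos (fun t => t - L) _ _ _ (is_derive_sqpos (t - L)) d1.
have h2 := @is_derive1_comp _ sqpos (fun t => - t - L) _ _ _ (is_derive_sqpos (- t - L)) d2.
apply: (is_derive_eq (is_deriveB (is_deriveB (is_derive_cst (1 : R) t (1 : R)) h1) h2)).
ring.
Qed.

Lemma continuous_cutoff L : continuous (cutoff L).
Proof. exact: (is_derive_continuous (is_derive_cutoff L)). Qed.

Lemma continuous_dcutoff L : continuous (dcutoff L).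
Proof.
have ccomp (f g : R -> R) : continuous f -> continuous g -> continuous (fun t => g (f t)).
  by move=> cf cg t; apply: (@continuous_comp _ _ _ f g); [exact: cf|exact: cg].
have cs : continuous sqpos := is_derive_continuous is_derive_sqpos.
have c1 : continuous (fun t : R => t - L) by move=> t; apply: cvgB => //; exact: cvg_cst.
have c2 : continuous (fun t : R => - t - L).
  by move=> t; apply: cvgB; [exact: cvgN|exact: cvg_cst].
have cw : continuous (fun t : R => 1 - sqpos (t - L) - sqpos (- t - L)).
  move=> t; apply: cvgB; last exact: (ccomp _ _ c2 cs).
  by apply: cvgB; [exact: cvg_cst|exact: (ccomp _ _ c1 cs)].
move=> t; apply: cvgM; first exact: (ccomp _ _ cw continuous_dsqpos).
by apply: cvgB; [exact: (ccomp _ _ c2 continuous_dsqpos)|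
  exact: (ccomp _ _ c1 continuous_dsqpos)].
Qed.

Lemma cutoff1 L t : `|t| <= L -> cutoff L t = 1.
Proof.
rewrite ler_norml => /andP[h1 h2]; rewrite /cutoff.
have e1 : sqpos (t - L) = 0 by apply: sqpos_le0E; lra.
have e2 : sqpos (- t - L) = 0 by apply: sqpos_le0E; lra.
by rewrite sqpos_ge0E e1 e2 ?expr2; lra.
Qed.

Lemma dcutoff1 L t : `|t| <= L -> dcutoff L t = 0.
Proof.
rewrite ler_norml => /andP[h1 h2]; rewrite /dcutoff.
have t1 : t - L <= 0 by lra.
have t2 : - t - L <= 0 by lra.
by rewrite (ler0_norm t1) (ler0_norm t2) !subrr mulr0.
Qed.

Lemma cutoff_arg L t : 0 <= L -> L + 1 < `|t| -> 1 - sqpos (t - L) - sqpos (- t - L) <= 0.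
Proof.
move=> L0; have [t0|t0] := leP 0 t.
  rewrite ger0_norm// => h; rewrite sqpos_ge0E; last lra.
  rewrite sqpos_le0E; last lra. nra.
rewrite ltr0_norm// => h; rewrite sqpos_le0E; last lra.
rewrite sqpos_ge0E; last lra. nra.
Qed.

Lemma cutoff0 L t : 0 <= L -> L + 1 < `|t| -> cutoff L t = 0 /\ dcutoff L t = 0.
Proof.
move=> L0 h; have w0 := cutoff_arg L0 h; split; first exact: sqpos_le0E.
by rewrite /dcutoff (ler0_norm w0) subrr mul0r.
Qed.

End line.

Section waves.
Context {R : realType} (n : nat).
Implicit Types (x : 'rV[R]_n) (xi : 'I_n -> R) (i : 'I_n) (a : R).

Definition dotv xi x : R := \sum_i xi i * x ord0 i.

(** The phases a = 0 and a = - pi / 2 give the real and imaginary parts of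
   e^(i xi.x). *)
Definition wave xi a x : R := cos (a + dotv xi x).
Definition dwave xi a i x : R := - (xi i * sin (a + dotv xi x)).

Lemma continuous_coord i : continuous (fun x : 'rV[R]_n => x ord0 i).
Proof. exact: coord_continuous. Qed.

Lemma continuous_comp_real (f : 'rV[R]_n -> R) (g : R -> R) :
  continuous f -> continuous g -> continuous (fun x => g (f x)).
Proof.
by move=> cf cg x; apply: (@continuous_comp _ _ _ f g); [exact: cf|exact: cg].
Qed.

Lemma continuous_dotv xi : continuous (dotv xi).
Proof.
apply: continuous_big => [|i _ x]; first exact: add_continuous.
exact: (cvgM (cvg_cst (xi i)) (@continuous_coord i x)).
Qed.

Lemma continuous_phase xi a : continuous (fun x => a + dotv xi x).
Proof. by move=> x; exact: (cvgD (cvg_cst a) (@continuous_dotv xi x)). Qed.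

Lemma continuous_wave xi a : continuous (wave xi a).
Proof.
exact: (continuous_comp_real (@continuous_phase xi a) (@continuous_cos R)).
Qed.

Lemma continuous_dwave xi a i : continuous (dwave xi a i).
Proof.
have cs := continuous_comp_real (@continuous_phase xi a) (@continuous_sin R).
by move=> x; exact: (cvgN (cvgM (cvg_cst (xi i)) (cs x))).
Qed.

Lemma upd_shift x i (h t : R) :
  upd x i (h *: (1 : R) + t) = h *: (delta_mx ord0 i : 'rV[R]_n) + upd x i t.
Proof.
apply/rowP => j; rewrite !mxE eqxx /= [h *: _]mulr1.
by case: eqVneq => _; rewrite ?mulr1 ?mulr0 ?add0r.
Qed.

Lemma continuous_upd x i : continuous (upd x i : R -> 'rV[R]_n).
Proof.
have -> : upd x i = (fun t => t *: (delta_mx ord0 i : 'rV[R]_n) + upd x i 0).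
  by apply/funext => t; rewrite -upd_shift addr0 [t *: _]mulr1.
by move=> t; apply: cvgD; [apply: cvgZr_tmp|exact: cvg_cst].
Qed.

Lemma is_derive_line (psi : 'rV[R]_n -> R) x i t :
  derivable psi (upd x i t) (delta_mx ord0 i : 'rV[R]_n) ->
  is_derive t (1 : R) (psi \o upd x i) (partial i psi (upd x i t)).
Proof.
move=> dpsi.
have E : (fun h : R => h^-1 *: ((psi \o upd x i) (h *: (1 : R) + t) - (psi \o upd x i) t)) =
   (fun h => h^-1 *: (psi (h *: (delta_mx ord0 i : 'rV[R]_n) + upd x i t) - psi (upd x i t))).
  by apply/funext => h /=; rewrite upd_shift.
by apply: DeriveDef; rewrite /derivable /partial /derive E.
Qed.

Lemma dotv_upd xi x i t : dotv xi (upd x i t) = dotv xi (upd x i 0) + xi i * t.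
Proof.
rewrite /dotv (bigD1 i)//= [in RHS](bigD1 i)//= !mxE eqxx mulr0 add0r addrC.
by congr (_ + _); apply: eq_bigr => j /negbTE ji; rewrite !mxE ji.
Qed.

Variable L : R.
Hypothesis L0 : 0 <= L.

(** A plane wave has to be multiplied by a cutoff to belong to H^1(R^n); the
   product of one-dimensional cutoffs keeps its restriction to lines explicit. *)
Definition cutwave xi a x := \prod_j cutoff L (x ord0 j) * wave xi a x.
Definition dcutwave xi a i x := \prod_(j | j != i) cutoff L (x ord0 j) *
  (dcutoff L (x ord0 i) * wave xi a x + cutoff L (x ord0 i) * dwave xi a i x).

Lemma continuous_cutoff_coord i : continuous (fun x : 'rV[R]_n => cutoff L (x ord0 i)).
Proof. exact: (continuous_comp_real (@continuous_coord i) (@continuous_cutoff R L)). Qed.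

Lemma continuous_prod_cutoff (P : pred 'I_n) :
  continuous (fun x : 'rV[R]_n => \prod_(j | P j) cutoff L (x ord0 j)).
Proof.
apply: continuous_big => [|j _]; first exact: mul_continuous.
exact: continuous_cutoff_coord.
Qed.

Lemma continuous_cutwave xi a : continuous (cutwave xi a).
Proof.
move=> x; exact: (cvgM (@continuous_prod_cutoff xpredT x) (@continuous_wave xi a x)).
Qed.

Lemma continuous_dcutwave xi a i : continuous (dcutwave xi a i).
Proof.
have c1 := continuous_comp_real (@continuous_coord i) (@continuous_dcutoff R L).
move=> x; apply: (cvgM (@continuous_prod_cutoff (fun j => j != i) x)).
exact: (cvgD (cvgM (c1 x) (@continuous_wave xi a x))
  (cvgM (@continuous_cutoff_coord i x) (@continuous_dwave xi a i x))).
Qed.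

Lemma cutwave_out xi a x : ~ box (L + 1) x -> cutwave xi a x = 0 /\
  forall i, dcutwave xi a i x = 0.
Proof.
move=> Bx; have [j xj] : exists j, L + 1 < `|x ord0 j|.
  apply: contrapT => H; apply: Bx; apply/box_norm => i.
  by rewrite leNgt; apply/negP => ?; apply: H; exists i.
have [c0 d0] := cutoff0 L0 xj; split; first by rewrite /cutwave (bigD1 j)//= c0 !mul0r.
move=> i; rewrite /dcutwave; have [<-|ij] := eqVneq j i.
  by rewrite c0 d0 !mul0r addr0 mulr0.
by rewrite (bigD1 j)//= c0 !mul0r.
Qed.

Lemma cutwave_in xi a x : box L x -> cutwave xi a x = wave xi a x /\
  forall i, dcutwave xi a i x = dwave xi a i x.
Proof.
move=> /box_norm Bx; split.
  by rewrite /cutwave big1 ?mul1r// => j _; rewrite cutoff1.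
by move=> i; rewrite /dcutwave big1 ?cutoff1 ?dcutoff1 ?mul0r ?add0r ?mul1r//
  => j _; rewrite cutoff1.
Qed.

Lemma boxed_cutwave xi a : boxed (cutwave xi a).
Proof.
apply: (@boxed_continuous _ _ _ (L + 1)); first exact: continuous_cutwave.
by move=> x /(cutwave_out xi a)[].
Qed.

Lemma boxed_dcutwave xi a i : boxed (dcutwave xi a i).
Proof.
apply: (@boxed_continuous _ _ _ (L + 1)); first exact: continuous_dcutwave.
by move=> x /(cutwave_out xi a)[_]; apply.
Qed.

Lemma is_derive_cutwave xi a x i t :
  is_derive t (1 : R) (cutwave xi a \o upd x i) (dcutwave xi a i (upd x i t)).
Proof.
pose A := \prod_(j | j != i) cutoff L (x ord0 j).
pose b := a + dotv xi (upd x i 0).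
have AE s : \prod_(j | j != i) cutoff L (upd x i s ord0 j) = A.
  by apply: eq_bigr => j /negbTE ji; rewrite mxE ji.
have bE s : a + dotv xi (upd x i s) = b + xi i * s by rewrite dotv_upd addrA.
have -> : cutwave xi a \o upd x i =
    A *: (cutoff L * (cos \o (fun s => b + xi i * s))).
  apply/funext => s; rewrite /= /cutwave (bigD1 i)//= AE mxE eqxx /wave bE.
  by rewrite (mulrC (cutoff L s)) -mulrA.
have db := is_derive_affine b (xi i) t.
have dc := @is_derive1_comp _ (@cos R) (fun s => b + xi i * s) _ _ _ (is_derive_cos _) db.
apply: (is_derive_eq (is_deriveZ A (is_deriveM (is_derive_cutoff L t) dc))).
rewrite /dcutwave AE mxE eqxx /wave /dwave bE /= !/(_ *: _) /=; ring.
Qed.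

(** Integration by parts along each line, the product of the wave and the test
   function having bounded support. *)
Lemma cutwave_H1 xi a : H1_grad (cutwave xi a) (dcutwave xi a).
Proof.
have bw := boxed_cutwave xi a; have bdw := boxed_dcutwave xi a.
have mT : measurable [set: 'rV[R]_n] := measurableT.
split=> [|i|phi tphi i]; [exact: boxed_L2|exact: boxed_L2|].
have [bphi bdphi] := test_function_boxed i tphi; have [sm _] := tphi.
have w2 := boxed_L2 mT bw; have dw2 := boxed_L2 mT (bdw i).
have phi2 := boxed_L2 mT bphi; have dphi2 := boxed_L2 mT bdphi.
apply/eqP; rewrite -subr_eq0 opprK; apply/eqP.
rewrite -RintegralD//;
    [|exact: L2_mul_integrable|exact: L2_mul_integrable].
pose K x := cutwave xi a x * partial i phi x + dcutwave xi a i x * phi x.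
have cK : continuous K.
  move=> x; exact: (cvgD (cvgM (@continuous_cutwave xi a x) ((sm [:: i]).1 x))
    (cvgM (@continuous_dcutwave xi a i x) ((sm [::]).1 x))).
have K0 x : ~ box (L + 1) x -> K x = 0.
  by move=> /(cutwave_out xi a)[h1 h2]; rewrite /K h1 h2 !mul0r addr0.
rewrite /Rintegral (integral_lines0 (i := i) (boxed_continuous cK K0))// => x.
pose F := (cutwave xi a \o upd x i) * (phi \o upd x i).
apply: (@integral_derivative0 _ F (K \o upd x i) (L + 1)); first by rewrite addr_ge0.
- move=> t; apply: (is_derive_eq (is_deriveM (is_derive_cutwave xi a x i t)
    (is_derive_line ((sm [::]).2 i _)))).
  by rewrite /K !/(_ *: _) /=; ring.
- by move=> t; apply: (@continuous_comp _ _ _ (upd x i) K); [exact: continuous_upd|exact: cK].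
- move=> t tL; have Bt : ~ box (L + 1) (upd x i t).
    by move=> /box_norm/(_ i); rewrite mxE eqxx leNgt tL.
  by split; [rewrite /F mulrfctE /= (proj1 (cutwave_out xi a Bt)) mul0r|exact: K0].
Qed.

Lemma cutwave_form_domain (Omega : set 'rV[R]_n) xi a : measurable Omega ->
  neumann_form_domain Omega (cutwave xi a) (dcutwave xi a).
Proof.
move=> mO; split; first by apply: boxed_L2 => //; exact: boxed_cutwave.
by exists (cutwave xi a); split; [exact: cutwave_H1|exact: aeW].
Qed.

End waves.

(** * Bessel's inequality for plane waves *)

(** Bessel's inequality for orthogonal complex vectors C + i S, in terms of their
   real and imaginary parts. The hypotheses only give Hermitian products, that
   is sums of two real ones, so the norm of the combination p is estimated after
   adding to it that of p': together they are the real and imaginary parts of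
   one complex combination. *)
Lemma hermitian_bessel (R : realType) (V : lmodType R) (dot : V -> V -> R)
    (I : finType) (C S : I -> V) (vol : R) (u : V) :
  semi_inner dot -> 0 < vol ->
  (forall i j, dot (C i) (C j) + dot (S i) (S j) = vol *+ (i == j)) ->
  (forall i j, dot (C i) (S j) = dot (S i) (C j)) ->
  \sum_i (dot u (C i) ^+ 2 + dot u (S i) ^+ 2) <= vol * dot u u.
Proof.
move=> dotP vol0 h1 h2.
pose a i := dot u (C i); pose b i := dot u (S i).
pose X i := a i *: C i + b i *: S i; pose X' i := a i *: S i - b i *: C i.
pose p := \sum_i X i; pose p' := \sum_i X' i; pose s := \sum_i (a i ^+ 2 + b i ^+ 2).
have XX i j : dot (X i) (X j) + dot (X' i) (X' j) =
    (a i * a j + b i * b j) * (vol *+ (i == j)).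
  by rewrite -h1 /X /X' !(siE dotP) !h2; ring.
have pp : dot p p + dot p' p' = vol * s.
  rewrite !(si_suml dotP) -big_split mulr_sumr; apply: eq_bigr => i _ /=.
  rewrite !(si_sumr dotP) -big_split (bigD1 i)//= XX eqxx mulr1n big1 => [|j ji].
    by rewrite addr0 -!expr2 mulrC.
  by rewrite XX eq_sym (negbTE ji) mulr0n mulr0.
have up : dot u p = s.
  by rewrite (si_sumr dotP); apply: eq_bigr => i _; rewrite !(siE dotP) -!expr2.
have p'0 := si_ge0 dotP p'.
have := si_ge0 dotP (vol *: u - p); rewrite !(siE dotP) (siC dotP p u) up => ge0.
rewrite -/s -(ler_pM2l vol0); nra.
Qed.

Section bessel.
Context {R : realType} (n : nat) (L : R).
Hypothesis L0 : 0 < L.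
Implicit Types (xi eta : 'I_n -> R).
Local Notation B := (@box R n L).

Let mB : measurable B. Proof. exact: measurable_box. Qed.

Lemma continuous_boxed_restrict (f : 'rV[R]_n -> R) : continuous f -> boxed (f \_ B).
Proof.
move=> cf; split.
  by apply/(measurable_restrictT _ mB); apply: measurable_funTS;
    exact: continuous_measurable_rV.
have [M HM] := continuous_bounded_box L cf.
exists (Num.max M 0), L; split=> x; rewrite patchE; case: ifPn.
- by rewrite inE => Bx; rewrite le_max HM.
- by move=> _; rewrite normr0 le_max lexx orbT.
- by rewrite inE.
- by [].
Qed.

(** A frequency along the i-th axis that is a nonzero multiple of pi / L makes the
   wave integrate to 0 along that axis. *)
Lemma integral_box_wave0 xi a i : xi i != 0 -> sin (xi i * L) = 0 ->
  \int[lebesgue_rV n]_(x in B) wave xi a x = 0.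
Proof.
move=> xi0 sL; have bw := continuous_boxed_restrict (@continuous_wave R n xi a).
rewrite Rintegral_mkcond /Rintegral (integral_lines0 (i := i) bw)// => x.
pose b := a + dotv xi (upd x i 0); pose f t := cos (b + xi i * t).
have fE t : wave xi a (upd x i t) = f t by rewrite /wave dotv_upd addrA.
have [Bx|Bx] := pselect (B (upd x i 0)); last first.
  apply: integral0_eq => t _; rewrite patchE; case: ifPn => //; rewrite inE => Bt.
  exfalso; apply: Bx => j; have := Bt j; rewrite !mxE; case: eqVneq => // _ _.
  by rewrite /= in_itv/= oppr_le0 ltW.
have aL : - L < L by rewrite (lt_trans _ L0)// oppr_lt0.
transitivity (\int[lebesgue_measure]_(t in [set` Interval (BLeft (- L)%R) (BRight L)]) (f t)%:E)%E.
  rewrite [RHS]integral_mkcond; apply: eq_integral => t _; rewrite !patchE fE.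
  suff -> : (upd x i t \in B) = (t \in `[- L, L]%classic) by case: ifP.
  apply/idP/idP; rewrite !inE => Bt; first by have := Bt i; rewrite mxE eqxx.
  by move=> j; have := Bx j; rewrite !mxE; case: eqVneq.
have db := is_derive_affine b (xi i).
have df t : is_derive t (1 : R) ((xi i)^-1 *: (sin \o (fun s => b + xi i * s))) (f t).
  have ds := @is_derive1_comp _ (@sin R) (fun s => b + xi i * s) _ _ _ (is_derive_sin _) (db t).
  apply: (is_derive_eq (is_deriveZ (xi i)^-1 ds)).
  by rewrite /(_ *: _) /= mulrCA mulVf// mulr1.
have cf : continuous f.
  have cb := is_derive_continuous db.
  move=> t; apply: (@continuous_comp _ _ _ (fun s => b + xi i * s) cos); first exact: cb.
  exact: continuous_cos.
rewrite (FTC_is_derive aL df cf) /= !fctE !/(_ *: _) /= mulrN sinB sinD sL !mulr0.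
by rewrite subr0 addr0 subrr.
Qed.

Lemma L2_box_continuous (f : 'rV[R]_n -> R) : continuous f -> L2 B f.
Proof.
move=> cf; have [mf fi] := boxed_L2 mB (continuous_boxed_restrict cf).
split; first by apply: measurable_funTS; exact: continuous_measurable_rV.
move: fi; congr (_ < _)%E; apply: eq_integral => x xB; by rewrite patchE xB.
Qed.

Lemma L2_extend0 (Omega : set 'rV[R]_n) u v : measurable Omega -> Omega `<=` B ->
  L2 Omega u -> L2 B v -> L2 B (u \_ Omega) /\ L2_dot B (u \_ Omega) v = L2_dot Omega u v.
Proof.
move=> mO OB [mu ui] v2; split.
  split; first by apply/(measurable_restrict _ mO mB); rewrite setIidr.
  apply: le_lt_trans ui; rewrite [leRHS]integral_mkcond [leLHS]integral_mkcond.
  rewrite le_eqVlt; apply/orP; left; apply/eqP; apply: eq_integral => x _.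
  rewrite !patchE; have [xO|xO] := boolP (x \in Omega).
    by rewrite mem_set//; apply: OB; rewrite inE in xO.
  by case: ifP => // _; rewrite expr0n.
rewrite /L2_dot Rintegral_mkcond [RHS]Rintegral_mkcond; apply: eq_Rintegral => x _.
rewrite !patchE; have [xO|xO] := boolP (x \in Omega).
  by rewrite mem_set//; apply: OB; rewrite inE in xO.
by case: ifP => // _; rewrite mul0r.
Qed.

Lemma wave_sinE xi x : wave xi (- (pi / 2)) x = sin (dotv xi x).
Proof. by rewrite /wave addrC cosBpihalf. Qed.

(** The waves are orthogonal on the box, where u is extended by 0. *)
Lemma wave_bessel (Omega : set 'rV[R]_n) (I : finType) (xi : I -> 'I_n -> R) u :
  measurable Omega -> Omega `<=` B -> L2 Omega u ->
  (forall i j, i != j -> exists k, xi i k != xi j k /\ sin ((xi i k - xi j k) * L) = 0) ->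
  \sum_i (L2_dot Omega u (wave (xi i) 0) ^+ 2 +
          L2_dot Omega u (wave (xi i) (- (pi / 2))) ^+ 2) <=
  (2 * L) ^+ n * L2_dot Omega u u.
Proof.
move=> mO OB u2 sep.
have w2 i a : L2 B (wave (xi i) a) by apply: L2_box_continuous; exact: continuous_wave.
have [u2' _] := L2_extend0 mO OB u2 (L2_0 B).
have uE v : L2 B v -> L2_dot Omega u v = L2_dot B (u \_ Omega) v.
  by move=> v2; have [_ ->] := L2_extend0 mO OB u2 v2.
have uuE : L2_dot Omega u u = L2_dot B (u \_ Omega) (u \_ Omega).
  have [_ ->] := L2_extend0 mO OB u2 u2'.
  by apply: eq_Rintegral => x xO; rewrite patchE xO.
have vol0 : 0 < (2 * L) ^+ n by rewrite exprn_gt0// mulr_gt0.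
rewrite uuE; under eq_bigr do rewrite !uE//.
have := @hermitian_bessel R (L2_type mB) (@L2d R n B mB) I
  (fun i => mk_L2 mB (w2 i 0)) (fun i => mk_L2 mB (w2 i (- (pi / 2))))
  ((2 * L) ^+ n) (mk_L2 mB u2').
apply=> //; first exact: semi_inner_L2d.
- move=> i j; rewrite /L2d /= /L2_dot -RintegralD//;
    [|exact: L2_mul_integrable|exact: L2_mul_integrable].
  pose dl k := xi i k - xi j k.
  have dlE x : dotv dl x = dotv (xi i) x - dotv (xi j) x.
    by rewrite /dotv -sumrB; apply: eq_bigr => k _; rewrite mulrBl.
  have -> : \int[lebesgue_rV n]_(x in B) (wave (xi i) 0 x * wave (xi j) 0 x +
      wave (xi i) (- (pi / 2)) x * wave (xi j) (- (pi / 2)) x) =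
      \int[lebesgue_rV n]_(x in B) wave dl 0 x.
    apply: eq_Rintegral => x _; rewrite !wave_sinE /wave !add0r dlE cosB.
    by rewrite mulrC addrC mulrC addrC.
  have [ij|ij] := eqVneq i j; last first.
    have [k [k1 k2]] := sep _ _ ij.
    by rewrite (@integral_box_wave0 dl 0 k)// subr_eq0.
  have -> : \int[lebesgue_rV n]_(x in B) wave dl 0 x = \int[lebesgue_rV n]_(x in B) 1.
    by apply: eq_Rintegral => x _; rewrite /wave dlE ij subrr addr0 cos0.
  by rewrite Rintegral_cst// mul1r [X in fine X](lebesgue_rV_box n (ltW L0)).
- move=> i j; rewrite /L2d /= /L2_dot; apply/eqP; rewrite -subr_eq0; apply/eqP.
  rewrite -RintegralB//; [|exact: L2_mul_integrable|exact: L2_mul_integrable].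
  pose dl k := xi j k - xi i k.
  have dlE x : dotv dl x = dotv (xi j) x - dotv (xi i) x.
    by rewrite /dotv -sumrB; apply: eq_bigr => k _; rewrite mulrBl.
  have -> : \int[lebesgue_rV n]_(x in B) (wave (xi i) 0 x * wave (xi j) (- (pi / 2)) x -
      wave (xi i) (- (pi / 2)) x * wave (xi j) 0 x) =
      \int[lebesgue_rV n]_(x in B) wave dl (- (pi / 2)) x.
    apply: eq_Rintegral => x _; rewrite !wave_sinE /wave !add0r dlE sinB; ring.
  have [ij|ij] := eqVneq j i.
    rewrite (_ : \int[_]_(x in _) _ = \int[lebesgue_rV n]_(x in B) 0).
      by rewrite Rintegral_cst// mul0r.
    by apply: eq_Rintegral => x _; rewrite wave_sinE dlE ij subrr sin0.
  have [k [k1 k2]] := sep _ _ ij.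
  by rewrite (@integral_box_wave0 dl _ k)// subr_eq0.
Qed.

End bessel.

(** * Kroeger's inequality *)

Section kroger.
Context {R : realType} (n : nat) (Omega : set 'rV[R]_n) (L : R).
Hypotheses (mO : measurable Omega) (L0 : 0 < L) (OL : Omega `<=` box L).
Implicit Types (xi : 'I_n -> R).

Let L0' : 0 <= L. Proof. exact: ltW. Qed.

Lemma dot_cos_sin (c : R) (f g : 'rV[R]_n -> R) :
  L2 Omega f -> L2 Omega g -> (forall x, Omega x -> f x ^+ 2 + g x ^+ 2 = c) ->
  L2_dot Omega f f + L2_dot Omega g g = c * volume Omega.
Proof.
move=> f2 g2 fg; rewrite /L2_dot -RintegralD//;
    [|exact: L2_mul_integrable|exact: L2_mul_integrable].
rewrite (eq_Rintegral _ (g := fun=> c)) ?Rintegral_cst// => x.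
by rewrite inE -!expr2 => /fg.
Qed.

Lemma volume_ge0 : 0 <= volume Omega. Proof. exact: fine_ge0. Qed.

Definition wave_form xi a : form_type mO :=
  mk_form mO (cutwave_form_domain L0' xi a mO).

Lemma wave_norm xi :
  L2d (form_val (wave_form xi 0)) (form_val (wave_form xi 0)) +
  L2d (form_val (wave_form xi (- (pi / 2)))) (form_val (wave_form xi (- (pi / 2)))) =
  volume Omega.
Proof.
rewrite /L2d /= (@dot_cos_sin 1) ?mul1r//; try exact/boxed_L2/boxed_cutwave.
move=> x /OL Bx; rewrite !(proj1 (cutwave_in _ _ Bx)) wave_sinE /wave add0r.
exact: cos2Dsin2.
Qed.

Lemma wave_energy xi :
  formq (wave_form xi 0) (wave_form xi 0) +
  formq (wave_form xi (- (pi / 2))) (wave_form xi (- (pi / 2))) =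
  (\sum_i xi i ^+ 2) * volume Omega.
Proof.
rewrite /formq /neumann_form -big_split mulr_suml; apply: eq_bigr => i _ /=.
apply: dot_cos_sin; try exact/boxed_L2/boxed_dcutwave.
move=> x /OL Bx; rewrite !(proj2 (cutwave_in _ _ Bx)) /dwave add0r.
rewrite (addrC (- (pi / 2))) sinBpihalf !sqrrN !exprMn sqrrN -mulrDr addrC.
by rewrite cos2Dsin2 mulr1.
Qed.

Lemma wave_dot xi a (u : L2_type mO) :
  L2d (form_val (wave_form xi a)) u = L2_dot Omega (val u) (wave xi a).
Proof.
rewrite (siC (semi_inner_L2d mO)); apply: eq_Rintegral => x; rewrite inE => /OL Bx /=.
by rewrite (proj1 (cutwave_in _ _ Bx)).
Qed.

(** The variational inequality for the real and imaginary parts of a plane wave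
   bounds (mu (k + 1) - |xi|^2) |Omega| by a nonnegative sum, so the positive part
   comes for free; Bessel's inequality bounds the sum over the frequencies, whose
   plane waves are orthogonal on the box. *)
Lemma kroeger_frequencies (mu : nat -> R) (k : nat) (I : finType)
    (xi : I -> 'I_n -> R) :
  neumann_eigenvalues Omega mu -> 0 <= mu 1%N ->
  (forall i j, i != j -> exists k, xi i k != xi j k /\ sin ((xi i k - xi j k) * L) = 0) ->
  volume Omega * \sum_i Num.max (mu k.+1 - \sum_l xi i l ^+ 2) 0 <=
  (2 * L) ^+ n * \sum_(j < k) (mu k.+1 - mu j.+1).
Proof.
move=> [mu_le mu_oo spec mult] mu1 sep.
have dotP := semi_inner_L2d mO; have qP := semi_inner_formq mO.
have res lam : (forall j, (1 <= j)%N -> mu j <> lam) ->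
    form_resolvent (@L2d R n Omega mO) (@formq _ _ _ mO) (@form_val _ _ _ mO) lam.
  move=> H; apply: form_resolventE; apply: contrapT => nres.
  have : neumann_spectrum Omega lam by [].
  by rewrite spec => -[j /= j1]; exact: H.
have mult' lam : exists2 m, ([set j | (1 <= j)%N /\ mu j = lam] #= `I_m)%card &
    form_mult (@L2d R n Omega mO) (@formq _ _ _ mO) (@form_val _ _ _ mO) lam m.
  by have [m Im /(form_multE mO)] := mult lam; exists m.
have [e es] := exists_eigen_system dotP qP mult' k.
have var w := variational_inequality dotP qP (L2d_complete (mD:=mO))
  (form_val_null (mD:=mO)) mu_le mu_oo mu1 res mult' w es.
have [_ eO] := es.
pose cs i (j : 'I_k) := L2_dot Omega (val (e j)) (wave (xi i) 0) ^+ 2 +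
  L2_dot Omega (val (e j)) (wave (xi i) (- (pi / 2))) ^+ 2.
have dmu (j : 'I_k) : 0 <= mu k.+1 - mu j.+1.
  by rewrite subr_ge0 mu_le//= ltnS ltnW// ltn_ord.
have one i : volume Omega * Num.max (mu k.+1 - \sum_l xi i l ^+ 2) 0 <=
    \sum_(j < k) (mu k.+1 - mu j.+1) * cs i j.
  rewrite maxr_pMr ?volume_ge0// mulr0 ge_max; apply/andP; split; last first.
    by apply: sumr_ge0 => j _; rewrite mulr_ge0// addr_ge0// sqr_ge0.
  have := lerD (var (wave_form (xi i) 0)) (var (wave_form (xi i) (- (pi / 2)))).
  rewrite -mulrDr wave_norm addrACA wave_energy -big_split /=.
  have -> : \sum_(j < k) ((mu k.+1 - mu j.+1) * L2d (form_val (wave_form (xi i) 0)) (e j) ^+ 2 +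
    (mu k.+1 - mu j.+1) * L2d (form_val (wave_form (xi i) (- (pi / 2)))) (e j) ^+ 2) =
    \sum_(j < k) (mu k.+1 - mu j.+1) * cs i j.
    by apply: eq_bigr => j _; rewrite !wave_dot -mulrDr.
  rewrite mulrBr; lra.
rewrite mulr_sumr; apply: (le_trans (ler_sum _ (fun i _ => one i))).
rewrite exchange_big mulr_sumr /=; apply: ler_sum => j _.
rewrite -mulr_sumr mulrC ler_wpM2r//.
have := wave_bessel L0 mO OL (L2_typeP (e j)) sep.
by rewrite -/(L2d (e j) (e j)) eO// eqxx mulr1.
Qed.

End kroger.

(** * The Gamma function and Gaussian sums *)

Section gamma.
Context {R : realType}.
Implicit Types (p t a : R).
Local Notation leb := (@lebesgue_measure R).

Lemma cvgy_expR_half : expR (- (t / 2)) @[t --> +oo] --> (0 : R).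
Proof.
have := @cvg_comp _ _ _ (fun t : R => t / 2) (fun t => expR (- t)) _ _ _ _ (@cvgr_expR R).
apply; apply: gt0_cvgMly => //; exact: cvg_id.
Qed.

Lemma powR_le_natpow p (m : nat) t : 0 <= p -> p <= m%:R -> 0 <= t ->
  t `^ p <= 1 + t ^+ m.
Proof.
move=> p0 pm t0; have [t1|t1] := leP t 1.
  apply: (@le_trans _ _ 1); last by rewrite lerDl exprn_ge0.
  by have := ge0_ler_powR p0 _ _ t1; rewrite !nnegrE powR1; exact.
apply: (@le_trans _ _ (t ^+ m)); last by rewrite lerDr.
by rewrite -powR_mulrn//; apply: ler_powR => //; exact: ltW.
Qed.

Lemma natpow_le_expR (m : nat) t : 0 <= t ->
  t ^+ m.+1 <= 2 ^+ m.+1 * (m.+1)`!%:R * expR (t / 2).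
Proof.
move=> t0; have := @expR_ge1Dxn R (t / 2) m (divr_ge0 t0 (ltW (@ltr0Sn R 1))).
rewrite expr_div_n => h.
rewrite -mulrA -ler_pdivrMl ?exprn_gt0// -ler_pdivrMl ?ltr0n ?fact_gt0//.
apply: le_trans h; rewrite mulrC [_^-1 * _]mulrC; lra.
Qed.

(** The factor e^(-t/2) absorbs any power of t. *)
Lemma powR_expR_bound p : 0 <= p -> exists2 C : R, 0 < C &
  forall t, 0 <= t -> t `^ p * expR (- t) <= C * expR (- (t / 2)).
Proof.
move=> p0; pose m := Num.truncn p.
have pm : p <= m.+1%:R by rewrite ltW// truncnS_gt.
exists (1 + 2 ^+ m.+1 * (m.+1)`!%:R); first by rewrite addr_gt0// mulr_gt0// ltr0n fact_gt0.
move=> t t0; have e1 : 1 <= expR (t / 2) by rewrite -expR0 ler_expR divr_ge0.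
have h : t `^ p <= (1 + 2 ^+ m.+1 * (m.+1)`!%:R) * expR (t / 2).
  rewrite (le_trans (powR_le_natpow p0 pm t0))// mulrDl mul1r lerD//.
  exact: natpow_le_expR.
have -> : expR (- (t / 2)) = expR (t / 2) * expR (- t).
  by rewrite -expRD; congr expR; lra.
by rewrite mulrA ler_wpM2r// expR_ge0.
Qed.

Lemma cvgy_powR_expR p : 0 <= p -> t `^ p * expR (- t) @[t --> +oo] --> (0 : R).
Proof.
move=> p0; have [C C0 HC] := powR_expR_bound p0.
apply: (@squeeze_cvgr _ _ _ _ (fun=> 0) (fun t => C * expR (- (t / 2)))).
- near=> t; have t0 : 0 <= t by near: t; exact: nbhs_pinfty_ge.
  by rewrite mulr_ge0 ?powR_ge0 ?expR_ge0//= HC.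
- exact: cvg_cst.
- rewrite -[X in _ --> X](mulr0 C); apply: cvgM; first exact: cvg_cst.
  exact: cvgy_expR_half.
Unshelve. all: by end_near. Qed.

Lemma powR_right0 p : 0 < p -> t `^ p @[t --> 0^'+] --> (0 : R) `^ p.
Proof. by move=> p0; rewrite powR0 ?gt_eqF//; exact: powR_cvg0. Qed.

Lemma continuous_expRN : continuous (fun t : R => expR (- t)).
Proof.
move=> t; apply: (@continuous_comp _ _ _ (fun t : R => - t) expR).
  exact: opp_continuous.
exact: continuous_expR.
Qed.

Lemma is_derive_expRN t : is_derive t (1 : R) (fun t => expR (- t)) (- expR (- t)).
Proof.
have d := @is_derive1_comp _ (@expR R) (-%R) t _ _ (is_derive_expR (- t)) (is_deriveNid t 1).
by apply: (is_derive_eq d); rewrite mulrN1.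
Qed.

Lemma powR_expR_within p : 0 < p ->
  {within `[0, +oo[, continuous (fun t => t `^ p * expR (- t))}.
Proof.
move=> p0; apply/continuous_within_itvcyP; split.
  move=> t; rewrite in_itv/= andbT => t0; have [dp _] := is_derive1_powR p t0.
  have cp : {for t, continuous (fun s : R => s `^ p)}.
    by apply: differentiable_continuous; apply/derivable1_diffP.
  exact: (cvgM cp (@continuous_expRN t)).
have c0 : (fun t : R => expR (- t)) @ 0^'+ --> expR (- (0 : R)).
  by apply: cvg_at_right_filter; exact: continuous_expRN.
exact: (cvgM (powR_right0 p0) c0).
Qed.

Lemma measurable_powR_expR p : measurable_fun setT (fun t : R => t `^ p * expR (- t)).
Proof.
apply: measurable_funM; first exact: measurable_powR.
exact: (continuous_measurable_fun continuous_expRN).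
Qed.

(** The value of Gamma at p + 1, as an extended real number. *)
Definition gamma_int p : \bar R := (\int[leb]_(t in `[0%R, +oo[) (t `^ p * expR (- t))%:E)%E.

Lemma GammaE p : Gamma (p + 1) = fine (gamma_int p).
Proof.
rewrite /Gamma /Rintegral /gamma_int addrK integral_itv_obnd_cbnd//.
by apply/measurable_EFinP/measurable_funTS; exact: measurable_powR_expR.
Qed.

Lemma is_derive_expR_half t :
  is_derive t (1 : R) (fun t => expR (- (t / 2))) (- (expR (- (t / 2)) / 2)).
Proof.
have -> : (fun t : R => expR (- (t / 2))) = expR \o (fun t => 0 + - 2^-1 * t).
  by apply/funext => u /=; rewrite add0r mulNr mulrC.
have d := @is_derive1_comp _ (@expR R) _ _ _ _ (is_derive_expR _)
  (is_derive_affine 0 (- 2^-1) t).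
apply: (is_derive_eq d); rewrite add0r mulNr mulrN; congr (- _).
by rewrite mulrC [2^-1 * t]mulrC [LHS]mulrC.
Qed.

Lemma measurable_expR_half (D : set R) : measurable_fun D (fun t : R => expR (- (t / 2))).
Proof.
apply: measurable_funTS; apply: continuous_measurable_fun.
exact: (is_derive_continuous is_derive_expR_half).
Qed.

Lemma integral_expR_half : (\int[leb]_(t in `[0%R, +oo[) (expR (- (t / 2)))%:E = 2%:E)%E.
Proof.
have dF t : is_derive t (1 : R) (fun t => - 2 * expR (- (t / 2))) (expR (- (t / 2))).
  apply: (is_derive_eq (is_deriveZ (- 2) (is_derive_expR_half t))).
  by rewrite /(_ *: _) /=; lra.
have cF := is_derive_continuous dF.
have cf := is_derive_continuous is_derive_expR_half.
rewrite (@ge0_continuous_FTC2y _ _ (fun t => - 2 * expR (- (t / 2))) 0 0).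
- by rewrite mul0r oppr0 expR0 mulr1 -EFinB; congr _%:E; lra.
- by move=> t _; exact: expR_ge0.
- exact: continuous_subspaceT.
- rewrite -[X in _ --> X](mulr0 (- 2)); apply: cvgM; first exact: cvg_cst.
  exact: cvgy_expR_half.
- by move=> t _; case: (dF t).
- by apply: cvg_at_right_filter; exact: cF.
- by move=> t _; rewrite derive1E; exact: derive_val.
Qed.

Lemma gamma_int_fin p : 0 <= p -> gamma_int p \is a fin_num.
Proof.
move=> p0; have [C C0 HC] := powR_expR_bound p0.
rewrite ge0_fin_numE; last first.
  by apply: integral_ge0 => t _; rewrite lee_fin mulr_ge0 ?powR_ge0 ?expR_ge0.
apply: (@le_lt_trans _ _ (\int[leb]_(t in `[0%R, +oo[) (C%:E * (expR (- (t / 2)))%:E))%E).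
  apply: ge0_le_integral => //.
  - by move=> t _; rewrite lee_fin mulr_ge0 ?powR_ge0 ?expR_ge0.
  - by apply/measurable_EFinP/measurable_funTS; exact: measurable_powR_expR.
  - apply/measurable_EFinP; apply: measurable_funM => //.
    exact: measurable_expR_half.
  - by move=> t; rewrite /= in_itv/= andbT => t0; rewrite -EFinM lee_fin HC.
rewrite ge0_integralZl//.
- by rewrite integral_expR_half -EFinM ltry.
- by apply/measurable_EFinP; exact: measurable_expR_half.
- by rewrite lee_fin ltW.
Qed.

(** The functional equation of Gamma. The derivative of t^p e^-t changes sign,
   whereas the fundamental theorem of calculus on a half-line asks for a
   nonnegative function: a multiple of e^(-t/2) is added for this purpose. *)
Lemma gamma_int_rec p : 1 < p -> gamma_int p = (p%:E * gamma_int (p - 1))%E.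
Proof.
move=> p1; have p0 : 0 < p by rewrite (lt_trans _ p1).
have q0 : 0 < p - 1 by rewrite subr_gt0.
have [C C0 HC] := powR_expR_bound (ltW p0).
pose D := `[0%R, +oo[%classic : set R.
pose f1 t := p * (t `^ (p - 1) * expR (- t)); pose f2 t := t `^ p * expR (- t).
pose f3 t := C * expR (- (t / 2)); pose g t := f1 t - f2 t + f3 t.
have mD : measurable D := measurable_itv _.
have mexp := @measurable_expR_half D.
have m1 : measurable_fun D f1.
  by apply: measurable_funM => //; apply: measurable_funTS; exact: measurable_powR_expR.
have m2 : measurable_fun D f2 by apply: measurable_funTS; exact: measurable_powR_expR.
have m3 : measurable_fun D f3 by apply: measurable_funM.
have mg : measurable_fun D g by apply: measurable_funD => //; apply: measurable_funB.
have f10 t : 0 <= f1 t by rewrite mulr_ge0 ?mulr_ge0 ?powR_ge0 ?expR_ge0// ltW.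
have f20 t : 0 <= f2 t by rewrite mulr_ge0 ?powR_ge0 ?expR_ge0.
have f30 t : 0 <= f3 t by rewrite mulr_ge0 ?expR_ge0// ltW.
have g0 t : 0 <= t -> 0 <= g t.
  by move=> /HC; rewrite -/(f2 t) -/(f3 t) /g; have := f10 t; lra.
have gsum t : g t + f2 t = f1 t + f3 t by rewrite /g; ring.
have I3 : (\int[leb]_(t in D) (f3 t)%:E = (2 * C)%:E)%E.
  under eq_integral do rewrite EFinM.
  rewrite ge0_integralZl//.
  - by rewrite integral_expR_half -EFinM mulrC.
  - exact/measurable_EFinP.
  - by rewrite lee_fin ltW.
have I1 : (\int[leb]_(t in D) (f1 t)%:E = p%:E * gamma_int (p - 1))%E.
  under eq_integral do rewrite EFinM.
  rewrite ge0_integralZl//.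
  - by apply/measurable_EFinP/measurable_funTS; exact: measurable_powR_expR.
  - by move=> t _; rewrite lee_fin mulr_ge0 ?powR_ge0 ?expR_ge0.
  - by rewrite lee_fin ltW.
have Ig : (\int[leb]_(t in D) (g t)%:E = (2 * C)%:E)%E.
  pose G t := t `^ p * expR (- t) - 2 * C * expR (- (t / 2)).
  have cexp := is_derive_continuous is_derive_expR_half.
  have dG t : 0 < t -> is_derive t (1 : R) G (g t).
    move=> t0.
    have d1 := is_deriveM (is_derive1_powR p t0) (is_derive_expRN t).
    have d2 := is_derive_expR_half t.
    apply: (is_derive_eq (is_deriveB d1 (is_deriveZ (2 * C) d2))).
    by rewrite /g /f1 /f2 /f3 !/(_ *: _) /=; field.
  have c2 := powR_expR_within p0.
  have c1 := powR_expR_within q0.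
  have cc a : {within `[0, +oo[, continuous (fun t : R => a * expR (- (t / 2)))}.
    by apply: continuous_subspaceT => t; apply: (cvgM (cvg_cst a) (@cexp t)).
  have cg : {within `[0, +oo[, continuous g}.
    move=> t; apply: (cvgD (cvgB (cvgM (cvg_cst p) (c1 t)) (c2 t)) (cc C t)).
  rewrite (@ge0_continuous_FTC2y _ g G 0 0)//.
  - rewrite /G powR0 ?gt_eqF// !mul0r oppr0 expR0 mulr1 sub0r -EFinB.
    by congr _%:E; ring.
  - rewrite -[X in _ --> X](subr0 0); apply: cvgB; first exact: (cvgy_powR_expR (ltW p0)).
    rewrite -[X in _ --> X](mulr0 (2 * C)); apply: cvgM; first exact: cvg_cst.
    exact: cvgy_expR_half.
  - by move=> t /dG[].
  - have [_ h2] := proj1 (continuous_within_itvcyP _ _) c2.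
    have [_ h3] := proj1 (continuous_within_itvcyP _ _) (cc (2 * C)).
    exact: (cvgB h2 h3).
  - move=> t; rewrite in_itv/= andbT => t0; rewrite derive1E.
    by have [_] := dG _ t0.
have : (\int[leb]_(t in D) (g t)%:E + \int[leb]_(t in D) (f2 t)%:E =
        \int[leb]_(t in D) (f1 t)%:E + \int[leb]_(t in D) (f3 t)%:E)%E.
  rewrite -!ge0_integralD//; try exact/measurable_EFinP; try by move=> t _; rewrite lee_fin.
    by apply: eq_integral => t _; rewrite -!EFinD gsum.
  by move=> t; rewrite /D /= in_itv/= andbT lee_fin; exact: g0.
rewrite Ig I1 I3 addeC -/(gamma_int p).
rewrite -(fineK (gamma_int_fin (ltW p0))) -(fineK (gamma_int_fin (ltW q0))).
by rewrite -EFinM -!EFinD => -[] /addIr ->.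
Qed.

End gamma.

Section gauss_sum.
Context {R : realType}.
Local Notation leb := (@lebesgue_measure R).

Let G (y : R) := \int[leb]_(t in `[0, y]) gauss_fun t.

Lemma cvg_gauss_nat : G n%:R @[n --> \oo] --> Num.sqrt pi / 2.
Proof.
have := @ge0_cvgn_integral R leb _ gauss_fun_ge0 measurable_gauss_fun.
rewrite integral0y_gauss => /fine_cvg; exact.
Qed.

(** The Gaussian decreases, so left Riemann sums exceed the integral. *)
Lemma gauss_riemann (N M : nat) : (0 < N)%N ->
  G (M%:R / N%:R) <= N%:R^-1 * \sum_(m < M) gauss_fun (m%:R / N%:R).
Proof.
move=> N0; have N0' : 0 < N%:R :> R by rewrite ltr0n.
elim: M => [|M IH]; first by rewrite big_ord0 mulr0 mul0r /G set_itv1 Rintegral_set1.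
have le01 : 0 <= M%:R / N%:R :> R by rewrite divr_ge0.
have le12 : M%:R / N%:R <= M.+1%:R / N%:R :> R by rewrite ler_pM2r ?invr_gt0// ler_nat.
have int1 : leb.-integrable `[0, M.+1%:R / N%:R] (EFin \o gauss_fun).
  exact: integrableS integrableT_gauss.
have := Rintegral_itvB int1; move=> /(_ (M%:R / N%:R)).
rewrite !bnd_simp => /(_ le01 le12) /eqP; rewrite subr_eq -/(G _) -/(G _) => /eqP ->.
rewrite big_ord_recr mulrDr addrC lerD//.
apply: (@le_trans _ _ (\int[leb]_(t in `]M%:R / N%:R, M.+1%:R / N%:R]) gauss_fun (M%:R / N%:R))).
  apply: le_Rintegral => //.
  - exact: integrableS integrableT_gauss.
  - apply: measurable_bounded_integrable => //.
      by rewrite /= lebesgue_measure_itv/=; case: ifP => // _; rewrite -EFinB ltry.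
    exact: bounded_cst.
  move=> t; rewrite /= in_itv/= => /andP[t1 _].
  rewrite ler_expR lerN2 lerXn2r ?nnegrE// ?(ltW t1)//.
  by rewrite (le_trans le01)// ltW.
rewrite Rintegral_cst//= lebesgue_measure_itv/= lte_fin ltr_pM2r ?invr_gt0// ltr_nat ltnSn.
rewrite -EFinB /= -mulrBl -natrB// subSnn mul1r mulrC//.
Qed.

(** The right Riemann sum lacks only the first term of the left one. *)
Lemma gauss_sum_lower (N : nat) : (0 < N)%N ->
  2 * G N%:R - 2 / N%:R <=
  2 / N%:R * \sum_(m < N ^ 2) gauss_fun (m.+1%:R / N%:R).
Proof.
move=> N0; have N0' : 0 < N%:R :> R by rewrite ltr0n.
have := gauss_riemann (N ^ 2) N0.
rewrite expnS expn1 natrM mulfK ?gt_eqF// => h.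
have h2 : \sum_(m < N * N) gauss_fun (m%:R / N%:R) <=
    1 + \sum_(m < N * N) gauss_fun (m.+1%:R / N%:R) :> R.
  case: (N * N)%N => [|k]; first by rewrite !big_ord0 addr0.
  rewrite big_ord_recl [in leRHS]big_ord_recr /= lerD ?gauss_fun_le1//.
  by rewrite lerDl gauss_fun_ge0.
have := ler_wpM2l (ltW (divr_gt0 (@ltr0Sn R 0) N0')) h2.
rewrite div1r mulrDr mulr1; lra.
Qed.

End gauss_sum.

(** * From lattice sums to the Gamma function *)

Section lattice.
Context {R : realType}.
Implicit Types (t a s x : R).
Local Notation leb := (@lebesgue_measure R).

(** - (t - a + 1) e^-t is a primitive of (t - a) e^-t. *)
Lemma laplace_pospart a : 0 <= a ->
  (\int[leb]_(t in `[0%R, +oo[) (expR (- t) * Num.max (t - a) 0)%:E = (expR (- a))%:E)%E.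
Proof.
move=> a0.
transitivity (\int[leb]_(t in `[a, +oo[) ((t - a) * expR (- t))%:E)%E.
  rewrite integral_mkcond [RHS]integral_mkcond; apply: eq_integral => t _.
  rewrite !patchE; case: ifPn; case: ifPn => //; rewrite !(inE, notin_setE)/= !in_itv/= !andbT.
  - by move=> ta t0; rewrite mulrC max_l// subr_ge0.
  - by move=> /negP; rewrite -ltNge => ta t0; rewrite max_r ?mulr0// subr_le0 ltW.
  - by move=> ta t0; exfalso; apply: t0; exact: le_trans ta.
pose F t := - ((t - a + 1) * expR (- t)).
have dt t : is_derive t (1 : R) (fun t => t - a + 1) 1.
  have -> : (fun t => t - a + 1) = id + cst (1 - a).
    by apply/funext => u /=; rewrite addrAC -addrA.
  by apply: is_derive_eq; rewrite addr0.
have dF t : is_derive t (1 : R) F ((t - a) * expR (- t)).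
  apply: (is_derive_eq (is_deriveN (is_deriveM (dt t) (is_derive_expRN t)))).
  by rewrite !/(_ *: _) /=; ring.
have cF := is_derive_continuous dF.
have cta : continuous (fun t => t - a) by move=> t; apply: cvgB => //; exact: cvg_cst.
rewrite (@ge0_continuous_FTC2y _ _ F a 0).
- have -> : F a = - expR (- a) by rewrite /F; ring.
  by rewrite -EFinB sub0r opprK.
- by move=> t ta; rewrite mulr_ge0 ?subr_ge0// expR_ge0.
- apply: continuous_subspaceT => t; exact: (cvgM (@cta t) (@continuous_expRN R t)).
- have h1 : t * expR (- t) @[t --> +oo] --> (0 : R).
    apply: cvg_trans (cvgy_powR_expR (@ler01 R)); apply: near_eq_cvg.
    by near=> t; rewrite powRr1//; near: t; exact: nbhs_pinfty_ge.
  have h2 : (1 - a) * expR (- t) @[t --> +oo] --> (0 : R).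
    by rewrite -[X in _ --> X](mulr0 (1 - a)); apply: cvgM; [exact: cvg_cst|exact: cvgr_expR].
  have -> : F = (fun t => - (t * expR (- t) + (1 - a) * expR (- t))).
    by apply/funext => t; rewrite /F; ring.
  by have := cvgN (cvgD h1 h2); rewrite addr0 oppr0; exact.
- by move=> t _; case: (dF t).
- by apply: cvg_at_right_filter; exact: cF.
- by move=> t _; rewrite derive1E; exact: derive_val.
Unshelve. all: by end_near.
Qed.

(** The nonzero integers of absolute value at most M; leaving 0 out makes sums of
   even functions twice a sum over positive integers, and does not change the
   limit. *)
Definition nzint M (b : bool * 'I_M) : R := (-1) ^+ b.1 * b.2.+1%:R.

Lemma nzint_sqr M (b : bool * 'I_M) : nzint b ^+ 2 = b.2.+1%:R ^+ 2.
Proof. by rewrite /nzint exprMn sqrr_sign mul1r. Qed.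

Definition cell d M := {ffun 'I_d -> bool * 'I_M}.
Definition cell_sqr d M (z : cell d M) : R := \sum_l nzint (z l) ^+ 2.

Lemma cell_sqr_ge0 d M (z : cell d M) : 0 <= cell_sqr z.
Proof. by apply: sumr_ge0 => l _; exact: sqr_ge0. Qed.

(** The theta sum of a product lattice is a power. *)
Lemma sum_cell_expR d M s :
  \sum_(z : cell d M) expR (- (s * cell_sqr z)) =
  (2 * \sum_(m < M) expR (- (s * m.+1%:R ^+ 2))) ^+ d.
Proof.
have -> : 2 * \sum_(m < M) expR (- (s * m.+1%:R ^+ 2)) =
    \sum_(b : bool * 'I_M) expR (- (s * nzint b ^+ 2)).
  rewrite -(pair_bigA _ (fun b m => expR (- (s * nzint (b, m) ^+ 2)))) /=.
  rewrite big_bool /= mulr2n mulrDl mul1r.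
  by congr (_ + _); apply: eq_bigr => m _; rewrite nzint_sqr.
rewrite -[in RHS](card_ord d) -prodr_const bigA_distr_bigA /=.
apply: eq_bigr => z _; rewrite /cell_sqr mulr_sumr -sumrN expR_sum.
by apply: eq_bigr.
Qed.

Section lattice_gamma.
Variables (d : nat) (x T h0 : R).
Hypotheses (x0 : 0 < x) (h00 : 0 < h0).
Hypothesis lat : forall h M, 0 < h <= h0 ->
  h ^+ d * \sum_(z : cell d M) Num.max (x - h ^+ 2 * cell_sqr z) 0 <= T.

Let q : R := d%:R / 2.
Let y0 := x / h0 ^+ 2.
Let K := T / (x * x `^ q).
Let P M s t := \sum_(z : cell d M) Num.max (t - s * cell_sqr z) 0.

Let y00 : 0 < y0. Proof. by rewrite divr_gt0 ?exprn_gt0. Qed.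
Let q0 : 0 <= q. Proof. by rewrite divr_ge0. Qed.
Let T0 : 0 <= T.
Proof.
apply: le_trans (lat (h := h0) 0 _); last by rewrite h00 lexx.
by rewrite mulr_ge0 ?exprn_ge0 ?(ltW h00)// sumr_ge0// => z _; rewrite le_max lexx orbT.
Qed.
Let K0 : 0 <= K. Proof. by rewrite divr_ge0// mulr_ge0 ?powR_ge0// ltW. Qed.

(* For fixed s, the hypothesis at the mesh h with h^2 = x s / t is a bound at t;
   the mesh is at most h0 as soon as t >= s y0. *)
Let P_far M s t : 0 < s -> s * y0 <= t -> P M s t <= K / s `^ q * (t * t `^ q).
Proof.
move=> s0 st; have t0 : 0 < t by apply: lt_le_trans st; rewrite mulr_gt0.
have w0 : 0 < x * s / t by rewrite divr_gt0 ?mulr_gt0.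
pose h := Num.sqrt (x * s / t).
have hh : h ^+ 2 = x * s / t by rewrite sqr_sqrtr// ltW.
have hd : h ^+ d = x `^ q * s `^ q / t `^ q.
  rewrite -powR_mulrn ?sqrtr_ge0// /h -powR12_sqrt ?(ltW w0)// -powRrM.
  rewrite (_ : 2^-1 * d%:R = q); last by rewrite /q mulrC.
  rewrite !powRM ?mulr_ge0 ?invr_ge0 ?(ltW x0) ?(ltW s0) ?(ltW t0)//.
  by congr (_ * _); rewrite -powR_inv1 ?(ltW t0)// powRAC powR_inv1 ?powR_ge0.
have hh0 : 0 < h <= h0.
  rewrite sqrtr_gt0 w0/= -(@ler_pXn2r _ 2%N) ?nnegrE ?sqrtr_ge0 ?(ltW h00)// hh.
  rewrite ler_pdivrMr//; move: st; rewrite /y0 mulrA ler_pdivrMr ?exprn_gt0//.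
  by rewrite mulrC [t * _]mulrC.
have := lat M hh0.
have -> : \sum_(z : cell d M) Num.max (x - h ^+ 2 * cell_sqr z) 0 = x / t * P M s t.
  rewrite /P mulr_sumr; apply: eq_bigr => z _.
  rewrite maxr_pMr ?divr_ge0 ?(ltW x0) ?(ltW t0)// mulr0 hh; congr Num.max.
  by field; exact: lt0r_neq0.
have xq := powR_gt0 q x0; have sq := powR_gt0 q s0; have tq := powR_gt0 q t0.
have -> : K / s `^ q * (t * t `^ q) = T / (x `^ q * s `^ q / t `^ q * (x / t)).
  rewrite /K; field.
  by rewrite ?(lt0r_neq0 xq) ?(lt0r_neq0 sq) ?(lt0r_neq0 tq) ?(lt0r_neq0 x0) ?(lt0r_neq0 t0).
rewrite hd [X in X <= T -> _]mulrA => lT.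
rewrite ler_pdivlMr 1?[leLHS]mulrC//.
by rewrite mulr_gt0// divr_gt0// mulr_gt0.
Qed.

(* Small values of t are covered by monotonicity. *)
Let P_bound M s t : 0 < s -> 0 <= t ->
  P M s t <= K / s `^ q * (t * t `^ q + s * y0 * (s * y0) `^ q).
Proof.
move=> s0 t0; have sq := powR_gt0 q s0.
have Ks : 0 <= K / s `^ q by rewrite divr_ge0// ltW.
have sy : 0 <= s * y0 by rewrite mulr_ge0// ltW.
have [st|ts] := leP (s * y0) t.
  rewrite (le_trans (P_far M s0 st))// ler_wpM2l// lerDl.
  by rewrite mulr_ge0 ?powR_ge0.
apply: (@le_trans _ _ (P M s (s * y0))).
  apply: ler_sum => z _; rewrite ge_max !le_max lexx orbT andbT.
  by rewrite lerD2r (ltW ts).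
rewrite (le_trans (P_far M s0 (lexx _)))// ler_wpM2l// lerDr.
by rewrite mulr_ge0 ?powR_ge0.
Qed.

(* Integrated against e^-t, the left-hand side becomes a theta sum and the
   right-hand side a value of Gamma. *)
Let theta_bound M s : 0 < s ->
  (2 * \sum_(m < M) expR (- (s * m.+1%:R ^+ 2))) ^+ d <=
  K / s `^ q * (fine (gamma_int (1 + q)) + 2 * (s * y0 * (s * y0) `^ q)).
Proof.
move=> s0; rewrite -sum_cell_expR -lee_fin.
have sq := powR_gt0 q s0.
have Ks : 0 <= K / s `^ q by rewrite divr_ge0// ltW.
pose c := s * y0 * (s * y0) `^ q.
have c0 : 0 <= c := mulr_ge0 (mulr_ge0 (ltW s0) (ltW y00)) (powR_ge0 _ _).
have p0 : 0 <= 1 + q by rewrite addr_ge0.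
pose D : set R := `[0%R, +oo[%classic.
have mD : measurable D := measurable_itv _.
have mE : measurable_fun D (fun t : R => expR (- t)).
  apply: measurable_funTS; exact: (continuous_measurable_fun (@continuous_expRN R)).
have mEh := @measurable_expR_half R D.
have mM a : measurable_fun D (fun t : R => expR (- t) * Num.max (t - a) 0).
  apply: measurable_funM => //; apply: measurable_maxr => //.
  exact: measurable_funB.
have -> : ((\sum_(z : cell d M) expR (- (s * cell_sqr z)))%:E =
    \int[leb]_(t in `[0%R, +oo[) (expR (- t) * P M s t)%:E)%E.
  transitivity (\sum_(z : cell d M) \int[leb]_(t in `[0%R, +oo[)
      (expR (- t) * Num.max (t - s * cell_sqr z) 0)%:E)%E.
    rewrite -sumEFin; apply: eq_bigr => z _; rewrite laplace_pospart//.
    by rewrite mulr_ge0 ?cell_sqr_ge0// ltW.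
  rewrite -ge0_integral_sum//.
  - by apply: eq_integral => t _; rewrite sumEFin mulr_sumr.
  - by move=> z; apply/measurable_EFinP; exact: mM.
  - by move=> z t _; rewrite lee_fin mulr_ge0 ?expR_ge0// le_max lexx orbT.
apply: (@le_trans _ _ (\int[leb]_(t in `[0%R, +oo[)
    ((K / s `^ q)%:E * ((t `^ (1 + q) * expR (- t))%:E + c%:E * (expR (- (t / 2)))%:E)))%E).
  apply: ge0_le_integral => //.
  - move=> t _; rewrite lee_fin mulr_ge0 ?expR_ge0// sumr_ge0// => z _.
    by rewrite le_max lexx orbT.
  - apply/measurable_EFinP.
    have -> : (fun t => expR (- t) * P M s t) =
      (fun t => \sum_(z : cell d M) expR (- t) * Num.max (t - s * cell_sqr z) 0).
      by apply/funext => t; rewrite mulr_sumr.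
    by apply: measurable_sum => z; exact: mM.
  - apply/measurable_EFinP; apply: measurable_funM => //; apply: measurable_funD.
      by apply: measurable_funTS; exact: measurable_powR_expR.
    exact: measurable_funM.
  move=> t; rewrite /= in_itv/= andbT => t0.
  rewrite -?EFinM -?EFinD -?EFinM lee_fin.
  apply: (@le_trans _ _ (expR (- t) * (K / s `^ q * (t * t `^ q + c)))).
    by rewrite ler_wpM2l ?expR_ge0// P_bound.
  rewrite mulrCA ler_wpM2l// mulrDr lerD//.
    have -> : t `^ (1 + q) = t * t `^ q.
      by rewrite -[1 + q]addrC -mulr_powRB1 ?ltr_wpDl// addrK.
    by rewrite mulrC.
  rewrite mulrC ler_wpM2l// ler_expR; lra.
have mg : measurable_fun D (fun t : R => (t `^ (1 + q) * expR (- t))%:E).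
  by apply/measurable_EFinP/measurable_funTS; exact: measurable_powR_expR.
have mh : measurable_fun D (fun t : R => (c%:E * (expR (- (t / 2)))%:E)%E).
  by apply/measurable_EFinP; exact: measurable_funM.
have g0 t : (0 <= (t `^ (1 + q) * expR (- t))%:E)%E.
  by rewrite lee_fin mulr_ge0 ?powR_ge0 ?expR_ge0.
have hc0 t : (0 <= c%:E * (expR (- (t / 2)))%:E)%E.
  by rewrite -EFinM lee_fin mulr_ge0 ?expR_ge0.
rewrite ge0_integralZl//; last 2 first.
- exact: (emeasurable_funD mg mh).
- by move=> t _; rewrite adde_ge0.
rewrite ge0_integralD// ge0_integralZl//; last exact/measurable_EFinP.
have gE := fineK (gamma_int_fin p0); set g := fine (gamma_int (1 + q)) in gE *.
rewrite integral_expR_half -/(gamma_int (1 + q)) -gE.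
by rewrite -?EFinM -?EFinD -?EFinM lee_fin (mulrC 2).
Qed.

Let G (y : R) := \int[leb]_(t in `[0, y]) gauss_fun t.

(* For s = 1 / N^2 the theta sum is a Riemann sum of the Gaussian. *)
Let theta_bound_nat N : (0 < N)%N -> 0 <= 2 * G N%:R - 2 / N%:R ->
  (2 * G N%:R - 2 / N%:R) ^+ d <=
  K * (fine (gamma_int (1 + q)) + 2 * (y0 * y0 `^ q) / N%:R).
Proof.
move=> N0 lb0; have N0' : 0 < N%:R :> R by rewrite ltr0n.
have lb := @gauss_sum_lower R N N0; rewrite -/(G _) in lb.
apply: (@le_trans _ _ ((2 / N%:R * \sum_(m < N ^ 2) gauss_fun (m.+1%:R / N%:R)) ^+ d)).
  by rewrite lerXn2r ?nnegrE// (le_trans lb0).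
pose s : R := N%:R ^- 2.
have s0 : 0 < s by rewrite invr_gt0 exprn_gt0.
have sq : s `^ q = N%:R ^- d.
  rewrite /s /q -exprVn -powR_mulrn ?invr_ge0 ?(ltW N0')// -powRrM mulrC divfK//.
  by rewrite powR_mulrn ?invr_ge0 ?(ltW N0')// exprVn.
have s1 : s <= N%:R^-1.
  rewrite /s lef_pV2 ?posrE ?exprn_gt0// expr2 ler_peMr ?(ltW N0')//.
  by rewrite ler1n.
have s1' : s <= 1 by rewrite (le_trans s1)// invf_le1// ler1n.
have := theta_bound (N ^ 2) s0; rewrite sq invrK => h.
have -> : (2 / N%:R * \sum_(m < N ^ 2) gauss_fun (m.+1%:R / N%:R)) ^+ d =
    N%:R ^- d * (2 * \sum_(m < N ^ 2) expR (- (s * m.+1%:R ^+ 2))) ^+ d.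
  rewrite -exprVn -exprMn; congr (_ ^+ d); rewrite mulrCA mulrA; congr (_ * _).
  by apply: eq_bigr => m _; rewrite /gauss_fun exprMn exprVn mulrC.
rewrite ler_pdivrMl ?exprn_gt0// (le_trans h)// [K * N%:R ^+ d]mulrC [leRHS]mulrA.
have sy0 : 0 <= s * y0 := mulr_ge0 (ltW s0) (ltW y00).
have h2 : (s * y0) `^ q <= y0 `^ q.
  by apply: ge0_ler_powR; rewrite ?nnegrE ?(ltW y00)// ler_piMl// ltW.
have h3 : s * y0 <= N%:R^-1 * y0 by rewrite ler_wpM2r// ltW.
have h4 := ler_pM sy0 (powR_ge0 _ _) h3 h2.
have NK : 0 <= N%:R ^+ d * K := mulr_ge0 (exprn_ge0 d (ltW N0')) K0.
rewrite (ler_wpM2l NK)// lerD2l -[leRHS]mulrA ler_wpM2l//.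
by apply: (le_trans h4); rewrite -[leLHS]mulrA [leLHS]mulrC.
Qed.

(** A bound on lattice sums of (x - |xi|^2)_+, for all small meshes, implies the
   bound by the integral x^(1 + d/2) pi^(d/2) / Gamma (2 + d/2) that these sums
   approximate. The integral is never computed: homogeneity turns the bound at x
   for all meshes into one at all t for a given mesh, whose Laplace transform
   compares a theta sum with Gamma; as the mesh tends to 0 the theta sum tends to
   the d-th power of the Gaussian integral. *)
Lemma lattice_gamma_limit :
  x * x `^ q * Num.sqrt pi ^+ d <= T * fine (gamma_int (1 + q)).
Proof.
have xq : 0 < x * x `^ q by rewrite mulr_gt0// powR_gt0.
suff : Num.sqrt pi ^+ d <= K * fine (gamma_int (1 + q)).
  by rewrite /K mulrAC ler_pdivlMr// mulrC.
have inv0 : (fun n => n.+1%:R^-1) @ \oo --> (0 : R) by exact: cvg_harmonic.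
have cG : (fun n => G n.+1%:R) @ \oo --> (Num.sqrt pi / 2 : R).
  by have := @cvg_gauss_nat R; rewrite -(cvg_shiftS (fun n => G n%:R)).
have cL : (fun n => 2 * G n.+1%:R - 2 / n.+1%:R) @ \oo --> (Num.sqrt pi : R).
  have := cvgB (cvgM (cvg_cst (2 : R)) cG) (cvgM (cvg_cst (2 : R)) inv0).
  by rewrite mulr0 subr0 mulrCA divff// mulr1; exact.
have cR : (fun n => K * (fine (gamma_int (1 + q)) + 2 * (y0 * y0 `^ q) / n.+1%:R)) @ \oo
    --> K * fine (gamma_int (1 + q)).
  have := cvgM (cvg_cst K) (cvgD (cvg_cst (fine (gamma_int (1 + q))))
    (cvgM (cvg_cst (2 * (y0 * y0 `^ q))) inv0)).
  by rewrite mulr0 addr0; exact.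
have cLd : (fun n => (2 * G n.+1%:R - 2 / n.+1%:R) ^+ d) @ \oo --> (Num.sqrt pi ^+ d : R).
  exact: (cvg_comp _ _ cL (@exprn_continuous R d _)).
rewrite -(cvg_lim _ cLd)// -(cvg_lim _ cR)//.
apply: ler_lim; [exact: cvgP cLd|exact: cvgP cR|].
have : \forall n \near \oo, 0 < 2 * G n.+1%:R - 2 / n.+1%:R.
  by apply: (cvgr_gt _ cL); rewrite sqrtr_gt0 pi_gt0.
by apply: filterS => n /ltW h; exact: theta_bound_nat.
Qed.

End lattice_gamma.
End lattice.

(** * The phase-space bound and the theorem *)

Section lattice_frequencies.
Context {R : realType}.

Lemma sin_natpi (m : nat) : sin (m%:R * pi) = 0 :> R.
Proof.
elim: m => [|m IH]; first by rewrite mul0r sin0.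
by rewrite -addn1 natrD mulrDl mul1r sinDpi IH oppr0.
Qed.

Lemma sin_nzintpi M (b : bool * 'I_M) : sin (nzint b * pi) = 0 :> R.
Proof.
rewrite /nzint; case: (b.1); rewrite ?expr1 ?expr0 ?mul1r ?sin_natpi//.
by rewrite mulN1r mulNr sinN sin_natpi oppr0.
Qed.

Lemma nzint_inj M : injective (@nzint R M).
Proof.
move=> [b i] [c j] e.
have : nzint (b, i) ^+ 2 = nzint (c, j) ^+ 2 :> R by rewrite e.
rewrite !nzint_sqr /= => /eqP; rewrite eqrXn2 ?ler0n// eqr_nat eqSS => /eqP/val_inj ij.
move: e; rewrite /nzint /= ij => /mulIf; rewrite pnatr_eq0 => /(_ isT) e; congr pair.
exact: signr_inj e.
Qed.

End lattice_frequencies.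

Section volume.
Context {R : realType}.

(** Omega contains a cube and is contained in another one. *)
Lemma volume_gt0 d (Omega : set 'rV[R]_d) : open Omega -> Omega !=set0 ->
  bounded_set Omega -> 0 < volume Omega.
Proof.
move=> oO [x Ox] bO; have mO := open_measurable_rV oO.
have [L L0 OL] := bounded_set_box bO.
have [e e0 eO] := nbhs_ball_rV (open_nbhs_nbhs (conj oO Ox)).
pose A (i : 'I_d) : set R := `]x ord0 i - e, x ord0 i + e[%classic.
have AO : [set y : 'rV[R]_d | forall i, A i (y ord0 i)] `<=` Omega.
  move=> y Ay; apply: eO => i; have := Ay i; rewrite /A /= in_itv/=.
  by rewrite ltr_distlC.
have mA : measurable [set y : 'rV[R]_d | forall i, A i (y ord0 i)].
  by apply: measurable_rV_box => i; exact: measurable_itv.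
rewrite fine_gt0//; apply/andP; split.
  apply: (@lt_le_trans _ _ (lebesgue_rV d [set y : 'rV[R]_d | forall i, A i (y ord0 i)])).
    rewrite (@lebesgue_rV_prod R d A) => [|i]; last exact: measurable_itv.
    rewrite (eq_bigr (fun=> (2 * e)%:E)) => [|i _].
      by rewrite prodEFin lte_fin prodr_gt0// => i _; rewrite mulr_gt0.
    rewrite lebesgue_measure_itv/= lte_fin ifT; last by lra.
    by rewrite -EFinB; congr _%:E; lra.
  by apply: le_measure; rewrite ?inE.
apply: (@le_lt_trans _ _ (lebesgue_rV d (box L))).
  by apply: le_measure; rewrite ?inE//; exact: measurable_box.
by rewrite lebesgue_rV_box ?ltry// ltW.
Qed.

End volume.

Section final.
Context {R : realType}.

(** Bernoulli's inequality y^(d/2) >= 1 + (d/2) (y - 1) for y = w^2. *)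
Lemma bernoulli_half (d : nat) (w : R) : (2 <= d)%N -> 0 <= w ->
  1 + d%:R / 2 * (w ^+ 2 - 1) <= w ^+ d.
Proof.
move=> d2 w0; elim: d d2 => // d IH; rewrite leq_eqVlt => /predU1P[<-|d2].
  by rewrite divff// mul1r addrC subrK.
have {}IH := IH d2; rewrite [leRHS]exprS.
have dR : 1 <= d%:R :> R by rewrite ler1n ltnW.
apply: (@le_trans _ _ (w * (1 + d%:R / 2 * (w ^+ 2 - 1)))); last by rewrite ler_wpM2l.
rewrite -natr1 -subr_ge0.
have -> : w * (1 + d%:R / 2 * (w ^+ 2 - 1)) - (1 + (d%:R + 1) / 2 * (w ^+ 2 - 1)) =
  (w - 1) ^+ 2 / 2 * (d%:R * (w + 1) - 1) by field.
rewrite mulr_ge0 ?divr_ge0 ?sqr_ge0// subr_ge0.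
by rewrite (le_trans dR)// ler_peMr ?ler0n// lerDr.
Qed.

Lemma powR_half (a : R) (d : nat) : 0 <= a -> a `^ (d%:R / 2) = Num.sqrt a ^+ d.
Proof.
by move=> a0; rewrite mulrC powRrM powR12_sqrt// powR_mulrn// sqrtr_ge0.
Qed.

End final.

Section sharp.
Context {R : realType}.

(** Kroeger's inequality on the lattice h Z^d, which is separated on the box of
   half-side L = pi / h; every h <= pi / L1 makes this box contain Omega. *)
Lemma phase_space_bound d (Omega : set 'rV[R]_d) (mu : nat -> R) (k : nat) :
  open Omega -> Omega !=set0 -> bounded_set Omega ->
  neumann_eigenvalues Omega mu -> 0 <= mu 1%N -> 0 < mu k.+1 ->
  mu k.+1 * mu k.+1 `^ (d%:R / 2) * Num.sqrt pi ^+ d * volume Omega <=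
  (2 * pi) ^+ d * (\sum_(j < k) (mu k.+1 - mu j.+1)) *
    fine (gamma_int (1 + d%:R / 2)).
Proof.
move=> oO nO bO ev mu1 x0; have vol0 := volume_gt0 oO nO bO.
have mO := open_measurable_rV oO.
have [L1 L10 OL1] := bounded_set_box bO.
pose S := \sum_(j < k) (mu k.+1 - mu j.+1).
have pi0 : 0 < pi :> R := pi_gt0 R.
have h00 : 0 < pi / L1 by rewrite divr_gt0.
have lat h M : 0 < h <= pi / L1 ->
    h ^+ d * \sum_(z : cell d M) Num.max (mu k.+1 - h ^+ 2 * cell_sqr z) 0 <=
    (2 * pi) ^+ d * S / volume Omega.
  move=> /andP[h0 hL]; pose L := pi / h.
  have L0 : 0 < L by rewrite divr_gt0.
  have OL : Omega `<=` box L.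
    move=> y /OL1/box_norm By; apply/box_norm => i; rewrite (le_trans (By i))//.
    by rewrite /L ler_pdivlMr// mulrC -ler_pdivlMr.
  have hLpi : h * L = pi by rewrite /L mulrCA divff ?mulr1// gt_eqF.
  have sep (z z' : cell d M) : z != z' -> exists l,
      h * nzint (z l) != h * nzint (z' l) /\ sin ((h * nzint (z l) - h * nzint (z' l)) * L) = 0.
    move=> zz'; have [l zl] : exists l, z l != z' l.
      apply: contrapT => H; move/negP : zz'; apply; apply/eqP/ffunP => l.
      by apply/eqP/negPn/negP => ?; apply: H; exists l.
    exists l; split.
      by apply: contra zl => /eqP/(mulfI (lt0r_neq0 h0))/nzint_inj ->.
    rewrite -mulrBr mulrAC hLpi mulrC mulrBl sinB !sin_nzintpi.
    by rewrite mul0r mulr0 subrr.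
  have := kroeger_frequencies mO L0 OL k ev mu1 sep.
  have -> : \sum_(z : cell d M) Num.max (mu k.+1 - \sum_l (h * nzint (z l)) ^+ 2) 0 =
      \sum_(z : cell d M) Num.max (mu k.+1 - h ^+ 2 * cell_sqr z) 0.
    apply: eq_bigr => z _; congr (Num.max (_ - _) _).
    by rewrite /cell_sqr mulr_sumr; apply: eq_bigr => l _; rewrite exprMn.
  rewrite -/S => le1; rewrite ler_pdivlMr// -mulrA mulrC -ler_pdivlMr ?exprn_gt0//.
  rewrite mulrC (le_trans le1)// le_eqVlt; apply/orP; left; apply/eqP.
  by rewrite /L mulrA expr_div_n; ring.
have := lattice_gamma_limit x0 h00 lat.
rewrite [X in _ <= X -> _]mulrAC ler_pdivlMr//; exact.
Qed.

(** With y = mu (k + 1) / m_k and q = d / 2, the phase-space bound reads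
   y^(1 + q) <= (1 + q) y - q S_k, and y^q >= 1 + q (y - 1) makes it
   S_k <= 2 y - y^2. *)
Lemma kroeger_parabola d (Omega : set 'rV[R]_d) (mu : nat -> R) (k : nat) :
  (2 <= d)%N -> (1 <= k)%N -> open Omega -> Omega !=set0 -> bounded_set Omega ->
  neumann_eigenvalues Omega mu -> 0 <= mu 1%N -> 0 < mu k.+1 ->
  0 < weyl_m Omega k /\
  (mu k.+1 - weyl_m Omega k) ^+ 2 <= weyl_m Omega k ^+ 2 * (1 - weyl_S Omega mu k).
Proof.
move=> d2 k1 oO nO bO ev mu1 x0; have vol0 := volume_gt0 oO nO bO.
have := phase_space_bound oO nO bO ev mu1 x0.
have d0 : 0 < d%:R :> R by rewrite ltr0n ltnW.
have k0 : 0 < k%:R :> R by rewrite ltr0n.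
pose q : R := d%:R / 2; have q0 : 0 < q by rewrite divr_gt0.
have pi0 : 0 < pi :> R := pi_gt0 R.
pose g : R := Gamma (1 + q).
have gE : fine (gamma_int (1 + q)) = (1 + q) * g.
  rewrite gamma_int_rec ?ltrDl// (addrC 1 q) addrK fineM//; last first.
    by rewrite gamma_int_fin// ltW.
  by rewrite /g (addrC 1 q) GammaE.
rewrite -/q gE; set x := mu k.+1; pose M := \sum_(j < k) mu j.+1.
have -> : \sum_(j < k) (x - mu j.+1) = k%:R * x - M.
  by rewrite sumrB sumr_const card_ord mulr_natl.
have -> : Num.sqrt pi ^+ d = pi `^ q :> R by rewrite powR_half// ltW.
move=> main; have xq := powR_gt0 q x0; have piq := powR_gt0 q pi0.
have g0 : 0 < g.
  rewrite lt_neqAle; apply/andP; split; last first.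
    by apply: Rintegral_ge0 => t _; rewrite mulr_ge0 ?powR_ge0 ?expR_ge0.
  apply: contraTneq main => <-; rewrite !mulr0 -ltNge.
  by rewrite !mulr_gt0.
pose B := ball_volume d : R.
have BE : B = pi `^ q / g by [].
have B0 : 0 < B by rewrite BE divr_gt0.
set m := weyl_m Omega k.
have m0 : 0 < m.
  apply: mulr_gt0; last by rewrite powR_gt0// divr_gt0.
  by apply: mulr_gt0; [rewrite exprn_gt0// mulr_gt0|exact: powR_gt0].
have mq : m `^ q = (2 * pi) ^+ d * (k%:R / (B * volume Omega)).
  have q1 : 2 / d%:R * q = 1 by rewrite /q; field; exact: lt0r_neq0.
  have e1 : ((2 * pi) ^+ 2) `^ q = (2 * pi) ^+ d :> R.
    rewrite powR_half ?sqr_ge0// sqrtr_sqr ger0_norm//.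
    by rewrite mulr_ge0// ltW.
  have e2 : (B `^ (- 2 / d%:R)) `^ q = B^-1.
    by rewrite -powRrM mulNr mulNr q1 powR_inv1// ltW.
  have kv0 : 0 <= k%:R / volume Omega by rewrite divr_ge0// ltW.
  have e3 : ((k%:R / volume Omega) `^ (2 / d%:R)) `^ q = k%:R / volume Omega.
    by rewrite -powRrM q1 powRr1.
  have h1 : 0 <= (2 * pi) ^+ 2 * B `^ (- 2 / d%:R) by rewrite mulr_ge0 ?sqr_ge0 ?powR_ge0.
  rewrite /m /weyl_m /weyl_constant -/B (powRM _ h1 (powR_ge0 _ _)).
  rewrite (powRM _ (sqr_ge0 _) (powR_ge0 _ _)) e1 e2 e3.
  by field; rewrite !lt0r_neq0.
pose y := x / m; have y0 : 0 < y by rewrite divr_gt0.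
have xE : x = m * y by rewrite /y mulrCA divff ?mulr1// gt_eqF.
have yq : 1 + q * (y - 1) <= y `^ q.
  have := bernoulli_half d2 (sqrtr_ge0 y); rewrite sqr_sqrtr ?(ltW y0)//.
  by rewrite /q powR_half// ltW.
have le1 : k%:R * m * y * y `^ q <= (1 + q) * (k%:R * x - M).
  have xqE : x `^ q = m `^ q * y `^ q by rewrite xE powRM// ltW.
  have c0 : 0 < (2 * pi) ^+ d * g by rewrite mulr_gt0// exprn_gt0// mulr_gt0.
  rewrite -(ler_pM2l c0); move: main; rewrite xqE mq.
  have -> : x * ((2 * pi) ^+ d * (k%:R / (B * volume Omega)) * y `^ q) * pi `^ q * volume Omega =
      (2 * pi) ^+ d * g * (k%:R * m * y * y `^ q).
    rewrite BE {1}xE; field; rewrite !lt0r_neq0//.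
  move=> /le_trans; apply; rewrite le_eqVlt; apply/orP; left; apply/eqP; ring.
have SE : weyl_S Omega mu k = (1 + q) / q * (M / k%:R) / m.
  rewrite /weyl_S -/m big_add1 big_mkord -/M /q; field.
  by rewrite !lt0r_neq0.
split=> //; rewrite SE xE.
have le2 : (1 + q) * (M / k%:R) <= m * ((1 + q) * y - y * y `^ q).
  rewrite mulrA ler_pdivrMr//; move: le1; rewrite xE; lra.
have le3 : (1 + q) * (M / k%:R) / m <= (1 + q) * y - y * y `^ q.
  by rewrite ler_pdivrMr// [leRHS]mulrC.
have le4 : y * (1 + q * (y - 1)) <= y * y `^ q by rewrite ler_pM2l.
have le5 : (1 + q) / q * (M / k%:R) / m <= 2 * y - y ^+ 2.
  rewrite -(ler_pM2l q0).
  have -> : q * ((1 + q) / q * (M / k%:R) / m) = (1 + q) * (M / k%:R) / m.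
    by field; rewrite !lt0r_neq0.
  by rewrite (le_trans le3)//; move: le4; lra.
have -> : (m * y - m) ^+ 2 = m ^+ 2 * (1 - (2 * y - y ^+ 2)) by ring.
by rewrite ler_pM2l ?exprn_gt0// lerD2l lerN2.
Qed.

End sharp.

Theorem theorem1p1 (R : realType) (d : nat) (hd : (2 <= d)%N)
  (Omega : set 'rV[R]_d)
  (Omega_open : open Omega) (Omega_connected : connected Omega)
  (Omega_nonempty : Omega !=set0) (Omega_bounded : bounded_set Omega)
  (mu : nat -> R) (mu_eigenvalues : neumann_eigenvalues Omega mu)
  (mu1 : mu 1%N = 0) (mu2 : 0 < mu 2%N) :
  forall k : nat, (1 <= k)%N ->
    let m := weyl_m Omega k in
    let S := weyl_S Omega mu k in
    (mu k.+1 - m) ^+ 2 <= m ^+ 2 * (1 - S) /\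
    (m * (1 - Num.sqrt (1 - S)) <= mu k.+1 /\
     mu k.+1 <= m * (1 + Num.sqrt (1 - S))).
Proof.
move=> k k1 m S; have [mu_le _ _ _] := mu_eigenvalues.
have x0 : 0 < mu k.+1 by rewrite (lt_le_trans mu2)// mu_le.
have mu10 : 0 <= mu 1%N by rewrite mu1.
have [m0 H] := kroeger_parabola hd k1 Omega_open Omega_nonempty Omega_bounded
  mu_eigenvalues mu10 x0.
rewrite -/m -/S in m0 H; split=> //.
have : `|mu k.+1 - m| <= m * Num.sqrt (1 - S).
  rewrite -sqrtr_sqr -{2}(ger0_norm (ltW m0)) -sqrtr_sqr -sqrtrM ?sqr_ge0//.
  exact: ler_wsqrtr.
by rewrite ler_norml => /andP[h1 h2]; split; lra.
Qed.
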